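(* Let $p_+$ and $p_-$ be compatible parameter sets and let $\alpha$ be a real number with $R(p_+)<\alpha<R(p_-)^{-1}$. Let $L(\alpha,\alpha^{-1})=\lambda_1(p_+,p_-;\alpha,\alpha^{-1})$ be the length of the longest increasing subsequence of the random multiset $M(p_+,p_-;\alpha_+,\alpha_-)$ with $\alpha_+=\alpha$, $\alpha_-=\alpha^{-1}$. Then $$\mathbf{E}\left(L(\alpha,\alpha^{-1})\right)=\frac{\alpha E'(\alpha;p_-)}{E(\alpha;p_-)}+\frac{\alpha^{-1}E'(\alpha^{-1};p_+)}{E(\alpha^{-1};p_+)},$$ where $E'(z;p)=\frac{d}{dz}E(z;p)$.
   Context: A parameter set is a triple $p=(t,q,r)$, where $t\ge 0$ is real and $q=(q_i)_{i\ge1}$, $r=(r_i)_{i\ge1}$ are sequences of nonnegative reals with $\sum_i q_i+\sum_i r_i<\infty$. Put $Q(p)=\sup_i q_i$, $R(p)=\sup_i r_i$ (with $0^{-1}=+\infty$), and for $|z|<R(p)^{-1}$ put $$E(z;p)=e^{tz}\prod_i (1+zq_i)(1-zr_i)^{-1}.$$ Parameter sets $p_+=(t^+,q^+,r^+)$ and $p_-=(t^-,q^-,r^-)$ are compatible if $Q(p_+)Q(p_-)<1$ and $R(p_+)R(p_-)<1$. Random variables: $P(s)$ is Poisson of mean $s$; $g(s)$ is geometric of parameter $s$, i.e. $\Pr(g(s)=k)=(1-s)s^k$ for $k\ge0$; $b(s)$ equals $1$ with probability $\frac{s}{1+s}$ and $0$ with probability $\frac1{1+s}$. Let $(\mathbb{Z}^+)'=\{1',2',\dots\}$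 be a disjoint copy of $\mathbb{Z}^+=\{1,2,\dots\}$, and $\Omega=[0,1]\uplus\mathbb{Z}^+\uplus(\mathbb{Z}^+)'$. The random multiset $M(p_+,p_-)$ in $\Omega\times\Omega$ is obtained as follows, with all choices independent: - on $[0,1]\times[0,1]$: $P(t^+t^-)$ i.i.d. uniform points; - on $[0,1]\times\{i\}$: $P(t^+q^-_i)$ i.i.d. uniform points; on $[0,1]\times\{i'\}$: $P(t^+r^-_i)$ i.i.d. uniform points; on $\{i\}\times[0,1]$: $P(q^+_it^-)$ i.i.d. uniform points; on $\{i'\}\times[0,1]$: $P(r^+_it^-)$ i.i.d. uniform points; - the point $(i,j)$ has multiplicity $g(q^+_iq^-_j)$; $(i,j')$ has multiplicity $b(q^+_ir^-_j)$; $(i',j)$ has multiplicity $b(r^+_iq^-_j)$; $(i',j')$ has multiplicity $g(r^+_ir^-_j)$. Extended model: let $\Omega^+=\Omega\uplus\{\Sigma\}$. For $\alpha_+,\alpha_-\ge0$ with $\alpha_+R(p_-)<1$ and $\alpha_-R(p_+)<1$, the random multiset $M(p_+,p_-;\alpha_+,\alpha_-)$ in $\Omega^+\times\Omega^+$ consists of $M(p_+,p_-)$ on $\Omega\times\Omega$ together with, independently: - on $[0,1]\times\{\Sigma\}$: $P(\alpha_-t^+)$ i.i.d. uniform points; $(i,\Sigma)$ has multiplicity $b(\alpha_-q^+_i)$; $(i',\Sigma)$ has multiplicity $g(\alpha_-r^+_i)$; - on $\{\Sigma\}\times[0,1]$: $P(\alpha_+t^-)$ i.i.d. uniform points; $(\Sigma,i)$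 has multiplicity $b(\alpha_+q^-_i)$; $(\Sigma,i')$ has multiplicity $g(\alpha_+r^-_i)$; - $(\Sigma,\Sigma)$ has multiplicity $0$. Fix two total orderings $\le_+$ and $\le_-$ on $\Omega$, each restricting to the usual order on $[0,1]$, and extend them to $\Omega^+$ by making $\Sigma$ the smallest element in both. (The orderings are otherwise arbitrary; the distributions considered do not depend on them.) A subsequence of a multiset $M$ is a finite sequence of points $(x_k,y_k)$ of $M$ in which no point occurs more often than its multiplicity in $M$. It is increasing if for all $k$ one has $x_k\le_+x_{k+1}$ and $y_k\le_-y_{k+1}$, and moreover $x_k=x_{k+1}$ implies $x_k\notin\mathbb{Z}^+$, and $y_k=y_{k+1}$ implies $y_k\notin\mathbb{Z}^+$ (so equality is allowed in $[0,1]$, in $(\mathbb{Z}^+)'$ and at $\Sigma$). Its length is its number of terms. $\lambda_1(p_+,p_-;\alpha_+,\alpha_-)$ denotes the maximal length of an increasing subsequence of $M(p_+,p_-;\alpha_+,\alpha_-)$; it is finite with probability 1. *)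

(* Defs.v *)
From HB Require Import structures.
From mathcomp Require Import all_boot all_order all_algebra.
From mathcomp Require Import all_classical all_reals all_analysis.

Set Implicit Arguments.
Unset Strict Implicit.
Unset Printing Implicit Defensive.

Import Order.TTheory GRing.Theory Num.Theory.
Import numFieldNormedType.Exports.

Local Open Scope classical_set_scope.
Local Open Scope ring_scope.

(* Sequences indexed by {1, 2, ...}, and the alphabets Z^+ and (Z^+)', are     *)
(* indexed from 0: the natural number i stands for i + 1.                      *)
Record param (R : realType) := Param {
  pt : R;
  pq : nat -> R;
  pr : nat -> R;
  pt_ge0 : 0 <= pt;
  pq_ge0 : forall i, 0 <= pq i;
  pr_ge0 : forall i, 0 <= pr i;
  p_summable : (\sum_(0 <= i <oo) (pq i)%:E + \sum_(0 <= i <oo) (pr i)%:E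
                < +oo)%E }.

Definition supQ (R : realType) (p : param R) : R := sup (range (pq p)).
Definition supR (R : realType) (p : param R) : R := sup (range (pr p)).

(* Only meaningful for |z| < (supR p)^-1, where the product converges.         *)
Definition Egen (R : realType) (p : param R) (z : R) : R :=
  expR (pt p * z) *
  limn (fun n : nat => \prod_(i < n) ((1 + z * pq p i) * (1 - z * pr p i)^-1)).

Definition compatible (R : realType) (pp pm : param R) : Prop :=
  supQ pp * supQ pm < 1 /\ supR pp * supR pm < 1.

(* The library's poisson_pmf is not a probability mass function at rate 0,     *)
(* a rate which does occur here.                                               *)
Definition poisson_mass (R : realType) (s : R) (k : nat) : R :=
  s ^+ k / k`!%:R * expR (- s).

Definition geom_mass (R : realType) (s : R) (k : nat) : R := (1 - s) * s ^+ k.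

Definition bern_mass (R : realType) (s : R) (k : nat) : R :=
  match k with
  | 0 => 1 / (1 + s)
  | 1 => s / (1 + s)
  | _ => 0
  end.

Definition zero_mass (R : realType) (k : nat) : R := (k == 0)%:R.

Definition unit01 (R : realType) := {x : R | 0 <= x <= 1}.

Inductive Omega (R : realType) :=
  | Oreal of unit01 R
  | Oint of nat
  | Oint' of nat.
Arguments Oint {R}.
Arguments Oint' {R}.

HB.instance Definition _ (R : realType) := gen_eqMixin (Omega R).

(* In the extended alphabet, None is the extra letter Sigma.                   *)
Definition OmegaS (R : realType) := option (Omega R).

(* The blocks [0,1], {i}, {i'} of Omega, and {Sigma} for None. The random      *)
(* multiset is sampled on each product of two blocks.                          *)
Inductive block := Breal | Bint of nat | Bint' of nat.

HB.instance Definition _ := gen_eqMixin block.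

Definition block_of (R : realType) (x : OmegaS R) : option block :=
  omap (fun y => match y with
                 | Oreal _ => Breal
                 | Oint i => Bint i
                 | Oint' i => Bint' i
                 end) x.

(* The element of the block a at position u (u matters only for a = [0,1]).    *)
Definition block_elt (R : realType) (a : option block) (u : unit01 R) :
    OmegaS R :=
  omap (fun b => match b with
                 | Breal => Oreal u
                 | Bint i => Oint i
                 | Bint' i => Oint' i
                 end) a.

(* The law of the number of points, with multiplicity, in a x b.               *)
Definition count_mass (R : realType) (pp pm : param R) (ap am : R)
    (a b : option block) : nat -> R :=
  match a, b with
  | Some Breal, Some Breal => poisson_mass (pt pp * pt pm)
  | Some Breal, Some (Bint i) => poisson_mass (pt pp * pq pm i)
  | Some Breal, Some (Bint' i) => poisson_mass (pt pp * pr pm i)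
  | Some (Bint i), Some Breal => poisson_mass (pq pp i * pt pm)
  | Some (Bint' i), Some Breal => poisson_mass (pr pp i * pt pm)
  | Some (Bint i), Some (Bint j) => geom_mass (pq pp i * pq pm j)
  | Some (Bint i), Some (Bint' j) => bern_mass (pq pp i * pr pm j)
  | Some (Bint' i), Some (Bint j) => bern_mass (pr pp i * pq pm j)
  | Some (Bint' i), Some (Bint' j) => geom_mass (pr pp i * pr pm j)
  | Some Breal, None => poisson_mass (am * pt pp)
  | Some (Bint i), None => bern_mass (am * pq pp i)
  | Some (Bint' i), None => geom_mass (am * pr pp i)
  | None, Some Breal => poisson_mass (ap * pt pm)
  | None, Some (Bint i) => bern_mass (ap * pq pm i)
  | None, Some (Bint' i) => geom_mass (ap * pr pm i)
  | None, None => @zero_mass R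
  end.

Definition mutually_independent (R : realType) (d : measure_display)
    (T : measurableType d) (P : probability T R) (I : eqType)
    (F : I -> set_system T) : Prop :=
  forall (J : seq I) (A : I -> set T), uniq J ->
    (forall i, i \in J -> F i (A i)) ->
    P (\bigcap_(i in [set` J]) A i) = (\prod_(i <- J) P (A i))%E.

Definition uniform01 (R : realType) (d : measure_display)
    (T : measurableType d) (P : probability T R) (U : T -> unit01 R) : Prop :=
  measurable_fun [set: T] (fun w => val (U w)) /\
  forall A : set R, measurable A ->
    P [set w | A (val (U w))] = uniform_prob (@ltr01 R) A.

(* The elementary random choices. The first coordinates of points of           *)
(* [0,1] x b are indexed by (b, k) and the second coordinates of points of     *)
(* a x [0,1] by (a, k), where k numbers the points of the block product.       *)
Inductive source :=
  | Count of option block & option block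
  | Fst of option block & nat
  | Snd of option block & nat.

HB.instance Definition _ := gen_eqMixin source.

Definition source_events (R : realType) (d : measure_display)
    (T : measurableType d)
    (N : option block -> option block -> T -> nat)
    (X Y : option block -> nat -> T -> unit01 R)
    (s : source) : set_system T :=
  match s with
  | Count a b => preimage_set_system [set: T] (N a b) measurable
  | Fst b k =>
      preimage_set_system [set: T] (fun w => val (X b k w)) measurable
  | Snd a k =>
      preimage_set_system [set: T] (fun w => val (Y a k w)) measurable
  end.

(* A realization, on the probability space (T, P), of the random choices       *)
(* defining M(pp, pm; ap, am).                                                 *)
Record sampling (R : realType) (d : measure_display) (T : measurableType d)
    (P : probability T R) (pp pm : param R) (ap am : R) := Sampling {
  cnt : option block -> option block -> {RV P >-> nat};
  fstu : option block -> nat -> T -> unit01 R;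
  sndu : option block -> nat -> T -> unit01 R;
  cnt_law : forall a b k,
    P (cnt a b @^-1` [set k]) = (count_mass pp pm ap am a b k)%:E;
  fstu_law : forall b k, uniform01 P (fstu b k);
  sndu_law : forall a k, uniform01 P (sndu a k);
  sampling_indep :
    mutually_independent P (source_events (fun a b => cnt a b) fstu sndu) }.

Section multiset.
Context (R : realType) (d : measure_display) (T : measurableType d)
  (P : probability T R) (pp pm : param R) (ap am : R)
  (S : sampling P pp pm ap am).

(* For k < cnt S a b w, the k-th point in a x b.                               *)
Definition sample_pt (a b : option block) (k : nat) (w : T) :
    OmegaS R * OmegaS R :=
  (block_elt a (fstu S b k w), block_elt b (sndu S a k w)).

Definition multiplicity (w : T) (z : OmegaS R * OmegaS R) : nat :=
  let a := block_of z.1 in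
  let b := block_of z.2 in
  count (fun k => sample_pt a b k w == z) (iota 0 (cnt S a b w)).

End multiset.

Definition alphabet_order (R : realType) (le : rel (Omega R)) : Prop :=
  [/\ reflexive le, antisymmetric le, transitive le, total le &
      forall u v : unit01 R, le (Oreal u) (Oreal v) = (val u <= val v)].

Definition extend_le (R : realType) (le : rel (Omega R)) : rel (OmegaS R) :=
  fun x y => match x, y with
             | None, _ => true
             | Some _, None => false
             | Some x', Some y' => le x' y'
             end.

Definition in_Zplus (R : realType) (x : OmegaS R) : bool :=
  if x is Some (Oint _) then true else false.

Definition incr_step (R : realType) (le : rel (Omega R)) : rel (OmegaS R) :=
  fun x y => extend_le le x y && ((x == y) ==> ~~ in_Zplus x).

Definition is_increasing (R : realType) (lep lem : rel (Omega R))
    (s : seq (OmegaS R * OmegaS R)) : bool :=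
  sorted (fun z z' => incr_step lep z.1 z'.1 && incr_step lem z.2 z'.2) s.

Definition mset_subsequence (R : realType)
    (M : OmegaS R * OmegaS R -> nat) (s : seq (OmegaS R * OmegaS R)) : Prop :=
  forall z, (count_mem z s <= M z)%N.

Definition longest_incr (R : realType) (lep lem : rel (Omega R))
    (M : OmegaS R * OmegaS R -> nat) : \bar R :=
  ereal_sup [set ((size s)%:R)%:E | s in
    [set s | mset_subsequence M s /\ is_increasing lep lem s]].

(* The maximal length, taken in [0, +oo]: it is finite only almost surely.     *)
Definition lambda1 (R : realType) (d : measure_display) (T : measurableType d)
    (P : probability T R) (pp pm : param R) (ap am : R)
    (lep lem : rel (Omega R)) (S : sampling P pp pm ap am) (w : T) : \bar R :=
  longest_incr lep lem (multiplicity S w).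

(* Main.v *)
(* Adding the points of the Sigma row and column makes the model stationary.   *)
(* Let G be the last passage time, I = G(x,y) - G(x',y) and                    *)
(* J = G(x,y) - G(x,y') its increments at a cell, x' and y' being the letters  *)
(* before x and y. When alpha_+ alpha_- = 1, the map (I, J, weight) -> (I, J)  *)
(* across a cell preserves the product of the boundary laws (Burke's           *)
(* property), for each of the four combinations of weak and strict letters.    *)
(* So on a finite grid the expectation of G, read along the bottom and then    *)
(* along the right side, is the sum of the means of all boundary multiplicities,*)
(* and these are the terms of the logarithmic derivatives of E.                *)
(* The points with a real coordinate are reduced to a finite grid by cutting   *)
(* [0,1] finely and treating each piece as a letter of Z^+: a cell is then     *)
(* nonempty with probability 1 - exp(-s) instead of s or s / (1 + s), and as G *)
(* is monotone in the weights, it is squeezed between two solvable models whose*)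
(* parameters differ by a factor 1 + o(1). The discretized length is at most   *)
(* lambda_1, and almost surely (when no two points share a real coordinate) it *)
(* eventually dominates every increasing subsequence, so Fatou's lemma         *)
(* concludes.                                                                  *)
Require Import Defs.
From HB Require Import structures.
From mathcomp Require Import all_boot all_order all_algebra.
From mathcomp Require Import all_classical all_reals all_analysis.
From mathcomp Require Import measurable_realfun zify ring lra.

Set Implicit Arguments.
Unset Strict Implicit.
Unset Printing Implicit Defensive.

Import Order.TTheory GRing.Theory Num.Theory.
Import numFieldNormedType.Exports.
Import HBNNSimple.

Local Open Scope classical_set_scope.
Local Open Scope ring_scope.

(** * Last passage percolation on a grid *)

(** The length is squeezed between last passage times on finite grids, whose means are exact because
    the row and column of Sigma make the model stationary.

    Exact means. Give every column [x] a parameter [u_x] and every row [y] a parameter [v_y], the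
    law of a cell depending on [u_x * v_y] and on which of its two letters are weak. Sigma has
    parameter alpha as a column and 1/alpha as a row, so the boundary cells have parameters
    [u_x / alpha] and [alpha * v_y], whose product is again [u_x * v_y]. Under this relation the
    pair of increments leaving a cell has the law of the pair entering it ([burke_cell]). Iterating
    over a row ([burke_row_step]) and over rows ([right_exits_mean]), the increments on the right
    side have the laws of the boundary weights on the left, which yields [lpp_mean]. The boundary
    means are [q z / (1 + z q)] and [r z / (1 - z r)], the terms of [z E'(z) / E(z)]
    ([log_derivative_Egen]).

    Discretization. At level [m] each alphabet is cut into slots: Sigma, the letters of index below
    [m], and short pieces of [0,1]. A chain uses at most one point of a cell with a strict row or
    column, so there only occupation matters; this is how the geometric multiplicity of [(i,j)]
    becomes a Bernoulli variable of parameter [q_i q_j]. The Poisson laws make the cell weights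
    independent ([cell_weights_law]). The passage time [grid_lambda] is at most [lambda1]
    ([grid_lambda_le]) and, when no two sampled coordinates coincide, eventually at least the size
    of any given increasing subsequence ([grid_lambda_ge], [distinct_points_ae]).

    Limit. A piece of length [l] acts as a letter of Z^+ of parameter nearly [t l]; stochastic
    domination by models with slightly smaller and larger parameters gives [sandwich_bounds]. Both
    bounds converge to the claimed value, and [mean_lambda1] concludes by Fatou's lemma in one
    direction and monotonicity in the other. *)

Section last_passage.
Variables (cx ry : nat -> bool).
Implicit Types (W : nat -> nat -> nat) (t : seq (nat * nat)).

(** The passage times at the corner, below and to the left are [c], [b] and [l]; [true] means weak.
    A point in a strict column must follow a point of an earlier column, so its weight extends [l];
    in a strict row it extends [b], and if both are strict it extends [c]. *)
Definition lpp_step (wx wy : bool) (c b l w : nat) : nat :=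
  match wx, wy with
  | true, true => maxn b l + w
  | false, true => maxn b (l + w)
  | true, false => maxn (b + w) l
  | false, false => maxn (maxn b l) (c + w)
  end.

(** [lpp W b a] concerns the first [a] columns and the first [b] rows, while weights are indexed by
    column first. The inner fixpoint runs along a row. *)
Fixpoint lpp W (b a : nat) : nat :=
  match b with
  | 0 => 0
  | b'.+1 =>
    (fix row a := match a with
     | 0 => 0
     | a'.+1 => lpp_step (cx a') (ry b') (lpp W b' a') (lpp W b' a)
                         (row a') (W a' b')
     end) a
  end.

Arguments lpp : simpl never.

Lemma lpp0 W b : lpp W b 0 = 0%N.
Proof. by case: b. Qed.

Lemma lppS W b a :
  lpp W b.+1 a.+1 =
  lpp_step (cx a) (ry b) (lpp W b a) (lpp W b a.+1) (lpp W b.+1 a) (W a b).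
Proof. by []. Qed.

Lemma lpp_step_le wx wy c b l w c' b' l' w' :
  (c <= c')%N -> (b <= b')%N -> (l <= l')%N -> (w <= w')%N ->
  (lpp_step wx wy c b l w <= lpp_step wx wy c' b' l' w')%N.
Proof. by rewrite /lpp_step; case: wx; case: wy; lia. Qed.

Lemma lpp_le W W' b a : (forall i j, W i j <= W' i j)%N ->
  (lpp W b a <= lpp W' b a)%N.
Proof.
move=> WW; elim: b a => // b IHb; elim=> // a IHa.
by rewrite !lppS; apply: lpp_step_le.
Qed.

Lemma lpp_ext W W' b a :
  (forall i j, (i < a)%N -> (j < b)%N -> W i j = W' i j) -> lpp W b a = lpp W' b a.
Proof.
elim: b a => // b IHb; elim=> // a IHa h; rewrite !lppS h// IHa; last first.
  by move=> i j ia jb; apply: h => //; exact: ltnW.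
rewrite !IHb// => i j ia jb; apply: h => //; do ?[exact: ltnW | exact: ltn_trans ia _].
Qed.

Lemma lpp_leS W b a : (lpp W b a <= lpp W b.+1 a)%N.
Proof. by case: a => [|a]; rewrite ?lpp0// lppS /lpp_step; case: cx; case: ry; lia. Qed.

Lemma lpp_leSr W b a : (lpp W b a <= lpp W b a.+1)%N.
Proof. by case: b => [|b]//; rewrite lppS /lpp_step; case: cx; case: ry; lia. Qed.

Definition slot_step (c : nat -> bool) : rel nat :=
  fun s s' => (s <= s')%N && ((s == s') ==> c s').

Definition cell_step : rel (nat * nat) :=
  fun z z' => slot_step cx z.1 z'.1 && slot_step ry z.2 z'.2.

Lemma slot_step_trans c : transitive (slot_step c).
Proof.
move=> y x z; rewrite /slot_step => /andP[xy _] /andP[yz /implyP cz].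
apply/andP; split; first exact: leq_trans yz.
by apply/implyP => /eqP xz; apply: cz; apply/eqP; lia.
Qed.

Lemma cell_step_trans : transitive cell_step.
Proof.
move=> y x z /andP[a b] /andP[c d].
by apply/andP; split; [apply: slot_step_trans c|apply: slot_step_trans d].
Qed.

Definition in_box (a b : nat) : pred (nat * nat) :=
  fun z => (z.1 < a)%N && (z.2 < b)%N.

(** Outside the doubly weak cells a chain visits a cell at most once ([count_strict]), so a positive
    weight suffices there. *)
Definition allowed W : pred (seq (nat * nat)) :=
  fun t => all (fun z => if cx z.1 && ry z.2
                      then (count_mem z t <= W z.1 z.2)%N
                      else (0 < W z.1 z.2)%N) t.

Lemma allowed_filter W t (p : pred (nat * nat)) :
  allowed W t -> allowed W (seq.filter p t).
Proof.
move=> /allP at_; apply/allP => z; rewrite mem_filter => /andP[_ /at_].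
case: ifP => // _; apply: leq_trans.
by rewrite count_filter; apply: sub_count => y /andP[].
Qed.

Lemma cell_step_pair t x y : sorted cell_step t -> x \in t -> y \in t -> x != y ->
  cell_step x y || cell_step y x.
Proof.
rewrite (sorted_pairwise cell_step_trans) => + xt yt xy.
elim: t xt yt => // z t IH; rewrite !inE /= => + + /andP[/allP zt pt].
case/predU1P => [xz|xt]; case/predU1P => [yz|yt].
- by rewrite xz yz eqxx in xy.
- by rewrite xz zt.
- by rewrite yz zt ?orbT.
- exact: IH.
Qed.

Lemma count_strict t z : sorted cell_step t -> ~~ (cx z.1 && ry z.2) ->
  (count_mem z t <= 1)%N.
Proof.
rewrite (sorted_pairwise cell_step_trans) => + zs.
elim: t => // y t IH /= /andP[/allP yt pt].
case: (eqVneq y z) => [yz|_]; last exact: IH.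
suff /count_memPn -> : z \notin t by [].
apply/negP => /yt; rewrite yz /cell_step /slot_step !eqxx !leqnn /=.
exact/negP.
Qed.

Lemma cell_step_max a b z : in_box a.+1 b.+1 z -> cell_step (a, b) z -> z = (a, b).
Proof.
case: z => x y /andP[/= xa yb] /andP[/andP[/= ax _] /andP[/= by_ _]].
by congr pair; apply/eqP; rewrite eqn_leq; apply/andP.
Qed.

(** A term in the last column and a term in the last row are comparable, and the larger of the two
    would be the corner [(a, b)]. *)
Lemma split_box a b t : sorted cell_step t -> all (in_box a.+1 b.+1) t ->
  (a, b) \notin t -> all (in_box a b.+1) t || all (in_box a.+1 b) t.
Proof.
move=> st /allP bt abt; apply/orP; apply: contrapT => /not_orP[].
move=> /negP/allPn[z zt zb] /negP/allPn[z' zt' zb'].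
have za : a = z.1.
  by have := bt _ zt; move: zb; rewrite /in_box /=; clear; lia.
have zb2 : b = z'.2.
  by have := bt _ zt'; move: zb'; rewrite /in_box /=; clear; lia.
case: (eqVneq z z') => [zz|ne].
  by move: abt; rewrite za zb2 -zz -surjective_pairing zt.
have /orP[] := cell_step_pair st zt zt' ne => /andP[/andP[h1 _] /andP[h2 _]].
  have := bt _ zt'; rewrite /in_box /= => /andP[h3 _].
  have E1 : z'.1 = a by apply/eqP; rewrite eqn_leq -ltnS h3 za h1.
  by case/negP: abt; rewrite -E1 zb2 -surjective_pairing.
suff E : z = (a, b) by rewrite -E zt in abt.
have := bt _ zt; rewrite /in_box /= => /andP[_ h3].
have E1 : z.2 = b by apply/eqP; rewrite eqn_leq -ltnS h3 zb2 h2.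
by rewrite (surjective_pairing z) E1 -za.
Qed.

(** Induction on [a + b], after removing the copies of the corner cell. What remains misses the last
    column or the last row; if the corner is used, everything else precedes it and so avoids its
    column or row whenever that is strict. *)
Lemma lpp_bound W a b t : sorted cell_step t -> all (in_box a b) t ->
  allowed W t -> (size t <= lpp W b a)%N.
Proof.
have [k] := ubnP (a + b); elim: k a b t => // k IH [|a] [|b] t.
1-3: by case: t => // -[x y] t; rewrite /= /in_box /= ?ltn0 ?andbF.
move=> abk st bt at_; rewrite lppS.
pose z0 := (a, b); pose t1 := seq.filter (predC1 z0) t.
have st1 : sorted cell_step t1.
  by apply: sorted_filter => //; exact: cell_step_trans.
have at1 : allowed W t1 by exact: allowed_filter.
have szt : size t = (size t1 + count_mem z0 t)%N.
  by rewrite size_filter addnC -(count_predC (pred1 z0)).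
have bt1 : all (in_box a.+1 b.+1) t1.
  by apply/allP => z; rewrite mem_filter => /andP[_ /(allP bt)].
have t1z0 : z0 \notin t1 by rewrite mem_filter /= eqxx.
have leA : all (in_box a b.+1) t1 -> (size t1 <= lpp W b.+1 a)%N.
  by move=> h; apply: IH => //; clear -abk; lia.
have leB : all (in_box a.+1 b) t1 -> (size t1 <= lpp W b a.+1)%N.
  by move=> h; apply: IH => //; clear -abk; lia.
have le1 : (size t1 <= maxn (lpp W b a.+1) (lpp W b.+1 a))%N.
  by have /orP[/leA|/leB] := split_box st1 bt1 t1z0; clear; lia.
have [z0t|z0t] := boolP (z0 \in t); last first.
  have c0 : count_mem z0 t = 0%N by apply/count_memPn.
  rewrite szt c0 addn0.
  by apply: leq_trans le1 _; rewrite /lpp_step; case: cx; case: ry; clear; lia.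
have Wz0 : if cx a && ry b then (count_mem z0 t <= W a b)%N else (0 < W a b)%N.
  by have := allP at_ _ z0t.
have c1 := @count_strict _ z0 st.
move: (count_mem z0 t) szt Wz0 c1 => n0 -> + c1.
have [/andP[ca cb]|nww] := ifPn.
  by rewrite /lpp_step ca cb => Wn0; exact: leq_add.
have {}c1 := c1 nww => W0.
have before z : z \in t1 -> cell_step z z0.
  move=> zt1; have := zt1; rewrite mem_filter => /andP[/= zz0 zt].
  have /orP[//|] := cell_step_pair st zt z0t zz0.
  by move/(cell_step_max (allP bt1 _ zt1)) => zE; rewrite zE eqxx in zz0.
have sA : ~~ cx a -> all (in_box a b.+1) t1.
  move=> ca; apply/allP => z /before; rewrite /cell_step /slot_step /in_box /=.
  by rewrite (negbTE ca) implybF; clear; lia.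
have sB : ~~ ry b -> all (in_box a.+1 b) t1.
  move=> ca; apply/allP => z /before; rewrite /cell_step /slot_step /in_box /=.
  by rewrite (negbTE ca) implybF; clear; lia.
rewrite /lpp_step; have [ca|ca] := boolP (cx a); have [cb|cb] := boolP (ry b).
- by rewrite ca cb in nww.
- by have := leB (sB cb); clear -c1 W0; lia.
- by have := leA (sA ca); clear -c1 W0; lia.
- suff : (size t1 <= lpp W b a)%N by clear -c1 W0; lia.
  apply: IH => //; first by clear -abk; lia.
  apply/allP => z zt; have := allP (sA ca) _ zt; have := allP (sB cb) _ zt.
  by rewrite /in_box /=; clear; lia.
Qed.

(** The recursion adds the whole weight of a cell, while a chain takes only one point from a cell
    with a strict side: hence the bound by 1. An optimal chain is either one of a smaller box or
    such a chain followed by all copies of the corner. *)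
Lemma lpp_attained W a b :
  (forall i j, ~~ (cx i && ry j) -> (W i j <= 1)%N) ->
  exists t, [/\ sorted cell_step t, all (in_box a b) t,
    (forall z, (count_mem z t <= W z.1 z.2)%N) & size t = lpp W b a].
Proof.
move=> W1; have [k] := ubnP (a + b); elim: k a b => // k IH a b abk.
case: a abk => [|a] abk; first by exists [::]; rewrite lpp0.
case: b abk => [|b] abk; first by exists [::].
have box_mono a1 b1 t : (a1 <= a.+1)%N -> (b1 <= b.+1)%N ->
    all (in_box a1 b1) t -> all (in_box a.+1 b.+1) t.
  by move=> ? ?; apply: sub_all => z; rewrite /in_box; lia.
have reuse a1 b1 : (a1 + b1 <= a + b.+1)%N -> (a1 <= a.+1)%N -> (b1 <= b.+1)%N ->
    lpp W b.+1 a.+1 = lpp W b1 a1 ->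
    exists t, [/\ sorted cell_step t, all (in_box a.+1 b.+1) t,
    (forall z, (count_mem z t <= W z.1 z.2)%N) & size t = lpp W b.+1 a.+1].
  move=> h h1 h2 ->; have [|t [st bt ct zt]] := IH a1 b1; first lia.
  by exists t; split => //; exact: box_mono bt.
pose z0 := (a, b).
have extend a1 b1 : (a1 + b1 <= a + b.+1)%N -> (a1 <= a.+1)%N -> (b1 <= b.+1)%N ->
    (a1 <= a)%N || (b1 <= b)%N ->
    (~~ cx a -> (a1 <= a)%N) -> (~~ ry b -> (b1 <= b)%N) ->
    lpp W b.+1 a.+1 = (lpp W b1 a1 + W a b)%N ->
    exists t, [/\ sorted cell_step t, all (in_box a.+1 b.+1) t,
    (forall z, (count_mem z t <= W z.1 z.2)%N) & size t = lpp W b.+1 a.+1].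
  move=> h h1 h2 h12 ha hb ->; have [|t [st bt ct zt]] := IH a1 b1; first lia.
  exists (t ++ nseq (W a b) z0); split.
  - rewrite (sorted_pairwise cell_step_trans) pairwise_cat.
    rewrite -(sorted_pairwise cell_step_trans) st /=; apply/andP; split.
      apply/allrelP => z z' /(allP bt) + /nseqP[-> _].
      rewrite /in_box /cell_step /slot_step /=.
      by case: (cx a) ha; case: (ry b) hb => /= *; lia.
    have [/andP[ca cb]|/W1] := boolP (cx a && ry b).
      elim: (W a b) => //= j ->; rewrite andbT; apply/allP => z /nseqP[-> _].
      by rewrite /cell_step /slot_step /= ca cb !eqxx !leqnn.
    by case: (W a b) => [|[|]].
  - rewrite all_cat (box_mono _ _ _ h1 h2 bt) /=; apply/allP => z /nseqP[-> _].
    by rewrite /in_box /= !leqnn.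
  - move=> z; rewrite count_cat count_nseq /=.
    case: (eqVneq z0 z) => [<-|_]; last by rewrite mul0n addn0.
    rewrite mul1n; have /count_memPn -> // : z0 \notin t.
    by apply/negP => /(allP bt); rewrite /in_box /=; lia.
  - by rewrite size_cat size_nseq zt.
have := lppS W b a; rewrite /lpp_step.
move: extend; case: (cx a); case: (ry b) => extend E.
- case: (leqP (lpp W b a.+1) (lpp W b.+1 a)) => h.
    by apply: (extend a b.+1) => //; lia.
  by apply: (extend a.+1 b) => //; lia.
- case: (leqP (lpp W b a.+1 + W a b) (lpp W b.+1 a)) => h.
    by apply: (reuse a b.+1) => //; lia.
  by apply: (extend a.+1 b) => //; lia.
- case: (leqP (lpp W b.+1 a + W a b) (lpp W b a.+1)) => h.
    by apply: (reuse a.+1 b) => //; lia.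
  by apply: (extend a b.+1) => //; lia.
- case: (leqP (lpp W b a + W a b) (lpp W b a.+1)) => h1.
    case: (leqP (lpp W b a.+1) (lpp W b.+1 a)) => h2.
      by apply: (reuse a b.+1) => //; lia.
    by apply: (reuse a.+1 b) => //; lia.
  case: (leqP (lpp W b a + W a b) (lpp W b.+1 a)) => h2.
    by apply: (reuse a b.+1) => //; lia.
  by apply: (extend a b) => //; lia.
Qed.
End last_passage.
Arguments lpp : simpl never.

(** * Iterated expectations over discrete laws *)

Section expectation.
Variable R : realType.
Local Open Scope ereal_scope.
Implicit Types (mu : nat -> R) (mus : seq (nat -> R)).

Definition is_mass mu : Prop :=
  (forall k, 0 <= mu k)%R /\ \sum_(k <oo) (mu k)%:E = 1.

Definition Ex mu (f : nat -> \bar R) : \bar R := \sum_(k <oo) (mu k)%:E * f k.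

Lemma eq_Ex mu f g : f =1 g -> Ex mu f = Ex mu g.
Proof. by move=> fg; apply: eq_eseriesr => k _; rewrite fg. Qed.

Lemma Ex_ge0 mu f : is_mass mu -> (forall k, 0 <= f k) -> 0 <= Ex mu f.
Proof.
move=> [mu0 _] f0; apply: nneseries_ge0 => k _ _.
by apply: mule_ge0; rewrite ?lee_fin.
Qed.

Lemma Ex_le mu f g : is_mass mu -> (forall k, 0 <= f k) ->
  (forall k, f k <= g k) -> Ex mu f <= Ex mu g.
Proof.
move=> [mu0 _] f0 fg; apply: lee_nneseries => k _ *.
  by apply: mule_ge0; rewrite ?lee_fin.
by apply: lee_wpmul2l; rewrite ?lee_fin.
Qed.

Lemma ExD mu f g : is_mass mu -> (forall k, 0 <= f k) -> (forall k, 0 <= g k) ->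
  Ex mu (fun k => f k + g k) = Ex mu f + Ex mu g.
Proof.
move=> [mu0 _] f0 g0; rewrite /Ex -nneseriesD; last 2 first.
- by move=> *; apply: mule_ge0; rewrite ?lee_fin.
- by move=> *; apply: mule_ge0; rewrite ?lee_fin.
by apply: eq_eseriesr => k _; rewrite ge0_muleDr.
Qed.

(** The factor may be infinite: then both sides are 0 or both are [+oo]. *)
Lemma nneseriesZr (f : nat -> \bar R) (x : \bar R) : (forall k, 0 <= f k) -> 0 <= x ->
  \sum_(k <oo) f k * x = (\sum_(k <oo) f k) * x.
Proof.
move=> f0; case: x => [r| |//] x0.
  under eq_eseriesr do rewrite muleC.
  by rewrite nneseriesZl// muleC.
case: (pselect (forall k, f k = 0)) => [fe|].
  by rewrite !eseries0 ?mul0e// => k _ _; rewrite fe ?mul0e.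
move/existsNP => [k fk].
have fk0 : 0 < f k by rewrite lt0e f0 andbT; apply/eqP.
rewrite (@nneseries_pinfty _ (fun k => f k * +oo) xpredT k)//; last 2 first.
- by move=> n _; apply: mule_ge0.
- by rewrite gt0_muley.
rewrite gt0_muley// (lt_le_trans fk0)//.
rewrite (@nneseriesD1 _ f k xpredT)//; apply: leeDl.
by apply: nneseries_ge0.
Qed.

Lemma Ex_cst mu c : is_mass mu -> 0 <= c -> Ex mu (fun=> c) = c.
Proof.
move=> [mu0 mu1] c0; rewrite /Ex nneseriesZr ?mu1 ?mul1e// => k.
Qed.

Lemma Ex_Ex mu nu (f : nat -> nat -> \bar R) : is_mass mu -> is_mass nu ->
  (forall i j, 0 <= f i j) ->
  Ex mu (fun i => Ex nu (f i)) = Ex nu (fun j => Ex mu (f ^~ j)).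
Proof.
move=> [mu0 _] [nu0 _] f0; rewrite /Ex.
transitivity (\sum_(i <oo) \sum_(j <oo) (mu i)%:E * ((nu j)%:E * f i j)).
  apply: eq_eseriesr => i _; rewrite nneseriesZl// => j _.
  by apply: mule_ge0; rewrite ?lee_fin.
rewrite nneseries_interchange; last first.
  by move=> i j; rewrite !mule_ge0 ?lee_fin.
apply: eq_eseriesr => j _; rewrite -nneseriesZl; last first.
  by move=> i _; apply: mule_ge0; rewrite ?lee_fin.
by apply: eq_eseriesr => i _; rewrite muleCA.
Qed.

Fixpoint EX mus (f : seq nat -> \bar R) : \bar R :=
  if mus is mu :: mus' then Ex mu (fun k => EX mus' (fun s => f (k :: s)))
  else f [::].

Definition is_masses mus := forall mu, List.In mu mus -> is_mass mu.

Lemma is_masses_cons mu mus :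
  is_masses (mu :: mus) <-> is_mass mu /\ is_masses mus.
Proof.
split=> [h|[h1 h2] nu /= [<-//|]]; last exact: h2.
by split=> [|nu h']; apply: h; [left|right].
Qed.

Lemma is_masses_cat mus nus :
  is_masses (mus ++ nus) <-> is_masses mus /\ is_masses nus.
Proof.
elim: mus => [|mu mus IH] /=; first by split=> [|[]].
by rewrite !is_masses_cons IH; tauto.
Qed.

Lemma EX_ge0 mus f : is_masses mus -> (forall s, 0 <= f s) -> 0 <= EX mus f.
Proof.
elim: mus f => //= mu mus IH f /is_masses_cons[h1 h2] f0.
by apply: Ex_ge0 => // k; exact: IH.
Qed.

Lemma eq_EX mus f g : (forall s, size s = size mus -> f s = g s) ->
  EX mus f = EX mus g.
Proof.
elim: mus f g => [|mu mus IH] f g fg /=; first exact: fg.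
by apply: eq_Ex => k; apply: IH => s sz; apply: fg; rewrite /= sz.
Qed.

Lemma EX_cat mus nus f :
  EX (mus ++ nus) f = EX mus (fun s => EX nus (fun t => f (s ++ t))).
Proof. by elim: mus f => //= mu mus IH f; apply: eq_Ex => k; rewrite IH. Qed.

Lemma EX_Ex mus mu (f : seq nat -> nat -> \bar R) : is_masses mus -> is_mass mu ->
  (forall s k, 0 <= f s k) ->
  EX mus (fun s => Ex mu (f s)) = Ex mu (fun k => EX mus (f ^~ k)).
Proof.
elim: mus f => //= nu mus IH f /is_masses_cons[h1 h2] h f0.
under eq_Ex do rewrite IH//.
by rewrite Ex_Ex// => i j; exact: EX_ge0.
Qed.

Lemma EXD mus f g : is_masses mus -> (forall s, 0 <= f s) -> (forall s, 0 <= g s) ->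
  EX mus (fun s => f s + g s) = EX mus f + EX mus g.
Proof.
elim: mus f g => //= mu mus IH f g /is_masses_cons[h1 h2] f0 g0.
under eq_Ex do rewrite IH//.
by rewrite ExD// => k; exact: EX_ge0.
Qed.

Lemma EX_cst mus c : is_masses mus -> 0 <= c -> EX mus (fun=> c) = c.
Proof.
elim: mus => //= mu mus IH /is_masses_cons[h1 h2] c0.
under eq_Ex do rewrite IH//.
exact: Ex_cst.
Qed.

(** Stochastic domination, tested on nonnegative nondecreasing functions. *)
Definition st_le mu nu := forall f : nat -> \bar R,
  (forall k, 0 <= f k) -> {homo f : x y / (x <= y)%N >-> x <= y} -> Ex mu f <= Ex nu f.

Definition mono_seq (f : seq nat -> \bar R) :=
  forall s t, all2 leq s t -> f s <= f t.

Lemma all2_leq_refl s : all2 leq s s.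
Proof. by elim: s => //= k s ->; rewrite leqnn. Qed.

Lemma EX_mono mus f g : is_masses mus -> (forall s, 0 <= f s) ->
  (forall s, f s <= g s) -> EX mus f <= EX mus g.
Proof.
elim: mus f g => //= mu mus IH f g /is_masses_cons[h1 h2] f0 fg.
by apply: Ex_le => // k; [apply: EX_ge0|apply: IH].
Qed.

(** The laws are replaced one coordinate at a time. *)
Lemma EX_st_le mus nus f : is_masses mus -> is_masses nus ->
  List.Forall2 st_le mus nus -> (forall s, 0 <= f s) -> mono_seq f ->
  EX mus f <= EX nus f.
Proof.
move=> + + h; elim: h f => //= mu nu mus' nus' mn _ IH f.
move=> /is_masses_cons[h1 h2] /is_masses_cons[h3 h4] f0 fm.
apply: (@le_trans _ _ (Ex mu (fun k => EX nus' (fun s => f (k :: s))))).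
  apply: Ex_le => // k; first exact: EX_ge0.
  by apply: IH => // s t st; apply: fm => /=; rewrite leqnn.
apply: mn => [k|k l kl]; first exact: EX_ge0.
apply: EX_mono => // s; apply: fm.
by rewrite /= kl all2_leq_refl.
Qed.

End expectation.

(** * Geometric and Bernoulli laws *)

Section masses.
Variable R : realType.
Local Open Scope ereal_scope.

Lemma nneseries_EFin (u : nat -> R) (l : R) :
  series u @ \oo --> l -> \sum_(k <oo) (u k)%:E = l%:E.
Proof.
move=> ul; rewrite -(cvg_lim _ ul)// -EFin_lim; last by apply/cvg_ex; exists l.
by apply/congr_lim/funext => n; rewrite /= sumEFin.
Qed.

Lemma geom_is_mass (s : R) : (0 <= s < 1)%R -> is_mass (geom_mass s).
Proof.
move=> /andP[s0 s1]; split=> [k|].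
  by rewrite /geom_mass mulr_ge0 ?exprn_ge0// subr_ge0 ltW.
apply: nneseries_EFin.
have s1' : (`|s| < 1)%R by rewrite ger0_norm.
have := cvg_geometric_series (a := (1 - s)%R) s1'.
by rewrite divff ?subr_eq0 ?gt_eqF.
Qed.

Definition bern01 (p : R) (k : nat) : R :=
  (match k with 0 => 1 - p | 1 => p | _ => 0 end)%R.

Lemma bern01_ge0 p k : (0 <= p <= 1)%R -> (0 <= bern01 p k)%R.
Proof. by case: k => [|[|k]] /= /andP[p0 p1] //; rewrite subr_ge0. Qed.

Lemma Ex_bern01 p f : (0 <= p <= 1)%R -> (forall k, 0 <= f k) ->
  Ex (bern01 p) f = (1 - p)%:E * f 0%N + p%:E * f 1%N.
Proof.
move=> p01 f0; rewrite /Ex (nneseries_split 0 2); last first.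
  by move=> k _; apply: mule_ge0; rewrite ?lee_fin ?bern01_ge0.
rewrite add0n eseries0; last by case=> [|[|k]]//= _ _; rewrite mul0e.
by rewrite adde0 !big_nat_recr//= big_geq//= add0e.
Qed.

Lemma bern01_is_mass p : (0 <= p <= 1)%R -> is_mass (bern01 p).
Proof.
move=> p01; split=> [k|]; first exact: bern01_ge0.
have := @Ex_bern01 p (fun=> 1) p01; rewrite /Ex.
under eq_eseriesr do rewrite mule1.
by move=> -> //; rewrite !mule1 -EFinD subrK.
Qed.

Lemma bern01_st_le p q : (0 <= p)%R -> (p <= q)%R -> (q <= 1)%R ->
  st_le (bern01 p) (bern01 q).
Proof.
move=> p0 pq q1 f f0 fm.
rewrite !Ex_bern01 ?p0 ?q1 ?(le_trans p0)//; last by rewrite (le_trans pq).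
have -> : ((1 - p) = (1 - q) + (q - p))%R by ring.
have -> : (q%:E = p%:E + (q - p)%:E) by rewrite -EFinD; congr EFin; ring.
rewrite EFinD !ge0_muleDl ?lee_fin ?subr_ge0//.
rewrite -addeA leeD2l// addeC leeD2l// lee_wpmul2l ?lee_fin ?subr_ge0//.
exact: fm.
Qed.

(* Law of a cell of a column and a row; [true] stands for a weak letter (of    *)
(* Z^+' or Sigma), and [p] is the product of the two parameters.               *)
Definition cell_law (wx wy : bool) (p : R) : nat -> R :=
  if wx && wy then geom_mass p
  else if wx || wy then bern01 (p / (1 + p))%R else bern01 p.

Lemma cell_law_is_mass wx wy p : (0 <= p)%R -> (wx && wy -> p < 1)%R ->
  (~~ (wx || wy) -> p <= 1)%R -> is_mass (cell_law wx wy p).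
Proof.
move=> p0; rewrite /cell_law; case: wx; case: wy => /= p1 p2.
- by apply: geom_is_mass; rewrite p0 p1.
- apply: bern01_is_mass; rewrite divr_ge0 ?addr_ge0//=.
  by rewrite ler_pdivrMr ?ltr_pwDl//; lra.
- apply: bern01_is_mass; rewrite divr_ge0 ?addr_ge0//=.
  by rewrite ler_pdivrMr ?ltr_pwDl//; lra.
- by apply: bern01_is_mass; rewrite p0 p2.
Qed.

(** Mean of a boundary cell, where one of the two letters is Sigma, hence weak ([cell_law_mean]). *)
Definition cell_mean (w : bool) (p : R) : R :=
  (if w then p / (1 - p) else p / (1 + p))%R.

(** Shifting the index gives [m = s * (m + 1)] for the mean [m]. This can be solved because [m] is
    finite, by the closed form of the partial sums. *)
Lemma geom_mean (s : R) : (0 <= s < 1)%R ->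
  Ex (geom_mass s) (fun k => k%:R%:E) = (s / (1 - s))%:E.
Proof.
move=> /andP[s0 s1]; have s10 : (1 - s != 0)%R by rewrite subr_eq0 gt_eqF.
have gm : is_mass (geom_mass s) by apply: geom_is_mass; rewrite s0.
have gm0 := gm.1.
have pos k : 0 <= (geom_mass s k)%:E * k%:R%:E.
  by rewrite mule_ge0 ?lee_fin.
set m := Ex _ _.
have m0 : 0 <= m by exact: nneseries_ge0.
have mfin : m <= (s / (1 - s))%:E.
  apply: lime_le; first exact: is_cvg_nneseries.
  apply: nearW => n.
  under eq_bigr do rewrite -EFinM.
  rewrite sumEFin lee_fin.
  have -> : (\sum_(0 <= k < n) geom_mass s k * k%:R
             = s * (1 - s ^+ n) / (1 - s) - n%:R * s ^+ n)%R.
    elim: n => [|n IH]; first by rewrite big_geq// expr0; field.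
    by rewrite big_nat_recr//= IH /geom_mass exprS -natr1; field.
  rewrite lerBlDr -[leLHS]addr0 lerD ?mulr_ge0 ?exprn_ge0//.
  rewrite ler_pM2r ?invr_gt0 ?subr_gt0//.
  by rewrite ler_piMr// gerBl exprn_ge0.
have : m = s%:E * (m + 1).
  rewrite {1}/m /Ex nneseries_recl//= mule0 add0e -(nneseries_addn 1)//.
  rewrite -{1}(Ex_cst gm (c := 1))// -ExD//.
  rewrite /Ex -nneseriesZl; last first.
    by move=> k _; rewrite mule_ge0 ?lee_fin ?gm0// adde_ge0.
  apply: eq_eseriesr => k _; rewrite -!EFinM; congr EFin.
  by rewrite /geom_mass addn1 exprS -natr1; ring.
have /fineK <- : m \is a fin_num.
  by rewrite ge0_fin_numE// (le_lt_trans mfin)// ltry.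
rewrite -EFinD -EFinM => -[] mE; congr EFin.
move: mE; move: (fine m) => x mE.
have : ((1 - s) * x = s)%R by rewrite mulrBl mul1r {1}mE; ring.
by move=> xs; apply: (mulfI s10); rewrite xs mulrCA divff ?mulr1.
Qed.

Lemma bern01_mean p : (0 <= p <= 1)%R -> Ex (bern01 p) (fun k => k%:R%:E) = p%:E.
Proof. by move=> p01; rewrite Ex_bern01//= mule0 add0e mule1. Qed.

Lemma cell_law_mean (w : bool) (p : R) : (0 <= p)%R -> (w -> p < 1)%R ->
  Ex (cell_law w true p) (fun k => k%:R%:E) = (cell_mean w p)%:E.
Proof.
move=> p0; case: w => /= p1; first by rewrite geom_mean// p0 p1.
rewrite /cell_law /= bern01_mean// divr_ge0 ?addr_ge0//=.
by rewrite ler_pdivrMr ?ltr_pwDl//; lra.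
Qed.

End masses.

(** * Burke's property *)

Section burke.
Variable R : realType.
Local Open Scope ereal_scope.

(** A single unordered sum over triples can be reindexed by a bijection of triples. *)
Lemma Ex3_esum (m1 m2 m3 : nat -> R) (F : nat -> nat -> nat -> \bar R) :
  is_mass m1 -> is_mass m2 -> is_mass m3 -> (forall i j k, 0 <= F i j k) ->
  Ex m1 (fun i => Ex m2 (fun j => Ex m3 (F i j))) =
  \esum_(x in [set: nat * (nat * nat)])
     (m1 x.1 * m2 x.2.1 * m3 x.2.2)%:E * F x.1 x.2.1 x.2.2.
Proof.
move=> h1 h2 h3 F0.
have g0 i j : 0 <= Ex m3 (F i j) by exact: Ex_ge0.
have g1 i : 0 <= Ex m2 (fun j => Ex m3 (F i j)) by exact: Ex_ge0.
have M0 (m : nat -> R) : is_mass m -> forall k x, 0 <= x -> 0 <= (m k)%:E * x.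
  by move=> [m0 _] k x x0; rewrite mule_ge0 ?lee_fin.
rewrite /Ex nneseries_esumT; last by move=> i; apply: (M0 _ h1); exact: g1.
have -> : [set: nat * (nat * nat)] = [set: nat] `*`` (fun=> [set: nat * nat]).
  by apply/seteqP; split.
rewrite -(@esum_esum _ _ _ _ _ (fun i y =>
  (m1 i * m2 y.1 * m3 y.2)%:E * F i y.1 y.2)); last first.
  by move=> i j _ _; rewrite mule_ge0 ?lee_fin ?mulr_ge0 ?h1.1 ?h2.1 ?h3.1.
apply: eq_esum => i _.
rewrite -nneseriesZl; last by move=> j _; apply: (M0 _ h2); exact: g0.
rewrite nneseries_esumT; last by move=> j; apply: (M0 _ h1); apply: (M0 _ h2); exact: g0.
have -> : [set: nat * nat] = [set: nat] `*`` (fun=> [set: nat]).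
  by apply/seteqP; split.
rewrite -(@esum_esum _ _ _ _ _ (fun j k =>
  (m1 i * m2 j * m3 k)%:E * F i j k)); last first.
  by move=> j k _ _; rewrite mule_ge0 ?lee_fin ?mulr_ge0 ?h1.1 ?h2.1 ?h3.1.
apply: eq_esum => j _; rewrite muleA -EFinM.
rewrite -nneseriesZl; last by move=> k _; exact: (M0 _ h3).
rewrite nneseries_esumT; last first.
  by move=> k; rewrite mule_ge0 ?lee_fin ?mulr_ge0 ?h1.1 ?h2.1 ?(M0 _ h3).
by apply: eq_esum => k _; rewrite muleA -EFinM.
Qed.

(* A weight-preserving involution on (input, input, weight) realizes the local *)
(* map: the first two components of the image are the outputs.                 *)
Lemma Ex3_involution (m1 m2 m3 : nat -> R) (g : nat * (nat * nat) -> nat * (nat * nat))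
    (f : nat -> nat -> \bar R) :
  is_mass m1 -> is_mass m2 -> is_mass m3 -> (forall i j, 0 <= f i j) ->
  involutive g ->
  (forall x, m1 (g x).1 * m2 (g x).2.1 * m3 (g x).2.2
     = m1 x.1 * m2 x.2.1 * m3 x.2.2)%R ->
  Ex m1 (fun i => Ex m2 (fun j => Ex m3 (fun k =>
     f (g (i, (j, k))).1 (g (i, (j, k))).2.1))) =
  Ex m1 (fun i => Ex m2 (fun j => f i j)).
Proof.
move=> h1 h2 h3 f0 gK gm.
rewrite (Ex3_esum (F := fun i j k => f (g (i, (j, k))).1 (g (i, (j, k))).2.1))//.
transitivity (Ex m1 (fun i => Ex m2 (fun j => Ex m3 (fun=> f i j)))); last first.
  by apply: eq_Ex => i; apply: eq_Ex => j; rewrite Ex_cst.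
rewrite (Ex3_esum (F := fun i j k => f i j))//.
rewrite [RHS](reindex_esum setT setT g); last first.
  split=> //; first by move=> x y _ _; exact: (can_inj gK).
  by move=> y _; exists (g y).
by apply: eq_esum => -[i [j k]] _; rewrite -gm.
Qed.

(** The outputs keep [i - j] and have minimum [k]; recording [minn i j] as the new weight makes the
    map its own inverse. *)
Definition burke_ww (x : nat * (nat * nat)) : nat * (nat * nat) :=
  let: (i, (j, k)) := x in (k + (i - j), (k + (j - i), minn i j))%N.

Lemma burke_wwK : involutive burke_ww.
Proof.
by move=> [i [j k]]; rewrite /burke_ww; congr (_, (_, _)); lia.
Qed.

(** For [i] and [k] at most 1 the outputs are [k] and [j + k - i], unless [i] exceeds [j + k]; that
    happens only at [(1, 0, 0)], which is its own image. Triples with [i] or [k] above 1 have mass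
    zero and are left fixed to make the map total. *)
Definition burke_sw (x : nat * (nat * nat)) : nat * (nat * nat) :=
  let: (i, (j, k)) := x in
  if [&& i <= 1, k <= 1 & ~~ [&& i == 1, j == 0 & k == 0]]%N
  then (k, (j + k - i, i))%N else x.

Lemma burke_swK : involutive burke_sw.
Proof.
move=> [i [j k]]; rewrite /burke_sw; case: ifPn => h; last by rewrite (negbTE h).
have -> : [&& k <= 1, i <= 1 & ~~ [&& k == 1, (j + k - i)%N == 0 & i == 0]]%N.
  by move: h; clear; lia.
by congr (_, (_, _)); move: h; clear; lia.
Qed.
(** With the corner normalized to 0, [i] is the increment along the bottom of the cell and [j] the
    one along its left side; the outputs are the increments along the top and the right side. *)
Definition out_x wx wy i j k := (lpp_step wx wy 0 i j k - j)%N.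
Definition out_y wx wy i j k := (lpp_step wx wy 0 i j k - i)%N.

Lemma burke_cell_ww (a b : R) f : (0 <= a < 1)%R -> (0 <= b < 1)%R ->
  (forall i j, 0 <= f i j) ->
  Ex (geom_mass a) (fun i => Ex (geom_mass b) (fun j => Ex (geom_mass (a * b))
     (fun k => f (out_x true true i j k) (out_y true true i j k)))) =
  Ex (geom_mass a) (fun i => Ex (geom_mass b) (fun j => f i j)).
Proof.
move=> /andP[a0 a1] /andP[b0 b1] f0.
transitivity (Ex (geom_mass a) (fun i => Ex (geom_mass b) (fun j =>
    Ex (geom_mass (a * b))
     (fun k => f (burke_ww (i, (j, k))).1 (burke_ww (i, (j, k))).2.1)))).
  apply: eq_Ex => i; apply: eq_Ex => j; apply: eq_Ex => k.
  by rewrite /out_x /out_y /= /lpp_step; congr f; lia.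
apply: Ex3_involution => //.
- by apply: geom_is_mass; rewrite a0.
- by apply: geom_is_mass; rewrite b0.
- by apply: geom_is_mass; rewrite mulr_ge0//= mulr_ilt1.
- exact: burke_wwK.
move=> [i [j k]]; rewrite /geom_mass /=.
suff E : (a ^+ (k + (i - j)) * b ^+ (k + (j - i)) * (a * b) ^+ minn i j =
   a ^+ i * b ^+ j * (a * b) ^+ k)%R.
  transitivity ((1 - a) * (1 - b) * (1 - a * b) * (a ^+ (k + (i - j)) *
    b ^+ (k + (j - i)) * (a * b) ^+ minn i j))%R; first by ring.
  by rewrite E; ring.
rewrite !exprMn.
transitivity (a ^+ (k + (i - j) + minn i j) * b ^+ (k + (j - i) + minn i j))%R.
  by rewrite !(exprD _ (_ + _)); ring.
transitivity (a ^+ (i + k) * b ^+ (j + k))%R; last by rewrite !exprD; ring.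
by congr (_ ^+ _ * _ ^+ _)%R; lia.
Qed.

Lemma burke_cell_sw (a b : R) f : (0 <= a)%R -> (0 <= b < 1)%R ->
  (forall i j, 0 <= f i j) ->
  let p := (a / (1 + a))%R in let q := (a * b / (1 + a * b))%R in
  Ex (bern01 p) (fun i => Ex (geom_mass b) (fun j => Ex (bern01 q)
     (fun k => f (out_x false true i j k) (out_y false true i j k)))) =
  Ex (bern01 p) (fun i => Ex (geom_mass b) (fun j => f i j)).
Proof.
move=> a0 /andP[b0 b1] f0 p q.
have ab0 : (0 <= a * b)%R by rewrite mulr_ge0.
have P (x : R) : (0 <= x)%R -> (0 <= x / (1 + x) <= 1)%R.
  by move=> x0; rewrite divr_ge0 ?addr_ge0//= ler_pdivrMr ?ltr_pwDl//; lra.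
have bern0 (x : R) (k : nat) : (1 < k)%N -> bern01 x k = 0%R by case: k => [|[|k]].
transitivity (Ex (bern01 p) (fun i => Ex (geom_mass b) (fun j => Ex (bern01 q)
     (fun k => f (burke_sw (i, (j, k))).1 (burke_sw (i, (j, k))).2.1)))).
  rewrite !(Ex_bern01 (P a a0)); last 2 first.
  - by move=> k; apply: Ex_ge0 => [|j]; [apply: geom_is_mass; rewrite b0|apply: Ex_ge0 => //;
      apply: bern01_is_mass; rewrite P].
  - by move=> k; apply: Ex_ge0 => [|j]; [apply: geom_is_mass; rewrite b0|apply: Ex_ge0 => //;
      apply: bern01_is_mass; rewrite P].
  by congr (_ * _ + _ * _); apply: eq_Ex => j; rewrite !Ex_bern01 ?P//;
    congr (_ * _ + _ * _); rewrite /burke_sw /out_x /out_y /lpp_step /=;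
    case: j => [|j] /=; congr f; lia.
rewrite Ex3_involution//.
- by apply: bern01_is_mass; rewrite P.
- by apply: geom_is_mass; rewrite b0.
- by apply: bern01_is_mass; rewrite P.
- exact: burke_swK.
have n1 : (1 + a != 0)%R by rewrite gt_eqF// ltr_pwDl.
have n2 : (1 + a * b != 0)%R by rewrite gt_eqF// ltr_pwDl.
move=> [i [j k]]; rewrite /burke_sw; case: ifPn => // /and3P[].
case: i => [|[|i]]//; case: k => [|[|k]]// _ _ /=; rewrite ?addn0 ?subn0//.
- move=> _; rewrite addn1 /geom_mass exprS /p /q; field.
  by rewrite n1 n2.
- case: j => [//|j] _; rewrite subn1 /= /geom_mass exprS /p /q; field.
  by rewrite n1 n2.
- by rewrite addnK.
Qed.

(** Direct check on the eight inputs. The pair (1,1) goes to (0,0) whatever the weight, (0,0) goes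
    to (1,1) when the weight is 1, and the other pairs are kept; the balance is
    [p q = (1 - p)(1 - q) a b]. *)
Lemma burke_cell_ss (a b : R) f : (0 <= a)%R -> (0 <= b)%R -> (a * b <= 1)%R ->
  (forall i j, 0 <= f i j) ->
  let p := (a / (1 + a))%R in let q := (b / (1 + b))%R in
  Ex (bern01 p) (fun i => Ex (bern01 q) (fun j => Ex (bern01 (a * b))
     (fun k => f (out_x false false i j k) (out_y false false i j k)))) =
  Ex (bern01 p) (fun i => Ex (bern01 q) (fun j => f i j)).
Proof.
move=> a0 b0 ab1 f0 p q.
have ab0 : (0 <= a * b)%R by rewrite mulr_ge0.
have abP : (0 <= a * b <= 1)%R by rewrite ab0.
have P (x : R) : (0 <= x)%R -> (0 <= x / (1 + x) <= 1)%R.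
  by move=> x0; rewrite divr_ge0 ?addr_ge0//= ler_pdivrMr ?ltr_pwDl//; lra.
have bm (x : R) : (0 <= x <= 1)%R -> is_mass (bern01 x) := @bern01_is_mass R x.
have E2 (g : nat -> nat -> \bar R) : (forall i j, 0 <= g i j) ->
   Ex (bern01 p) (fun i => Ex (bern01 q) (g i)) =
   ((1 - p) * (1 - q))%:E * g 0%N 0%N + ((1 - p) * q)%:E * g 0%N 1%N +
   ((p * (1 - q))%:E * g 1%N 0%N + (p * q)%:E * g 1%N 1%N).
  move=> g0; rewrite Ex_bern01 ?P//; last by move=> k; apply: Ex_ge0 => //; apply: bm; exact: P.
  have [p0 p1] := andP (P a a0); have [q0 q1] := andP (P b b0).
  rewrite !Ex_bern01 ?P// !ge0_muleDr ?mule_ge0 ?lee_fin ?subr_ge0//.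
  by rewrite !muleA -!EFinM.
rewrite !E2//; last by move=> i j; apply: Ex_ge0 => //; exact: bm.
rewrite !Ex_bern01//.
rewrite /out_x /out_y /lpp_step !maxnn !addn0 !addn1 !max0n !maxn0 !subn0 !subnn.
rewrite /= ?subnn.
have n1 : (1 + a != 0)%R by rewrite gt_eqF// ltr_pwDl.
have n2 : (1 + b != 0)%R by rewrite gt_eqF// ltr_pwDl.
have [p0 p1] := andP (P a a0); have [q0 q1] := andP (P b b0).
have M (r s : R) (x : \bar R) : (0 <= r)%R -> (0 <= s)%R ->
    r%:E * x + s%:E * x = (r + s)%:E * x.
  by move=> r0 s0; rewrite EFinD ge0_muleDl ?lee_fin.
rewrite !ge0_muleDr ?mule_ge0 ?lee_fin ?subr_ge0//.
rewrite !muleA -!EFinM.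
move: (f 0%N 0%N) (f 1%N 0%N) (f 0%N 1%N) (f 1%N 1%N) => x y z t.
have q0' : (0 <= 1 - q)%R by rewrite subr_ge0.
have p0' : (0 <= 1 - p)%R by rewrite subr_ge0.
have ab0' : (0 <= 1 - a * b)%R by rewrite subr_ge0.
(* Five terms remain; the first and the fifth are both multiples of the value of [f] at (0,0) and
   are brought together. *)
rewrite !M ?mulr_ge0// ?invr_ge0 ?addr_ge0// !addeA (ACl (1 * 5 * 3 * 4 * 2)) /= M; last 2 first.
- by rewrite !mulr_ge0.
- by rewrite addr_ge0 ?mulr_ge0// ?invr_ge0 ?addr_ge0.
by congr (_ * _ + _ * _ + _ * _ + _ * _); congr EFin; rewrite /p /q; field; rewrite n1 n2.
Qed.
End burke.

(** * Burke's property along rows and up the right side *)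

Section burke_rows.
Variable R : realType.
Local Open Scope ereal_scope.

(** The weak column, strict row case is the transpose of [burke_cell_sw]. *)
Lemma burke_cell (wx wy : bool) (a b : R) f : (0 <= a)%R -> (0 <= b)%R ->
  (wx -> a < 1)%R -> (wy -> b < 1)%R -> (~~ (wx || wy) -> a * b <= 1)%R ->
  (forall i j, 0 <= f i j) ->
  Ex (cell_law wx true a) (fun i => Ex (cell_law true wy b) (fun j =>
    Ex (cell_law wx wy (a * b))
     (fun k => f (out_x wx wy i j k) (out_y wx wy i j k)))) =
  Ex (cell_law wx true a) (fun i => Ex (cell_law true wy b) (fun j => f i j)).
Proof.
move=> a0 b0; case: wx; case: wy => /= a1 b1 ab1 f0.
- by apply: burke_cell_ww => //; rewrite ?a0 ?b0 ?a1 ?b1.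
- have hb : is_mass (bern01 (b / (1 + b))) :=
      cell_law_is_mass (wx := true) (wy := false) b0 (ltac:(by [])) (ltac:(by [])).
  have ha : is_mass (geom_mass a) by apply: geom_is_mass; rewrite a0 a1.
  have ab0 : (0 <= a * b)%R by rewrite mulr_ge0.
  have hab : is_mass (bern01 (a * b / (1 + a * b))) :=
      cell_law_is_mass (wx := true) (wy := false) ab0 (ltac:(by [])) (ltac:(by [])).
  rewrite /cell_law /= Ex_Ex//; last by move=> i j; exact: Ex_ge0.
  rewrite [RHS]Ex_Ex// (mulrC a).
  apply: etrans; last first.
    by apply: (@burke_cell_sw _ b a (fun i j => f j i)) => //; rewrite a0 a1.
  apply: eq_Ex => j; apply: eq_Ex => i; apply: eq_Ex => k.
  by rewrite /out_x /out_y /lpp_step maxnC.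
- by apply: burke_cell_sw => //; rewrite b0 b1.
- by apply: burke_cell_ss => //; exact: ab1.
Qed.

(** Sweep of one row from left to right: [Is] are the increments below it and [J] enters on the
    left; the result is the list of increments above and the increment leaving on the right. *)
Fixpoint row_out (ws : seq bool) wy (Is : seq nat) (J : nat) (Ks : seq nat) :
    seq nat * nat :=
  match ws, Is, Ks with
  | w :: ws', i :: Is', k :: Ks' =>
    let r := row_out ws' wy Is' (out_y w wy i J k) Ks' in
    (out_x w wy i J k :: r.1, r.2)
  | _, _, _ => ([::], J)
  end.

Definition row_laws (cols : seq (bool * R)) (row : bool * R) : seq (nat -> R) :=
  [seq cell_law c.1 row.1 (c.2 * row.2) | c <- cols].

Definition burke_col (am : R) (c : bool * R) : Prop :=
  (0 <= c.2)%R /\ (c.1 -> c.2 * am < 1)%R.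

Definition burke_pair (c r : bool * R) : Prop :=
  (~~ (c.1 || r.1) -> c.2 * r.2 <= 1)%R.

Definition burke_row (ap : R) (r : bool * R) : Prop :=
  (0 <= r.2)%R /\ (r.1 -> ap * r.2 < 1)%R.

Variables (ap am : R).
Hypotheses (ap0 : (0 < ap)%R) (apm : (ap * am = 1)%R).

Let am0 : (0 < am)%R.
Proof. by have := @ltr01 R; rewrite -apm pmulr_rgt0. Qed.

(** The only use of alpha_+ alpha_- = 1 in the algebra: two boundary parameters multiply to the
    parameter of the interior cell. *)
Let burke_prod (x y : R) : (x * am * (ap * y) = x * y)%R.
Proof. by rewrite -mulrA (mulrA am) (mulrC am) apm mul1r. Qed.

Lemma col_law_is_mass c : burke_col am c -> is_mass (cell_law c.1 true (c.2 * am)).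
Proof.
move=> [c0 c1]; apply: cell_law_is_mass; rewrite ?orbT ?andbT//.
by rewrite mulr_ge0// ltW.
Qed.

Lemma left_law_is_mass r : burke_row ap r -> is_mass (cell_law true r.1 (ap * r.2)).
Proof.
by move=> [r0 r1]; apply: cell_law_is_mass => //; rewrite mulr_ge0// ltW.
Qed.

Lemma cell_law_pair_is_mass c r : burke_col am c -> burke_row ap r ->
  burke_pair c r -> is_mass (cell_law c.1 r.1 (c.2 * r.2)).
Proof.
move=> [c0 c1] [r0 r1] cr; apply: cell_law_is_mass => //; first by rewrite mulr_ge0.
move=> /andP[/c1 h1 /r1 h2].
rewrite -burke_prod.
by apply: mulr_ilt1 => //; rewrite mulr_ge0// ltW.
Qed.

(** Induction on the columns: by [burke_cell] the two increments leaving the first cell are again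
    independent with the entering laws, and the vertical one enters the rest of the row. *)
Lemma burke_row_step cols r (f : seq nat -> nat -> \bar R) :
  (forall c, List.In c cols -> burke_col am c /\ burke_pair c r) ->
  burke_row ap r -> (forall s j, 0 <= f s j) ->
  EX (row_laws cols (true, am)) (fun Is =>
    Ex (cell_law true r.1 (ap * r.2)) (fun J => EX (row_laws cols r) (fun Ks =>
      let q := row_out [seq c.1 | c <- cols] r.1 Is J Ks in f q.1 q.2))) =
  EX (row_laws cols (true, am)) (fun Is =>
    Ex (cell_law true r.1 (ap * r.2)) (fun J => f Is J)).
Proof.
move=> + hr; have hJ := left_law_is_mass hr.
elim: cols f => [|c cols IH] f hcols f0 //=.
have [hc hcr] := hcols c (or_introl erefl).
have {}hcols c' : List.In c' cols -> burke_col am c' /\ burke_pair c' r.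
  by move=> h; apply: hcols; right.
have hk := cell_law_pair_is_mass hc hr hcr.
have hc1 := col_law_is_mass hc.
have hcm : is_masses (row_laws cols (true, am)).
  by move=> mu /List.in_map_iff[c' [<- /hcols[hc' _]]]; exact: col_law_is_mass.
have hrm : is_masses (row_laws cols r).
  move=> mu /List.in_map_iff[c' [<- /hcols[hc' hcr']]].
  exact: cell_law_pair_is_mass.
pose G i j := EX (row_laws cols (true, am)) (fun Is =>
   EX (row_laws cols r) (fun Ks =>
     let q := row_out [seq c.1 | c <- cols] r.1 Is j Ks in f (i :: q.1) q.2)).
have G0 i j : 0 <= G i j by do 2 apply: EX_ge0 => // ?.
transitivity (Ex (cell_law c.1 true (c.2 * am)) (fun i =>
   Ex (cell_law true r.1 (ap * r.2)) (fun j => Ex (cell_law c.1 r.1 (c.2 * r.2))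
     (fun k => G (out_x c.1 r.1 i j k) (out_y c.1 r.1 i j k))))).
  apply: eq_Ex => i; rewrite EX_Ex//; last first.
    by move=> s j; apply: Ex_ge0 => // k; exact: EX_ge0.
  apply: eq_Ex => j; rewrite EX_Ex//; last by move=> s k; exact: EX_ge0.
have a0 : (0 <= c.2 * am)%R by rewrite mulr_ge0//; [case: hc|exact: ltW].
have b0 : (0 <= ap * r.2)%R by rewrite mulr_ge0//; [exact: ltW|case: hr].
have abP : (~~ (c.1 || r.1) -> c.2 * am * (ap * r.2) <= 1)%R by rewrite burke_prod.
have := burke_cell a0 b0 hc.2 hr.2 abP G0; rewrite burke_prod => ->.
apply: eq_Ex => i; rewrite /G -EX_Ex//; last first.
  by move=> s j; apply: EX_ge0.
by rewrite (IH (fun s j => f (i :: s) j)).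
Qed.

Fixpoint ER (ls : seq (seq (nat -> R))) (f : seq (seq nat) -> \bar R) : \bar R :=
  if ls is l :: ls' then EX l (fun s => ER ls' (fun ss => f (s :: ss)))
  else f [::].

Lemma ER_flatten ls f :
  ER ls f = EX (flatten ls) (fun s => f (reshape (shape ls) s)).
Proof.
elim: ls f => //= l ls IH f; rewrite EX_cat.
apply: eq_EX => s sz; rewrite IH.
by apply: eq_EX => t _; rewrite -sz take_size_cat// drop_size_cat.
Qed.

Definition is_mass_rows (ls : seq (seq (nat -> R))) :=
  forall l, List.In l ls -> is_masses l.

Lemma is_mass_rowsE ls : is_mass_rows ls -> is_masses (flatten ls).
Proof.
elim: ls => //= l ls IH h; apply/is_masses_cat; split; first by apply: h; left.
by apply: IH => l' h'; apply: h; right.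
Qed.

(** The head of each data row is the boundary weight on its left, which is the increment entering
    that row. *)
Fixpoint right_exits (ws wys : seq bool) (Is : seq nat) (data : seq (seq nat)) : nat :=
  match wys, data with
  | wy :: wys', s :: data' =>
    let q := row_out ws wy Is (head 0%N s) (behead s) in
    (q.2 + right_exits ws wys' q.1 data')%N
  | _, _ => 0%N
  end.

(** Each row returns the horizontal increments with their original law, so the same argument applies
    to the next row, and its exit has the mean of its left boundary weight. *)
Lemma right_exits_mean cols rows :
  (forall c, List.In c cols -> burke_col am c) ->
  (forall r, List.In r rows -> burke_row ap r) ->
  (forall c r, List.In c cols -> List.In r rows -> burke_pair c r) ->
  EX (row_laws cols (true, am)) (fun Is =>
    ER [seq row_laws ((true, ap) :: cols) r | r <- rows]
      (fun data => (right_exits [seq c.1 | c <- cols] [seq r.1 | r <- rows]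
                       Is data)%:R%:E)) =
  (\sum_(r <- rows) cell_mean r.1 (ap * r.2))%:E.
Proof.
move=> hc; have hcm : is_masses (row_laws cols (true, am)).
  by move=> mu /List.in_map_iff[c' [<- /hc hc']]; exact: col_law_is_mass.
elim: rows => [|r rows IH] hr hcr.
  by rewrite /= big_nil EX_cst.
have {}IH := IH (fun r h => hr r (or_intror h)) (fun c r hc h => hcr c r hc (or_intror h)).
have hr1 : burke_row ap r by apply: hr; left.
have hcr1 c : List.In c cols -> burke_col am c /\ burke_pair c r.
  by move=> h; split; [exact: hc|apply: hcr => //; left].
have hrm : is_masses (flatten [seq row_laws ((true, ap) :: cols) r | r <- rows]).
  apply: is_mass_rowsE => l /List.in_map_iff[r' [<- hr']] mu /=.
  have hr'' : burke_row ap r' by apply: hr; right.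
  move=> [<-|/List.in_map_iff[c [<- hc']]]; first exact: left_law_is_mass.
  by apply: cell_law_pair_is_mass => //; [exact: hc|apply: hcr => //; right].
pose H Is := ER [seq row_laws ((true, ap) :: cols) r | r <- rows]
      (fun data => (right_exits [seq c.1 | c <- cols] [seq r.1 | r <- rows]
                       Is data)%:R%:E).
have H0 Is : 0 <= H Is by rewrite /H ER_flatten; apply: EX_ge0.
transitivity (EX (row_laws cols (true, am)) (fun Is =>
    Ex (cell_law true r.1 (ap * r.2)) (fun J => EX (row_laws cols r) (fun Ks =>
      let q := row_out [seq c.1 | c <- cols] r.1 Is J Ks in q.2%:R%:E + H q.1)))).
  apply: eq_EX => Is _ /=; apply: eq_Ex => J; apply: eq_EX => Ks _.
  rewrite /H !ER_flatten -[X in X + _](EX_cst hrm)// -EXD//.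
  by apply: eq_EX => t _ /=; rewrite -EFinD natrD.
rewrite (burke_row_step (f := fun s j => j%:R%:E + H s))//; last first.
  by move=> s j; rewrite adde_ge0.
have hJ := left_law_is_mass hr1.
transitivity (EX (row_laws cols (true, am)) (fun Is =>
   (cell_mean r.1 (ap * r.2))%:E + H Is)).
  apply: eq_EX => Is _; rewrite ExD// Ex_cst//.
  rewrite -cell_law_mean//; last 2 first.
  - by rewrite mulr_ge0//; [exact: ltW|case: hr1].
  - by case: hr1.
  by case: (r.1).
have m0 : 0 <= (cell_mean r.1 (ap * r.2))%:E.
  have [r0 r1] := hr1; rewrite lee_fin /cell_mean; have ar0 : (0 <= ap * r.2)%R.
    by rewrite mulr_ge0// ltW.
  case: (r.1) r1 => r1; rewrite divr_ge0// ?subr_ge0 ?addr_ge0//.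
  by rewrite ltW// r1.
by rewrite EXD// EX_cst// IH big_cons EFinD.
Qed.

Lemma bottom_mean cols : (forall c, List.In c cols -> burke_col am c) ->
  EX (row_laws cols (true, am)) (fun s => (sumn s)%:R%:E) =
  (\sum_(c <- cols) cell_mean c.1 (c.2 * am))%:E.
Proof.
elim: cols => [|c cols IH] hc; first by rewrite big_nil.
rewrite /= big_cons EFinD.
have hc1 : burke_col am c by apply: hc; left.
have {}hc c' : List.In c' cols -> burke_col am c' by move=> h; apply: hc; right.
have hcm : is_masses (row_laws cols (true, am)).
  by move=> mu /List.in_map_iff[c' [<- /hc hc']]; exact: col_law_is_mass.
transitivity (Ex (cell_law c.1 true (c.2 * am)) (fun k => k%:R%:E +
   EX (row_laws cols (true, am)) (fun s => (sumn s)%:R%:E))).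
  apply: eq_Ex => k; rewrite -[X in X + _](EX_cst hcm)// -EXD//.
  by apply: eq_EX => s _; rewrite -EFinD natrD.
have hcl := col_law_is_mass hc1.
have [c0 c1] := hc1.
rewrite ExD//; last by move=> _; exact: EX_ge0.
rewrite Ex_cst//; last exact: EX_ge0.
by rewrite cell_law_mean ?IH// mulr_ge0// ltW.
Qed.

End burke_rows.

(** * Increments of the last passage time *)

Section lpp_rows.
Variables (cx ry : nat -> bool) (W : nat -> nat -> nat).
Local Notation L := (lpp cx ry W).

Let inc k := fun j => (L k.+1 j.+2 - L k.+1 j.+1)%N.

Lemma lpp_step_shift wx wy c i j k :
  lpp_step wx wy c (c + i) (c + j) k = (c + lpp_step wx wy 0 i j k)%N.
Proof. by rewrite /lpp_step; case: wx; case: wy; lia. Qed.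

(** [lpp_step] commutes with adding a constant ([lpp_step_shift]), so the increments obey a
    recursion of their own, which is [row_out]. *)
Lemma row_out_lpp k j0 n :
  row_out [seq cx j.+1 | j <- iota j0 n] (ry k.+1) [seq inc k j | j <- iota j0 n]
    (L k.+2 j0.+1 - L k.+1 j0.+1) [seq W j.+1 k.+1 | j <- iota j0 n] =
  ([seq inc k.+1 j | j <- iota j0 n],
   (L k.+2 (j0 + n).+1 - L k.+1 (j0 + n).+1)%N).
Proof.
elim: n j0 => [|n IH] j0 /=; first by rewrite addn0.
pose c := L k.+1 j0.+1.
have E1 : L k.+1 j0.+2 = (c + inc k j0)%N by rewrite subnKC// lpp_leSr.
have E2 : L k.+2 j0.+1 = (c + (L k.+2 j0.+1 - c))%N by rewrite subnKC// lpp_leS.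
have E3 : L k.+2 j0.+2 = (c + lpp_step (cx j0.+1) (ry k.+1) 0 (inc k j0)
    (L k.+2 j0.+1 - c) (W j0.+1 k.+1))%N.
  by rewrite lppS E1 {1}E2 lpp_step_shift.
have -> : out_y (cx j0.+1) (ry k.+1) (inc k j0) (L k.+2 j0.+1 - c) (W j0.+1 k.+1) =
    (L k.+2 j0.+2 - L k.+1 j0.+2)%N by rewrite /out_y E3 E1 subnDl.
rewrite (IH j0.+1) /= addSnnS; congr ((_ :: _), _).
rewrite /out_x /inc E3 [in RHS]E2.
by rewrite subnDl addKn.
Qed.

Hypotheses (cx0 : cx 0 = true) (ry0 : ry 0 = true).

Lemma lpp_col1 k : L k.+1 1 = (L k 1 + W 0 k)%N.
Proof. by rewrite lppS cx0 !lpp0 /lpp_step; case: (ry k); lia. Qed.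

Lemma right_exits_lpp n m k0 :
  right_exits [seq cx j.+1 | j <- iota 0 n] [seq ry k.+1 | k <- iota k0 m]
   [seq inc k0 j | j <- iota 0 n]
   [seq [seq W j k.+1 | j <- iota 0 n.+1] | k <- iota k0 m] =
  (L (k0 + m).+1 n.+1 - L k0.+1 n.+1)%N.
Proof.
elim: m k0 => [|m IH] k0 /=; first by rewrite addn0 subnn.
have -> : W 0 k0.+1 = (L k0.+2 1 - L k0.+1 1)%N by rewrite lpp_col1 addKn.
have -> : [seq W j k0.+1 | j <- iota 1 n] = [seq W j.+1 k0.+1 | j <- iota 0 n].
  by rewrite (iotaDl 1 0 n) -map_comp.
rewrite row_out_lpp /= IH add0n addSnnS.
have h1 : (L k0.+1 n.+1 <= L k0.+2 n.+1)%N by exact: lpp_leS.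
have h2 : (L k0.+2 n.+1 <= L (k0 + m.+1).+1 n.+1)%N.
  elim: (m) => [|p IHp]; first by rewrite addn1.
  by apply: leq_trans IHp _; rewrite [(k0 + p.+2)%N]addnS; exact: lpp_leS.
by move: h1 h2; clear; lia.
Qed.

(** Telescoping along the bottom row and then up the right side. Row 0 and column 0 are weak, so the
    increments along them are the weights themselves. *)
Lemma lpp_rows n m : W 0 0 = 0%N ->
  L m.+1 n.+1 = (sumn [seq W j.+1 0 | j <- iota 0 n] +
  right_exits [seq cx j.+1 | j <- iota 0 n] [seq ry k.+1 | k <- iota 0 m]
   [seq W j.+1 0 | j <- iota 0 n]
   [seq [seq W j k.+1 | j <- iota 0 n.+1] | k <- iota 0 m])%N.
Proof.
move=> W00.
have row1 j : L 1 j.+1 = (L 1 j + W j 0)%N.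
  by rewrite lppS ry0 /lpp_step /=; case: (cx j); rewrite max0n.
have -> : [seq W j.+1 0 | j <- iota 0 n] = [seq inc 0 j | j <- iota 0 n].
  by apply: eq_map => j; rewrite /inc (row1 j.+1) addKn.
rewrite right_exits_lpp add0n.
have -> : sumn [seq inc 0 j | j <- iota 0 n] = L 1 n.+1.
  elim: n => [|n IH]; first by rewrite /= row1 lpp0.
  rewrite -addn1 iotaD map_cat sumn_cat IH /= addn0 add0n /inc addn1.
  by rewrite subnKC// lpp_leSr.
rewrite subnKC//; elim: m => // m IH.
by apply: leq_trans IH _; exact: lpp_leS.
Qed.

End lpp_rows.

(** * Mean passage time of the solvable grid *)

Section burke_grid.
Variable R : realType.
Local Open Scope ereal_scope.

Lemma Ex_zero_mass (f : nat -> \bar R) : (forall k, 0 <= f k) ->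
  Ex (@zero_mass R) f = f 0%N.
Proof.
move=> f0; rewrite /Ex (nneseriesD1 (n := 0%N))//; last first.
  by move=> k _; rewrite /zero_mass mule_ge0// lee_fin ler0n.
rewrite eseries0 /zero_mass ?eqxx ?mul1e ?adde0// => k _ /andP[_ /negbTE->].
by rewrite mul0e.
Qed.

Lemma zero_mass_is_mass : is_mass (@zero_mass R).
Proof.
split=> [k|]; first by rewrite /zero_mass ler0n.
have := @Ex_zero_mass (fun=> 1); rewrite /Ex.
by under eq_eseriesr do rewrite mule1; apply.
Qed.

Definition grid_laws (law : nat -> nat -> nat -> R) (n m : nat) :=
  [seq [seq law i j | i <- iota 0 n] | j <- iota 0 m].

Definition weight_of (ss : seq (seq nat)) : nat -> nat -> nat :=
  fun i j => nth 0%N (nth [::] ss j) i.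

Lemma In_iota_lt k m p : List.In k (iota m p) -> (k < m + p)%N.
Proof.
elim: p m => //= p IH m [<-|/IH]; last by rewrite addSnnS.
by rewrite -addSnnS leq_addr.
Qed.

Lemma is_mass_grid law n m :
  (forall i j, (i < n)%N -> (j < m)%N -> is_mass (law i j)) ->
  is_masses (flatten (grid_laws law n m)).
Proof.
move=> h; apply: is_mass_rowsE => l /List.in_map_iff[j [<- hj]].
move=> mu /List.in_map_iff[i [<- hi]].
by apply: h; [exact: In_iota_lt hi|exact: In_iota_lt hj].
Qed.

Lemma grid_st_le (cx ry : nat -> bool) law law' n m :
  (forall i j, (i < n)%N -> (j < m)%N ->
    [/\ is_mass (law i j), is_mass (law' i j) & st_le (law i j) (law' i j)]) ->
  ER (grid_laws law n m) (fun ss => (lpp cx ry (weight_of ss) m n)%:R%:E) <=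
  ER (grid_laws law' n m) (fun ss => (lpp cx ry (weight_of ss) m n)%:R%:E).
Proof.
move=> h; rewrite !ER_flatten.
have -> : shape (grid_laws law n m) = shape (grid_laws law' n m).
  by rewrite /shape /grid_laws -!map_comp; apply: eq_map => j /=; rewrite !size_map.
apply: EX_st_le => //.
- by apply: is_mass_grid => i j hi hj; case: (h i j hi hj).
- by apply: is_mass_grid => i j hi hj; case: (h i j hi hj).
- rewrite /grid_laws.
  have inE' (k p : nat) : k \in iota 0 p -> (k < p)%N by rewrite mem_iota.
  have : {subset iota 0 m <= iota 0 m} by [].
  elim: {1 3 4}(iota 0 m) => //= j l IH jl.
  apply: List.Forall2_app; last by apply: IH => k kl; apply: jl; rewrite inE kl orbT.
  have jm : (j < m)%N by apply: inE'; apply: jl; rewrite mem_head.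
  have : {subset iota 0 n <= iota 0 n} by [].
  elim: {1 3 4}(iota 0 n) => //= i l' IH' il; constructor; last first.
    by apply: IH' => k kl; apply: il; rewrite inE kl orbT.
  by case: (h i j _ jm) => //; apply: inE'; apply: il; rewrite mem_head.
- move=> s t st; rewrite lee_fin ler_nat; apply: lpp_le => i j; rewrite /weight_of.
  elim: (shape _) s t st i j => [|k sh IH] s t st i j; first by rewrite !nth_nil.
  case: j => [|j] /=; last first.
    apply: IH; move: st; elim: k s t => [|k IHk] [|x s] [|y t] //=.
    by case/andP => _; exact: IHk.
  elim: k s t i st => [|k IHk] [|x s] [|y t] [|i] //=; first by case/andP.
  by case/andP => _; exact: IHk.
Qed.

Lemma eq_ER ls (f g : seq (seq nat) -> \bar R) :
  (forall ss, shape ss = shape ls -> f ss = g ss) -> ER ls f = ER ls g.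
Proof.
elim: ls f g => [|l ls IH] f g fg /=; first exact: fg.
by apply: eq_EX => s sz; apply: IH => ss sh; apply: fg; rewrite /= sz sh.
Qed.

Lemma ER_addl ls (c : \bar R) (f : seq (seq nat) -> \bar R) :
  is_masses (flatten ls) -> 0 <= c -> (forall ss, 0 <= f ss) ->
  ER ls (fun ss => c + f ss) = c + ER ls f.
Proof. by move=> h c0 f0; rewrite !ER_flatten EXD// EX_cst. Qed.

Lemma map_nth_row (s : seq nat) n : size s = n ->
  [seq nth 0%N s i | i <- iota 0 n] = s.
Proof. by move=> <-; exact: mkseq_nth. Qed.

(** Index 0 stands for Sigma in both directions, with an empty corner cell. [bottom_mean] gives the
    first sum and [right_exits_mean] the second. *)
Lemma lpp_mean (cx ry : nat -> bool) (px py : nat -> R) n m :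
  cx 0%N = true -> ry 0%N = true -> (0 < px 0%N)%R -> (px 0%N * py 0%N = 1)%R ->
  (forall i, (0 < i <= n)%N -> (0 <= px i)%R /\ (cx i -> px i * py 0%N < 1)%R) ->
  (forall j, (0 < j <= m)%N -> (0 <= py j)%R /\ (ry j -> px 0%N * py j < 1)%R) ->
  (forall i j, (0 < i <= n)%N -> (0 < j <= m)%N -> ~~ (cx i || ry j) ->
    (px i * py j <= 1)%R) ->
  let law (i j : nat) := if (i == 0%N) && (j == 0%N) then @zero_mass R
                 else cell_law (cx i) (ry j) (px i * py j) in
  ER (grid_laws law n.+1 m.+1)
     (fun ss => (lpp cx ry (weight_of ss) m.+1 n.+1)%:R%:E) =
  (\sum_(i <- iota 0 n) cell_mean (cx i.+1) (px i.+1 * py 0%N) +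
   \sum_(j <- iota 0 m) cell_mean (ry j.+1) (px 0%N * py j.+1))%:E.
Proof.
move=> cx0 ry0 ap0 apm hc hr hp law.
pose cols := [seq (cx i.+1, px i.+1) | i <- iota 0 n].
pose rows := [seq (ry j.+1, py j.+1) | j <- iota 0 m].
have In_iota (k p : nat) : List.In k (iota 0 p) -> (0 < k.+1 <= p)%N.
  by move=> /In_iota_lt.
have hcols c : List.In c cols -> burke_col (py 0%N) c.
  by move=> /List.in_map_iff[i [<- /In_iota hi]]; exact: hc.
have hrows r : List.In r rows -> burke_row (px 0%N) r.
  by move=> /List.in_map_iff[j [<- /In_iota hj]]; exact: hr.
have hpairs c r : List.In c cols -> List.In r rows -> burke_pair c r.
  move=> /List.in_map_iff[i [<- /In_iota hi]] /List.in_map_iff[j [<- /In_iota hj]].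
  exact: hp.
have cE : [seq c.1 | c <- cols] = [seq cx i.+1 | i <- iota 0 n] by rewrite -map_comp.
have rE : [seq r.1 | r <- rows] = [seq ry i.+1 | i <- iota 0 m] by rewrite -map_comp.
have shiftE T (f : nat -> T) p : [seq f i | i <- iota 1 p] = [seq f i.+1 | i <- iota 0 p].
  by rewrite (iotaDl 1 0 p) -map_comp.
have hcm : is_masses (row_laws cols (true, py 0%N)).
  move=> mu /List.in_map_iff[c' [<- /hcols hc']].
  exact: (col_law_is_mass ap0 apm).
have hrm : is_masses (flatten [seq row_laws ((true, px 0%N) :: cols) r | r <- rows]).
  apply: is_mass_rowsE => l /List.in_map_iff[r' [<- hr']] mu /=.
  have hr'' : burke_row (px 0%N) r' by exact: hrows.
  move=> [<-|/List.in_map_iff[c [<- hc']]].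
    exact: (left_law_is_mass ap0 hr'').
  by apply: (cell_law_pair_is_mass ap0 apm) => //; [exact: hcols|exact: hpairs].
have -> : grid_laws law n.+1 m.+1 = (@zero_mass R :: row_laws cols (true, py 0%N)) ::
    [seq row_laws ((true, px 0%N) :: cols) r | r <- rows].
  rewrite /grid_laws /= !shiftE -map_comp; congr (_ :: _).
    rewrite /law /=; congr (_ :: _); rewrite /row_laws -map_comp.
    by apply: eq_map => i /=; rewrite /law /= ry0.
  apply: eq_map => j /=; rewrite /law andbF cx0; congr (_ :: _).
  by rewrite shiftE /row_laws -map_comp.
rewrite /= Ex_zero_mass; last first.
  by move=> k; apply: EX_ge0 => // s; rewrite ER_flatten; exact: EX_ge0.
have shE : shape [seq row_laws ((true, px 0%N) :: cols) r | r <- rows] = nseq m n.+1.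
  rewrite /shape -!map_comp.
  transitivity [seq n.+1 | _ <- iota 0 m].
    by apply: eq_map => j /=; rewrite !size_map size_iota.
  by elim: (m) 0%N => //= p IHp k; rewrite IHp.
transitivity (EX (row_laws cols (true, py 0%N)) (fun Is => (sumn Is)%:R%:E +
   ER [seq row_laws ((true, px 0%N) :: cols) r | r <- rows]
      (fun data => (right_exits [seq c.1 | c <- cols] [seq r.1 | r <- rows]
                       Is data)%:R%:E))).
  apply: eq_EX => s; rewrite !size_map size_iota => sz.
  rewrite -ER_addl//.
  apply: eq_ER => ss; rewrite shE => shs.
  rewrite -EFinD -natrD; congr (_%:R%:E).
  rewrite (@lpp_rows cx ry (weight_of ((0%N :: s) :: ss)) cx0 ry0 n m)// cE rE.
  have -> : [seq weight_of ((0%N :: s) :: ss) j.+1 0 | j <- iota 0 n] = s.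
    by rewrite /weight_of /= map_nth_row.
  congr (_ + right_exits _ _ _ _)%N.
  have ms : size ss = m by rewrite -(size_map size) -/(shape ss) shs size_nseq.
  rewrite -[RHS](mkseq_nth [::]) /mkseq ms.
  apply/eq_in_map => k; rewrite mem_iota /= => km.
  rewrite -[RHS](@map_nth_row _ n.+1); last first.
    have := congr1 (fun t => nth 0%N t k) shs.
    by rewrite nth_nseq km /shape (nth_map [::]) ?ms.
  by rewrite /weight_of.
rewrite EXD//; last by move=> s; rewrite ER_flatten; exact: EX_ge0.
rewrite (bottom_mean ap0 apm)// (right_exits_mean ap0 apm)// -EFinD.
by rewrite /cols /rows !big_map.
Qed.

End burke_grid.

(** * Independence *)

Section independence.
Context (R : realType) (d : measure_display) (T : measurableType d)
  (P : probability T R).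
Local Open Scope ereal_scope.

Lemma bigcap_set_cons (I : eqType) (i : I) (s : seq I) (A : I -> set T) :
  \bigcap_(k in [set` i :: s]) A k = A i `&` \bigcap_(k in [set` s]) A k.
Proof.
apply/seteqP; split=> x hx.
  by split=> [|k ks]; apply: hx; rewrite /= inE ?eqxx// ks orbT.
by case: hx => hi hs k /=; rewrite inE => /predU1P[->//|]; exact: hs.
Qed.

Lemma bigcap_set_nil (I : eqType) (A : I -> set T) :
  \bigcap_(k in [set` [::]]) A k = setT.
Proof. by apply/seteqP; split. Qed.

Lemma measurable_bigcap_seq (I : eqType) (s : seq I) (A : I -> set T) :
  (forall i, i \in s -> measurable (A i)) ->
  measurable (\bigcap_(i in [set` s]) A i).
Proof.
elim: s => [|i s IH] h; first by rewrite bigcap_set_nil; exact: measurableT.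
rewrite bigcap_set_cons; apply: measurableI; first by apply: h; rewrite mem_head.
by apply: IH => k ks; apply: h; rewrite inE ks orbT.
Qed.

Lemma dynkin_indep_of (B : set T) : measurable B ->
  dynkin [set A | measurable A /\ P (A `&` B) = P A * P B].
Proof.
move=> mB; split.
- by split; [exact: measurableT|rewrite setTI probability_setT mul1e].
- move=> A [mA AB]; split; first exact: measurableC.
  have -> : P (~` A `&` B) = P B - P (B `&` A).
    rewrite setIC -setDE; apply: measureD => //.
    by rewrite (le_lt_trans (probability_le1 _ _))// ltry.
  rewrite (setIC B A) AB probability_setC//.
  rewrite -(fineK (fin_num_measure P _ mA)) -(fineK (fin_num_measure P _ mB)).
  rewrite -EFinM -(EFinB 1) -EFinM -EFinB; congr EFin; ring.
- move=> A tA hA; split; first by apply: bigcup_measurable => k _; case: (hA k).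
  have mA k : measurable (A k) by case: (hA k).
  have mU : measurable (\bigcup_k A k) by exact: bigcup_measurable.
  rewrite setI_bigcupl !measure_semi_bigcup//.
  - rewrite -nneseriesZr//.
    by apply: eq_eseriesr => k _; case: (hA k).
  - by move=> i; exact: measurableI.
  - exact: trivIset_setIr.
  - by rewrite -setI_bigcupl; exact: measurableI.
Qed.

Lemma dynkin_measurable (F : set_system T) : (forall A, F A -> measurable A) ->
  forall A, <<d F >> A -> measurable A.
Proof.
move=> mF A; apply; split => //; split.
- exact: measurableT.
- by move=> B; exact: measurableC.
- by move=> B _ mB; exact: bigcup_measurable.
Qed.

(** The events independent of a given one form a Dynkin system, so each family can be enlarged in
    turn. Generating Dynkin systems instead of sigma-algebras avoids asking for stability under
    intersection. *)
Lemma indep_dynkin (I : eqType) (F : I -> set_system T) :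
  (forall i A, F i A -> measurable A) -> mutually_independent P F ->
  mutually_independent P (fun i => <<d F i >>).
Proof.
move=> mF iF.
(* [J1] holds the indices already enlarged, [J2] those still restricted to generating events. *)
suff H (J1 J2 : seq I) (A : I -> set T) : uniq (J1 ++ J2) ->
    (forall i, i \in J1 -> <<d F i >> (A i)) -> (forall i, i \in J2 -> F i (A i)) ->
    P (\bigcap_(i in [set` J1 ++ J2]) A i) = \prod_(i <- J1 ++ J2) P (A i).
  by move=> J A uJ hA; have := H J [::] A; rewrite cats0; apply.
elim: J1 J2 A => [|i J1 IH] J2 A; first by move=> u _; exact: iF.
rewrite cat_cons => uJ h1 h2; rewrite bigcap_set_cons big_cons.
have /andP[inJ uJ'] : (i \notin J1 ++ J2) && uniq (J1 ++ J2) by [].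
have mB : measurable (\bigcap_(k in [set` J1 ++ J2]) A k).
  apply: measurable_bigcap_seq => k; rewrite mem_cat => /orP[kJ|/h2/mF//].
  by apply: (@dynkin_measurable (F k)) => //; [exact: mF|apply: h1; rewrite inE kJ orbT].
have PB : P (\bigcap_(k in [set` J1 ++ J2]) A k) = \prod_(k <- J1 ++ J2) P (A k).
  by apply: IH => // k kJ; apply: h1; rewrite inE kJ orbT.
rewrite -PB.
suff: [set X | measurable X /\ P (X `&` (\bigcap_(k in [set` J1 ++ J2]) A k)) =
    P X * P (\bigcap_(k in [set` J1 ++ J2]) A k)] (A i) by case.
have := h1 i (mem_head _ _); apply; split; first exact: dynkin_indep_of.
move=> X FX; split; first exact: mF FX.
pose A' k := if k == i then X else A k.
have E k : k \in J1 ++ J2 -> A' k = A k.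
  by move=> kJ; rewrite /A'; case: eqP => // ki; rewrite -ki kJ in inJ.
have := IH (i :: J2) A'.
have uJ2 : uniq (J1 ++ i :: J2).
  by rewrite -(perm_uniq (s1 := i :: J1 ++ J2))// -(cat1s i J2) -(cat1s i (_ ++ _)) perm_catCA.
move=> /(_ uJ2) H.
have {}H : P (\bigcap_(k in [set` J1 ++ i :: J2]) A' k) = \prod_(k <- J1 ++ i :: J2) P (A' k).
  apply: H => [k kJ|k].
    by rewrite E ?mem_cat ?kJ//; apply: h1; rewrite inE kJ orbT.
  rewrite inE => /predU1P[->|kJ]; first by rewrite /A' eqxx.
  by rewrite E ?mem_cat ?kJ ?orbT//; exact: h2.
have perm : perm_eq (J1 ++ i :: J2) (i :: J1 ++ J2).
  by rewrite -(cat1s i J2) -(cat1s i (_ ++ _)) perm_catCA.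
move: H; rewrite (perm_big _ perm) big_cons.
have -> : [set` J1 ++ i :: J2] = [set` i :: J1 ++ J2].
  by apply/seteqP; split=> k /=; rewrite (perm_mem perm).
have A'i : A' i = X by rewrite /A' eqxx.
rewrite bigcap_set_cons A'i => H.
have -> : \bigcap_(k in [set` J1 ++ J2]) A k = \bigcap_(k in [set` J1 ++ J2]) A' k.
  by apply: eq_bigcapr => k /= /E ->.
have prodE : \prod_(j <- J1 ++ J2) P (A j) = \prod_(j <- J1 ++ J2) P (A' j).
  by apply: eq_big_seq => k /E ->.
have PB' : P (\bigcap_(k in [set` J1 ++ J2]) A' k) = \prod_(j <- J1 ++ J2) P (A' j).
  rewrite -prodE -PB; congr (P _); apply: eq_bigcapr => k /= /E ->.
  by [].
by rewrite PB'; exact: H.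
Qed.

(** Used twice: to gather the coordinates of one point, then the points and the count of one block
    product. *)
Definition group_system (I J : eqType) (h : I -> J) (F : I -> set_system T) (j : J) :
    set_system T :=
  [set A | exists (s : seq I) (B : I -> set T),
    [/\ uniq s, (forall i, i \in s -> h i = j /\ F i (B i)) &
        A = \bigcap_(i in [set` s]) B i]].

Lemma bigcap_flatten (I : eqType) (ss : seq (seq I)) (B : I -> set T) :
  \bigcap_(i in [set` flatten ss]) B i =
  \bigcap_(s in [set` ss]) \bigcap_(i in [set` s]) B i.
Proof.
elim: ss => [|s ss IH]; first by rewrite !bigcap_set_nil.
rewrite bigcap_set_cons -IH /=; apply/seteqP; split=> x.
  by move=> h; split=> i /= ins; apply: h; rewrite /= mem_cat ins ?orbT.
by move=> [h1 h2] i /=; rewrite mem_cat => /orP[] ?; [exact: h1|exact: h2].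
Qed.

Lemma indep_group (I J : eqType) (h : I -> J) (F : I -> set_system T) :
  mutually_independent P F -> mutually_independent P (group_system h F).
Proof.
move=> iF L A uL hA.
have H j : exists sB : seq I * (I -> set T), j \in L ->
    [/\ uniq sB.1, (forall i, i \in sB.1 -> h i = j /\ F i (sB.2 i)) &
        A j = \bigcap_(i in [set` sB.1]) sB.2 i].
  have [jL|jL] := boolP (j \in L); last by exists ([::], fun=> setT).
  by have [s [B sB]] := hA _ jL; exists (s, B).
have [g hg] := choice H.
pose B i := (g (h i)).2 i.
have gB j : j \in L -> A j = \bigcap_(i in [set` (g j).1]) B i.
  move=> jL; have [_ h2 ->] := hg j jL; apply: eq_bigcapr => i /h2[hi _].
  by rewrite /B hi.
have uf : uniq (flatten [seq (g j).1 | j <- L]).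
  elim: L uL hg {hA H gB} => //= j L IH /andP[jL uL] hg.
  rewrite cat_uniq IH//; last by move=> k kL; apply: hg; rewrite inE kL orbT.
  have [-> h2 _] := hg j (mem_head _ _); rewrite andbT/=.
  apply/hasPn => i /flattenP[_ /mapP[k kL ->]] ik; apply/negP => /h2[hij _].
  have [_ h3 _] := hg k (ltac:(by rewrite inE kL orbT)).
  by have [hik _] := h3 i ik; move: jL; rewrite -hij hik kL.
have FB i : i \in flatten [seq (g j).1 | j <- L] -> F i (B i).
  move=> /flattenP[_ /mapP[j jL ->]] ij; have [_ h2 _] := hg j jL.
  by have [hi Fi] := h2 i ij; rewrite /B hi.
have := iF _ B uf FB; rewrite bigcap_flatten big_flatten big_map.
have -> : \bigcap_(s in [set` [seq (g j).1 | j <- L]]) \bigcap_(i in [set` s]) B i =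
    \bigcap_(j in [set` L]) A j.
  apply/seteqP; split=> x hx.
    by move=> j /= jL; rewrite gB//; apply: hx; exact/mapP/(ex_intro2 _ _ j).
  by move=> _ /mapP[j jL ->]; rewrite -gB//; exact: hx.
move=> ->; apply: eq_big_seq => j jL; rewrite gB// iF//.
- by have [] := hg j jL.
- by move=> i ij; apply: FB; apply/flattenP; exists (g j).1 => //; exact: map_f.
Qed.

(** Independence between the groups and inside each group gives independence of all events, by
    splitting products along the fibers of [h]. *)
Lemma indep_ungroup (I J : eqType) (h : I -> J) (G : J -> set_system T)
    (E : I -> set T) (Is : seq I) : uniq Is ->
  mutually_independent P G ->
  (forall j (s : seq I), uniq s -> (forall i, i \in s -> i \in Is /\ h i = j) ->
     G j (\bigcap_(i in [set` s]) E i) /\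
     P (\bigcap_(i in [set` s]) E i) = \prod_(i <- s) P (E i)) ->
  P (\bigcap_(i in [set` Is]) E i) = \prod_(i <- Is) P (E i).
Proof.
move=> uI iG hE; pose L := undup [seq h i | i <- Is].
pose fib j := [seq i <- Is | h i == j].
have fibP j i : i \in fib j -> i \in Is /\ h i = j.
  by rewrite mem_filter => /andP[/eqP].
have ufib j : uniq (fib j) by exact: filter_uniq.
have -> : \bigcap_(i in [set` Is]) E i =
    \bigcap_(j in [set` L]) \bigcap_(i in [set` fib j]) E i.
  apply/seteqP; split=> x hx.
    by move=> j _ i /fibP[iI _]; exact: hx.
  move=> i /= iI; apply: (hx (h i)); first by rewrite /= mem_undup map_f.
  by rewrite /= mem_filter eqxx.
rewrite iG ?undup_uniq//; last by move=> j _; case: (hE j (fib j)) => //; exact: fibP.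
under eq_bigr => j _.
  rewrite (hE j (fib j) (ufib j) (fibP j)).2 big_filter; over.
rewrite (exchange_big_dep xpredT)//=; apply: eq_big_seq => i iI.
have hiL : h i \in L by rewrite mem_undup map_f.
rewrite -big_filter (_ : seq.filter _ L = [:: h i]) ?big_seq1//.
rewrite -(filter_pred1_uniq (undup_uniq _) hiL).
by apply: eq_filter => j; rewrite /= eq_sym.
Qed.

End independence.

(** * Discretization of the alphabets *)

Section slots.
Variables (R : realType) (le : rel (Omega R)).
Hypothesis le_order : alphabet_order le.
Variable m : nat.

Let orefl : reflexive le. Proof. by case: le_order. Qed.
Let oanti : antisymmetric le. Proof. by case: le_order. Qed.
Let otrans : transitive le. Proof. by case: le_order. Qed.
Let ototal : total le. Proof. by case: le_order. Qed.
Let le_real u v : le (Oreal u) (Oreal v) = (val u <= val v).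
Proof. by case: le_order. Qed.

Lemma zero_unit01 : 0 <= (0 : R) <= 1. Proof. by rewrite lexx ler01. Qed.

Definition unit01_zero : unit01 R := exist _ 0 zero_unit01.

Definition grid_point (k : nat) : unit01 R := insubd unit01_zero (k%:R / m%:R).

Definition letter_blocks : seq block :=
  [seq Bint i | i <- iota 0 m] ++ [seq Bint' i | i <- iota 0 m].

Definition letter (b : block) : Omega R :=
  match b with
  | Breal => Oreal unit01_zero
  | Bint i => Oint i
  | Bint' i => Oint' i
  end.

Definition pivots : seq (Omega R) :=
  [seq letter b | b <- letter_blocks] ++
  [seq Oreal (grid_point k) | k <- iota 0 m.+1].

(* Each pivot contributes 0, 1 or 2 according to whether [x] is below, equal   *)
(* to or above it, so that a pivot is alone at its rank.                       *)
Definition rank (x : Omega R) : nat :=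
  \sum_(p <- pivots) (le p x + ~~ le x p).

Lemma rank_term_le x y p : le x y ->
  (le p x + ~~ le x p <= le p y + ~~ le y p)%N.
Proof.
move=> xy; apply: leq_add.
  by case: (boolP (le p x)) => // px; rewrite (otrans px xy).
by case: (boolP (le y p)) => yp; [rewrite (otrans xy yp)|exact: leq_b1].
Qed.

Lemma rank_le x y : le x y -> (rank x <= rank y)%N.
Proof. by move=> xy; apply: leq_sum => p _; exact: rank_term_le. Qed.

Lemma rank_lt x y : (rank x < rank y)%N -> le x y.
Proof.
by have /orP[//|/rank_le] := ototal x y; rewrite leqNgt => /negbTE ->.
Qed.

Lemma leq_sum_eq (I : eqType) (s : seq I) (f g : I -> nat) :
  (forall i, f i <= g i)%N -> \sum_(i <- s) f i = \sum_(i <- s) g i ->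
  forall i, i \in s -> f i = g i.
Proof.
move=> fg; elim: s => // j s IH; rewrite !big_cons => e i.
have sfg : (\sum_(i <- s) f i <= \sum_(i <- s) g i)%N by apply: leq_sum.
have ej : f j = g j
  by move: (fg j) e sfg; move: (f j) (g j) (\sum_(i <- s) f i) (\sum_(i <- s) g i); lia.
rewrite inE => /predU1P[->//|]; apply: IH.
by move: e; rewrite ej => /addnI.
Qed.

(** Every term of the rank is monotone, so equal sums force equal terms. *)
Lemma rank_eq_between x y p : rank x = rank y -> le x y -> p \in pivots ->
  (le p x = le p y) /\ (le x p = le y p).
Proof.
move=> e xy pp; have := leq_sum_eq (fun p => rank_term_le p xy) e pp.
have h1 : le p x -> le p y by move=> h; exact: otrans h xy.
have h2 : le y p -> le x p by move=> h; exact: otrans xy h.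
move: h1 h2; case: (le p x); case: (le p y); case: (le x p); case: (le y p) => //= h1 h2.
all: by [have := h1 isT|have := h2 isT].
Qed.

Lemma rank_pivot x p : p \in pivots -> rank x = rank p -> x = p.
Proof.
move=> pp e; have /orP[xp|px] := ototal x p.
  have [h1 h2] := rank_eq_between e xp pp.
  by apply: oanti; rewrite xp h1 orefl.
have [h1 h2] := rank_eq_between (esym e) px pp.
by apply: oanti; rewrite px -h2 orefl.
Qed.

Lemma rank_real_close (u v : unit01 R) : (0 < m)%N ->
  rank (Oreal u) = rank (Oreal v) -> val v - val u <= m%:R^-1.
Proof.
move=> m0 e; have [//|far] := leP (val v - val u) (m%:R^-1).
have mR : 0 < m%:R :> R by rewrite ltr0n.
have /andP[u0 u1] := valP u; have /andP[v0 v1] := valP v.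
have mu0 : 0 <= m%:R * val u by rewrite mulr_ge0// ltW.
(* The first multiple of 1/m beyond [u]; it is at most [u + 1/m], hence below [v], and as a pivot it
   separates the two. *)
pose k := (Num.truncn (m%:R * val u)).+1.
have /andP[k1 k2] := Num.Theory.truncn_itv mu0.
have uk : val u < k%:R / m%:R by rewrite ltr_pdivlMr// (mulrC (val u)).
have kv : k%:R / m%:R < val v.
  rewrite ltrBrDr in far.
  apply: le_lt_trans far; rewrite /k -natr1 mulrDl mul1r addrC lerD2l.
  by rewrite ler_pdivrMr// (mulrC (val u)).
have vk : val (grid_point k) = k%:R / m%:R.
  rewrite /grid_point val_insubd; case: ifPn => // /negP[].
  by rewrite divr_ge0//= (le_trans (ltW kv)).
have kp : Oreal (grid_point k) \in pivots.
  rewrite mem_cat; apply/orP; right; apply/mapP; exists k => //.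
  rewrite mem_iota /= add0n ltnS.
  have : k%:R < m%:R :> R by rewrite -[ltRHS]mul1r -ltr_pdivrMr// (lt_le_trans kv).
  by rewrite ltr_nat => /ltnW.
have uv : le (Oreal u) (Oreal v) by rewrite le_real ltW// (lt_trans uk kv).
have [h _] := rank_eq_between e uv kp.
by move: h; rewrite !le_real vk (ltW kv) leNgt uk.
Qed.

Definition slot (x : OmegaS R) : nat := if x is Some y then (rank y).+1 else 0.

(** Ranks run from 0 to twice the number of pivots, and slot 0 is added for Sigma. *)
Definition slot_count : nat := (size pivots).*2.+2.

Lemma slot_lt x : (slot x < slot_count)%N.
Proof.
case: x => //= x; rewrite /slot_count !ltnS /rank.
elim: pivots => [|p s IH]; first by rewrite big_nil.
rewrite big_cons /= doubleS; case: (le p x); case: (le x p) => //=; lia.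
Qed.

Lemma slot_le x y : extend_le le x y -> (slot x <= slot y)%N.
Proof. by case: x => [x|//]; case: y => [y|//] /= /rank_le. Qed.

Lemma slot_gt x y : (slot x < slot y)%N -> extend_le le x y.
Proof. by case: x => [x|//]; case: y => [y|//] /=; rewrite ltnS => /rank_lt. Qed.

(** A slot without a letter of index below [m] counts as a piece of [0,1], possibly empty. A letter
    of larger index may fall into it, but its points belong to another block and are ignored by
    [cell_weight]. *)
Definition slot_block (s : nat) : option block :=
  if s is s'.+1 then
    Some (head Breal [seq b <- letter_blocks | rank (letter b) == s'])
  else None.

(** Pieces of [0,1] are strict: a chain of cells takes at most one point from each. This only
    shortens chains, and nothing is lost in the limit since coordinates are almost surely
    distinct. *)
Definition slot_weak (s : nat) : bool :=
  match slot_block s with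
  | None | Some (Bint' _) => true
  | _ => false
  end.

Lemma letter_blocksP b : b \in letter_blocks ->
  block_of (Some (letter b)) = Some b /\ letter b \in pivots.
Proof.
move=> bl; split; last by rewrite mem_cat map_f.
by move: bl; rewrite mem_cat => /orP[] /mapP[i _ ->].
Qed.

Lemma slot_block_letter s b : slot_block s = Some b -> b != Breal ->
  b \in letter_blocks /\ s = slot (Some (letter b)).
Proof.
case: s => //= s [] hb nb.
case E : [seq b <- letter_blocks | rank (letter b) == s] hb => [|c l] /= hb.
  by rewrite -hb eqxx in nb.
have : c \in [seq b <- letter_blocks | rank (letter b) == s] by rewrite E mem_head.
by rewrite hb mem_filter => /andP[/eqP <- ->].
Qed.

Lemma slot_letter x b : slot_block (slot x) = Some b -> b != Breal ->
  x = Some (letter b).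
Proof.
move=> hb nb; have [bl] := slot_block_letter hb nb.
case: x hb => //= x _ [] e; congr Some; apply: rank_pivot => //.
by have [] := letter_blocksP bl.
Qed.

Lemma slot_none x : slot_block (slot x) = None -> x = None.
Proof. by case: x. Qed.

Lemma slot_block_real (u : unit01 R) : slot_block (slot (Some (Oreal u))) = Some Breal.
Proof.
case E : (slot_block _) => [b|//]; congr Some; apply/eqP; apply: contraT => nb.
have [bl _] := slot_block_letter E nb.
have := slot_letter E nb; move: bl; rewrite mem_cat.
by case/orP => /mapP[i _ ->].
Qed.

Lemma slot_block_of b : b \in letter_blocks -> slot_block (slot (Some (letter b))) = Some b.
Proof.
move=> bl; have [bb bp] := letter_blocksP bl.
rewrite /=; congr Some.
set l := seq.filter _ _.
have bs : b \in l by rewrite mem_filter eqxx bl.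
have : head Breal l \in l by move: bs; case: (l) => //= c r _; rewrite mem_head.
rewrite mem_filter => /andP[/eqP e hl].
have := rank_pivot bp e.
have [hb _] := letter_blocksP hl.
by move=> E; move: hb; rewrite E bb => -[].
Qed.

Definition real_slot (s : nat) : set R :=
  [set x | exists u : unit01 R, val u = x /\ slot (Some (Oreal u)) = s].

(** By monotonicity of [slot], this set is an interval. *)
Lemma measurable_real_slot s : measurable (real_slot s).
Proof.
apply: is_interval_measurable => x y [u [ux us]] [v [vy vs]] z /andP[xz zy].
have z01 : 0 <= z <= 1.
  have /andP[u0 _] := valP u; have /andP[_ v1] := valP v.
  by rewrite (le_trans _ xz) ?ux// -?ux// (le_trans zy)// -vy.
exists (exist _ z z01); split=> //.
apply/eqP; rewrite eqn_leq; apply/andP; split; [rewrite -vs|rewrite -us].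
- by apply: slot_le; rewrite /= le_real /= vy.
- by apply: slot_le; rewrite /= le_real /= ux.
Qed.

Lemma uniform_real_slot_le s : (0 < m)%N ->
  (uniform_prob (@ltr01 R) (real_slot s) <= (2 / m%:R)%:E)%E.
Proof.
move=> m0.
have [[x [u [ux us]]]|] := pselect (exists x, real_slot s x); last first.
  move=> /forallNP e; rewrite (_ : real_slot s = set0) ?measure0 ?lee_fin ?divr_ge0//.
  by apply/seteqP; split => // y /e.
have sub : real_slot s `<=` `[x - m%:R^-1, x + m%:R^-1].
  move=> y [v [vy vs]]; rewrite /= in_itv /=.
  have e : rank (Oreal u) = rank (Oreal v) by move: us; rewrite -vs => -[].
  have := rank_real_close m0 e; have := rank_real_close m0 (esym e).
  by rewrite ux vy; lra.
have mi : 0 < m%:R^-1 :> R by rewrite invr_gt0 ltr0n.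
apply: (@le_trans _ _ (\int[lebesgue_measure]_(x in real_slot s) 1)%E).
  apply: ge0_le_integral => //.
  - exact: measurable_real_slot.
  - by move=> z _; rewrite lee_fin uniform_pdf_ge0// ltr01.
  - apply/measurable_EFinP; apply: measurable_funS (@measurable_uniform_pdf R 0 1) => //.
  - by move=> z _; rewrite lee_fin /uniform_pdf; case: ifPn => // _; rewrite subr0 invr1.
rewrite integral_cst ?mul1e; last exact: measurable_real_slot.
apply: (@le_trans _ _ (lebesgue_measure `[x - m%:R^-1, x + m%:R^-1]%classic)).
  apply: le_measure => //; rewrite inE; first exact: measurable_real_slot.
  exact: measurable_itv.
rewrite lebesgue_measure_itv /= lte_fin ifT; last by lra.
by rewrite -EFinB lee_fin; lra.
Qed.

End slots.

(** * The law of the discretized multiset *)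

Section cell_weights.
Context (R : realType) (d : measure_display) (T : measurableType d)
  (P : probability T R) (pp pm : param R) (ap am : R)
  (S : sampling P pp pm ap am) (lep lem : rel (Omega R)).
Hypotheses (lepP : alphabet_order lep) (lemP : alphabet_order lem).
Variable m : nat.
Local Open Scope ereal_scope.

Local Notation slotx := (slot lep m).
Local Notation sloty := (slot lem m).
Local Notation blockx := (slot_block lep m).
Local Notation blocky := (slot_block lem m).

Definition pt_cell (a b : option block) (k : nat) (w : T) : nat * nat :=
  (slotx (sample_pt S a b k w).1, sloty (sample_pt S a b k w).2).

Definition cell_blocks (z : nat * nat) : option block * option block :=
  (blockx z.1, blocky z.2).

Definition both_weak (z : nat * nat) : bool :=
  slot_weak lep m z.1 && slot_weak lem m z.2.

Definition empty_cells (a b : option block) (A : seq (nat * nat)) : set T :=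
  [set w | forall k, (k < cnt S a b w)%N -> pt_cell a b k w \notin A].

(** A doubly weak cell is a whole block product, so its weight is the full count; in any other cell
    only one point can serve, and the weight records occupation. *)
Definition cell_weight (z : nat * nat) (w : T) : nat :=
  let a := blockx z.1 in let b := blocky z.2 in
  if both_weak z then cnt S a b w
  else has (fun k => pt_cell a b k w == z) (iota 0 (cnt S a b w)).

Definition slot_len (le : rel (Omega R)) (s : nat) : R :=
  if slot_block le m s == Some Breal
  then fine (uniform_prob (@ltr01 R) (real_slot le m s)) else 1%R.

Definition cell_len (z : nat * nat) : R := (slot_len lep z.1 * slot_len lem z.2)%R.

Let src := source_events (fun a b => cnt S a b) (fstu S) (sndu S).

Let src_indep : mutually_independent P src.
Proof. exact: (@sampling_indep _ _ _ _ _ _ _ _ S). Qed.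

Let src_measurable s A : src s A -> measurable A.
Proof.
case: s => [a b|b k|a k] /= [B mB <-]; rewrite setTI.
- by rewrite -[X in measurable X]setTI; apply: (measurable_funP (cnt S a b)).
- by rewrite -[X in measurable X]setTI; apply: (fstu_law S b k).1.
- by rewrite -[X in measurable X]setTI; apply: (sndu_law S a k).1.
Qed.

(** The block product that a choice belongs to and the number of the point it determines, [None]
    marking the count. *)
Definition source_point (s : source) : option block * option block * option nat :=
  match s with
  | Count a b => (a, b, None)
  | Fst b k => (Some Breal, b, Some k)
  | Snd a k => (a, Some Breal, Some k)
  end.

Let pts := group_system source_point src.

Let pts_indep : mutually_independent P pts.
Proof. by apply: indep_group; exact: src_indep. Qed.

Let pts_measurable i A : pts i A -> measurable A.
Proof.
move=> [s [B [us sB ->]]]; apply: measurable_bigcap_seq => k /sB[_].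
exact: src_measurable.
Qed.

Lemma uniform_fine (A : set R) : measurable A ->
  uniform_prob (@ltr01 R) A = (fine (uniform_prob (@ltr01 R) A))%:E.
Proof. by move=> mA; rewrite fineK// fin_num_measure. Qed.

Lemma slot_block_elt (le : rel (Omega R)) (leP : alphabet_order le) s u a :
  slot_block le m s = a -> a != Some Breal -> slot le m (block_elt a u) = s.
Proof.
case: a => [b|] e nb; last by case: s e.
have nb' : b != Breal by apply: contra nb => /eqP ->.
have [_ ->] := slot_block_letter e nb'.
by case: b nb' {e nb} => // h; rewrite eqxx in h.
Qed.

(** Only a coordinate in [0,1] is random, and the two coordinates of a point are independent; hence
    the product of lengths, a letter having length 1. *)
Lemma hit_event a b k z : cell_blocks z = (a, b) ->
  pts (a, b, Some k) [set w | pt_cell a b k w = z] /\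
  P [set w | pt_cell a b k w = z] = (cell_len z)%:E.
Proof.
move=> [za zb].
pose s1 := if a == Some Breal then [:: Fst b k] else [::].
pose s2 := if b == Some Breal then [:: Snd a k] else [::].
pose B s := match s with
  | Count _ _ => setT
  | Fst b' k' => [set w | real_slot lep m z.1 (val (fstu S b' k' w))]
  | Snd a' k' => [set w | real_slot lem m z.2 (val (sndu S a' k' w))]
  end.
have us : uniq (s1 ++ s2).
  rewrite /s1 /s2; case: eqP => _; case: eqP => _ //=.
  by rewrite andbT inE; apply/eqP.
have sB s : s \in s1 ++ s2 -> source_point s = (a, b, Some k) /\ src s (B s).
  rewrite mem_cat /s1 /s2 => /orP[].
    case: eqP => [->|//]; rewrite inE => /eqP ->; split=> //=.
    exists (real_slot lep m z.1); first exact: measurable_real_slot.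
    by rewrite setTI.
  case: eqP => [->|//]; rewrite inE => /eqP ->; split=> //=.
  exists (real_slot lem m z.2); first exact: measurable_real_slot.
  by rewrite setTI.
have real_val (le : rel (Omega R)) s (u : unit01 R) :
    real_slot le m s (val u) <-> slot le m (Some (Oreal u)) = s.
  split; last by move=> h; exists u.
  by move=> [v [/val_inj -> ]].
have E : [set w | pt_cell a b k w = z] = \bigcap_(s in [set` s1 ++ s2]) B s.
  apply/seteqP; split => w.
    move=> h s /=; rewrite mem_cat /s1 /s2 => /orP[].
      case: eqP => [a1|//]; rewrite inE => /eqP -> /=; apply/real_val.
      by rewrite -h /pt_cell /sample_pt /= a1.
    case: eqP => [a1|//]; rewrite inE => /eqP -> /=; apply/real_val.
    by rewrite -h /pt_cell /sample_pt /= a1.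
  move=> h; rewrite /= /pt_cell [RHS]surjective_pairing; congr pair.
    have [a1|a1] := eqVneq a (Some Breal); last exact: slot_block_elt.
    have := h (Fst b k); rewrite /= mem_cat /s1 a1 eqxx mem_head => /(_ isT).
    by move/real_val.
  have [b1|b1] := eqVneq b (Some Breal); last exact: slot_block_elt.
  have := h (Snd a k); rewrite /= mem_cat /s2 b1 eqxx mem_head orbT => /(_ isT).
  by move/real_val.
split; first by exists (s1 ++ s2), B.
rewrite E src_indep//; last by move=> s /sB[].
rewrite big_cat /cell_len EFinM /slot_len /= za zb; congr (_ * _).
  rewrite /s1; case: eqP => _; last by rewrite big_nil.
  rewrite big_seq1 -uniform_fine; last exact: measurable_real_slot.
  by rewrite -(fstu_law S b k).2//; exact: measurable_real_slot.
rewrite /s2; case: eqP => _; last by rewrite big_nil.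
rewrite big_seq1 -uniform_fine; last exact: measurable_real_slot.
by rewrite -(sndu_law S a k).2//; exact: measurable_real_slot.
Qed.

Let dpts i := <<d pts i >>.

Let dpts_indep : mutually_independent P dpts.
Proof. exact: indep_dynkin pts_measurable pts_indep. Qed.

Let dpts_measurable i A : dpts i A -> measurable A.
Proof. by apply: dynkin_measurable; exact: pts_measurable. Qed.

Lemma dynkinU2 (G : set_system T) (A B : set T) : dynkin G -> G A -> G B ->
  A `&` B = set0 -> G (A `|` B).
Proof.
move=> [GT GC GU] GA GB AB0; rewrite -bigcup2E; apply: GU.
  by apply/trivIsetP => -[|[|i]] [|[|j]] //= _ _ _; rewrite ?set0I ?setI0// setIC.
by move=> [|[|i]] //=; rewrite -setCT; exact: GC.
Qed.

Lemma miss_event a b k A : uniq A -> (forall z, z \in A -> cell_blocks z = (a, b)) ->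
  dpts (a, b, Some k) [set w | pt_cell a b k w \notin A] /\
  P [set w | pt_cell a b k w \notin A] = (1 - \sum_(z <- A) cell_len z)%:E.
Proof.
move=> uA hA.
have dd : dynkin (dpts (a, b, Some k)) by exact: g_dynkin_dynkin.
suff [h1 h2] : dpts (a, b, Some k) [set w | pt_cell a b k w \in A] /\
    P [set w | pt_cell a b k w \in A] = (\sum_(z <- A) cell_len z)%:E.
  have -> : [set w | pt_cell a b k w \notin A] = ~` [set w | pt_cell a b k w \in A].
    by apply/seteqP; split => w /negP.
  split; first by case: dd => _ + _; apply.
  rewrite probability_setC; last exact: dpts_measurable h1.
  by rewrite h2 -EFinB.
elim: A uA hA => [|z A IH] /=.
  have -> : [set w | pt_cell a b k w \in [::]] = set0 by apply/seteqP; split.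
  rewrite measure0 big_nil => _ _; split=> //; rewrite -setCT.
  by case: dd => dT dC _; exact: dC.
move=> /andP[zA uA] hA.
have [||h1 h2] := IH; [by []|by move=> y yA; apply: hA; rewrite inE yA orbT|].
have [h3 h4] := hit_event k (hA z (mem_head _ _)).
have E : [set w | pt_cell a b k w \in z :: A] =
    [set w | pt_cell a b k w = z] `|` [set w | pt_cell a b k w \in A].
  apply/seteqP; split => w /=; first by rewrite inE => /predU1P.
  by rewrite inE => h; apply/predU1P.
have disj : [set w | pt_cell a b k w = z] `&` [set w | pt_cell a b k w \in A] = set0.
  by apply/seteqP; split => // w [/= ->]; rewrite (negbTE zA).
have h3' : dpts (a, b, Some k) [set w | pt_cell a b k w = z] by exact: sub_gen_smallest.
rewrite E; split; first exact: dynkinU2.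
rewrite measureU ?big_cons//; last 2 first.
- exact: dpts_measurable h3'.
- exact: dpts_measurable h1.
by rewrite [X in X + _]h4 [X in _ + X]h2 -EFinD.
Qed.

Let blk := group_system (fun i : option block * option block * option nat => i.1) dpts.

Let blk_indep : mutually_independent P blk.
Proof. by apply: indep_group; exact: dpts_indep. Qed.

Let blk_measurable i A : blk i A -> measurable A.
Proof.
move=> [s [B [us sB ->]]]; apply: measurable_bigcap_seq => k /sB[_].
exact: dpts_measurable.
Qed.

Lemma count_event a b n : dpts (a, b, None) (cnt S a b @^-1` [set n]).
Proof.
apply: sub_gen_smallest; exists [:: Count a b], (fun=> cnt S a b @^-1` [set n]).
split=> //; last by rewrite bigcap_set_cons bigcap_set_nil setIT.
by move=> i; rewrite inE => /eqP ->; split => //=; exists [set n]; rewrite ?setTI.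
Qed.

Lemma blk_count_event a b n : blk (a, b) (cnt S a b @^-1` [set n]).
Proof.
exists [:: (a, b, None)], (fun=> cnt S a b @^-1` [set n]).
split=> //; last by rewrite bigcap_set_cons bigcap_set_nil setIT.
by move=> i; rewrite inE => /eqP ->; split => //; exact: count_event.
Qed.

Let no_hit a b (A : seq (nat * nat)) n := cnt S a b @^-1` [set n] `&`
  [set w | forall k, (k < n)%N -> pt_cell a b k w \notin A].

Lemma no_hit_event a b A n : uniq A -> (forall z, z \in A -> cell_blocks z = (a, b)) ->
  blk (a, b) (no_hit a b A n) /\
  P (no_hit a b A n) =
    (count_mass pp pm ap am a b n * (1 - \sum_(z <- A) cell_len z) ^+ n)%:E.
Proof.
move=> uA hA.
pose s := (a, b, None) :: [seq (a, b, Some k) | k <- iota 0 n].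
pose B (i : option block * option block * option nat) := if i.2 is Some k
  then [set w | pt_cell a b k w \notin A] else cnt S a b @^-1` [set n].
have us : uniq s.
  rewrite /s /= map_inj_uniq ?iota_uniq ?andbT; last by move=> i j [].
  by apply/negP => /mapP[].
have sB i : i \in s -> i.1 = (a, b) /\ dpts i (B i).
  rewrite inE => /predU1P[->|/mapP[k _ ->]]; split=> //; first exact: count_event.
  by case: (miss_event k uA hA).
have E : no_hit a b A n = \bigcap_(i in [set` s]) B i.
  rewrite bigcap_set_cons; congr (_ `&` _); apply/seteqP; split=> w h.
    by move=> _ /mapP[k + ->] /=; rewrite mem_iota => /h.
  by move=> k kn; apply: (h (a, b, Some k)); rewrite /= map_f// mem_iota.
split; first by exists s, B.
rewrite E dpts_indep//; last by move=> i /sB[].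
rewrite /s big_cons /B /= cnt_law EFinM; congr (_ * _).
rewrite big_map; under eq_bigr => k _ do rewrite (miss_event k uA hA).2.
elim: n {s B us sB E} => [|n IH]; first by rewrite big_nil.
by rewrite -[n.+1]addn1 iotaD big_cat /= IH big_seq1 exprD expr1 EFinM.
Qed.

Let dblk i := <<d blk i >>.

(** Decompose by the number [n] of points; given [n], they miss the cells independently. *)
Lemma empty_cells_event a b A : uniq A -> (forall z, z \in A -> cell_blocks z = (a, b)) ->
  dblk (a, b) (empty_cells a b A) /\
  P (empty_cells a b A) = \sum_(n <oo)
    (count_mass pp pm ap am a b n * (1 - \sum_(z <- A) cell_len z) ^+ n)%:E.
Proof.
move=> uA hA.
have E : empty_cells a b A = \bigcup_n no_hit a b A n.
  apply/seteqP; split => w.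
    by move=> h; exists (cnt S a b w).
  by move=> [n _ [/= cn h]] k; rewrite cn; exact: h.
have tri : trivIset setT (no_hit a b A).
  by move=> i j _ _ [w [[/= ci _] [/= cj _]]]; rewrite -ci -cj.
have nh n := no_hit_event n uA hA.
split.
  rewrite E; have [_ _] : dynkin (dblk (a, b)) by exact: g_dynkin_dynkin.
  by apply => // n; apply: sub_gen_smallest; case: (nh n).
rewrite E measure_semi_bigcup//.
- by apply: eq_eseriesr => n _; rewrite -(nh n).2.
- by move=> n; exact: blk_measurable (nh n).1.
- by apply: bigcup_measurable => n _; exact: blk_measurable (nh n).1.
Qed.

(** The generating function that turns [empty_cells_event] into an exponential of the total
    length. *)
Lemma poisson_pgf (s c : R) : (0 <= s)%R -> (0 <= c)%R ->
  \sum_(n <oo) (poisson_mass s n * c ^+ n)%:E = (expR (- (s * (1 - c))))%:E.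
Proof.
move=> s0 c0; apply: nneseries_EFin.
have -> : (fun n => poisson_mass s n * c ^+ n)%R =
    (fun n => expR (- s) * exp_coeff (s * c) n)%R.
  by apply/funext => n; rewrite /poisson_mass /exp_coeff /= exprMn; ring.
have -> : expR (- (s * (1 - c))) = (expR (- s) * expR (s * c))%R.
  by rewrite -expRD; congr expR; ring.
rewrite (_ : series _ = (fun n => expR (- s) * series (exp_coeff (s * c)) n)%R).
  by apply: cvgM; [exact: cvg_cst|exact: is_cvg_series_exp_coeff].
by apply/funext => n; rewrite /series /= mulr_sumr.
Qed.

Definition block_param (p : param R) (z : R) (a : option block) : R :=
  match a with
  | None => z
  | Some Breal => pt p
  | Some (Bint i) => pq p i
  | Some (Bint' i) => pr p i
  end.

Definition block_weak (a : option block) : bool :=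
  match a with None | Some (Bint' _) => true | _ => false end.

Lemma count_mass_real a b : (a == Some Breal) || (b == Some Breal) ->
  count_mass pp pm ap am a b =
  poisson_mass (block_param pp ap a * block_param pm am b).
Proof.
case: a => [[|i|i]|]; case: b => [[|j|j]|] /orP[] /eqP //= _.
by rewrite mulrC.
Qed.

Hypotheses (ap0 : (0 <= ap)%R) (am0 : (0 <= am)%R).

Lemma block_param_ge0 (p : param R) (z : R) a : (0 <= z)%R -> (0 <= block_param p z a)%R.
Proof.
by move=> z0; case: a => [[|i|i]|] //=; [exact: pt_ge0|exact: pq_ge0|exact: pr_ge0].
Qed.

Lemma slot_len_ge0 (le : rel (Omega R)) s : (0 <= slot_len le s)%R.
Proof. by rewrite /slot_len; case: ifP => // _; apply: fine_ge0. Qed.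

Lemma empty_cells_real a b A : uniq A -> (forall z, z \in A -> cell_blocks z = (a, b)) ->
  (a == Some Breal) || (b == Some Breal) ->
  P (empty_cells a b A) =
  (expR (- (block_param pp ap a * block_param pm am b * \sum_(z <- A) cell_len z)))%:E.
Proof.
move=> uA hA hr; have [_ ->] := empty_cells_event uA hA.
have c0 : (0 <= 1 - \sum_(z <- A) cell_len z)%R.
  by have [_ h] := miss_event 0%N uA hA; rewrite -lee_fin -h.
rewrite count_mass_real// poisson_pgf//; last by rewrite mulr_ge0 ?block_param_ge0.
by congr (expR (- _))%:E; rewrite opprB addrC subrK.
Qed.

Definition cell_void (z : nat * nat) : R :=
  let a := blockx z.1 in let b := blocky z.2 in
  if (a == Some Breal) || (b == Some Breal)
  then expR (- (block_param pp ap a * block_param pm am b * cell_len z))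
  else count_mass pp pm ap am a b 0.

Definition weight_law (z : nat * nat) : nat -> R :=
  if both_weak z then count_mass pp pm ap am (blockx z.1) (blocky z.2)
  else bern01 (1 - cell_void z)%R.

Let cell_events (z : nat * nat) : set_system T :=
  if both_weak z then
    [set A | exists k, A = cnt S (blockx z.1) (blocky z.2) @^-1` [set k]]
  else [set A | A = empty_cells (blockx z.1) (blocky z.2) [:: z]].

Lemma nonreal_cell z : cell_blocks z = (blockx z.1, blocky z.2) ->
  ~~ ((blockx z.1 == Some Breal) || (blocky z.2 == Some Breal)) ->
  forall k w, pt_cell (blockx z.1) (blocky z.2) k w = z.
Proof.
move=> _ /norP[a1 b1] k w; rewrite /pt_cell [RHS]surjective_pairing.
by congr pair; exact: slot_block_elt.
Qed.

Lemma empty_cells_nonreal z :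
  ~~ ((blockx z.1 == Some Breal) || (blocky z.2 == Some Breal)) ->
  empty_cells (blockx z.1) (blocky z.2) [:: z] =
  cnt S (blockx z.1) (blocky z.2) @^-1` [set 0%N].
Proof.
move=> nr; apply/seteqP; split => w /=.
  move=> h; apply/eqP; rewrite -leqn0 leqNgt; apply/negP => /h.
  by rewrite inE (nonreal_cell (erefl _) nr) eqxx.
by move=> c0 k; rewrite c0.
Qed.

Lemma nonreal_cell_eq z z' : cell_blocks z = cell_blocks z' ->
  ~~ ((blockx z.1 == Some Breal) || (blocky z.2 == Some Breal)) -> z = z'.
Proof.
case: z => s t; case: z' => s' t' [/= e1 e2] /norP[a1 b1].
rewrite -(slot_block_elt lepP (unit01_zero R) (erefl (blockx s)) a1).
rewrite -(slot_block_elt lemP (unit01_zero R) (erefl (blocky t)) b1).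
by congr pair; apply: slot_block_elt.
Qed.

Lemma both_weak_nonreal z : both_weak z ->
  ~~ ((blockx z.1 == Some Breal) || (blocky z.2 == Some Breal)).
Proof.
rewrite /both_weak /slot_weak => /andP[].
case: (blockx _) => [[|i|i]|] //; case: (blocky _) => [[|j|j]|] // _ _;
  by apply/norP; split; apply/eqP.
Qed.

(** Distinct block products are independent. In a product with a real factor, the void probability
    of several cells is the exponential of a sum of lengths and so factorizes; a product without
    real factor forms a single cell. *)
Lemma cell_events_indep : mutually_independent P cell_events.
Proof.
move=> J A uJ hA.
have dblk_indep : mutually_independent P dblk.
  by apply: indep_dynkin; [exact: blk_measurable|exact: blk_indep].
apply: (indep_ungroup (h := cell_blocks) (G := dblk)) => // -[a b] s us hs.
have [hr|hr] := boolP ((a == Some Breal) || (b == Some Breal)).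
  have sv z : z \in s -> cell_blocks z = (a, b) /\ A z = empty_cells a b [:: z].
    move=> zs; have [zJ e] := hs z zs; split=> //.
    have := hA z zJ; case: e => ea eb.
    rewrite /cell_events ea eb; case: ifP => // /both_weak_nonreal.
    by rewrite ea eb hr.
  have E : \bigcap_(i in [set` s]) A i = empty_cells a b s.
    apply/seteqP; split => w h.
      move=> k kc; apply/negP => ks.
      have := h _ ks; rewrite (sv _ ks).2 => /(_ k kc).
      by rewrite inE eqxx.
    move=> z /= zs; rewrite (sv z zs).2 => k kc; rewrite inE.
    by apply: contra (h k kc) => /eqP ->.
  have sb z : z \in s -> cell_blocks z = (a, b) by move=> /sv[].
  rewrite E; split; first by case: (empty_cells_event us sb).
  rewrite empty_cells_real// mulr_sumr -sumrN expR_sum -prodEFin.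
  apply: eq_big_seq => z zs; rewrite (sv z zs).2 empty_cells_real ?big_seq1//.
  by move=> y; rewrite inE => /eqP ->; exact: sb.
have [s0|[z sz]] : s = [::] \/ exists z, s = [:: z].
  case: s us hs => [|z [|y s]] us hs; [by left|by right; exists z|].
  move: us; rewrite /= inE negb_or -andbA => /and3P[/eqP[]].
  have [_ ez] := hs z (mem_head _ _).
  have [_ ey] := hs y (ltac:(by rewrite !inE eqxx orbT)).
  apply: nonreal_cell_eq; first by rewrite ez ey.
  by case: ez hr => -> ->.
- rewrite s0 bigcap_set_nil big_nil probability_setT; split=> //.
  by have [] : dynkin (dblk (a, b)) by exact: g_dynkin_dynkin.
have [zJ ez] := hs z (ltac:(by rewrite sz mem_head)).
rewrite sz bigcap_set_cons bigcap_set_nil setIT big_seq1; split=> //.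
have := hA z zJ; case: (ez) => ea eb; rewrite /cell_events ea eb; case: ifP => _.
  by move=> [k ->]; apply: sub_gen_smallest; exact: blk_count_event.
move=> ->; have [] // := @empty_cells_event a b [:: z].
by move=> y; rewrite inE => /eqP ->.
Qed.

Lemma cell_voidE z :
  P (empty_cells (blockx z.1) (blocky z.2) [:: z]) = (cell_void z)%:E.
Proof.
rewrite /cell_void; case: ifPn => hr.
  by rewrite empty_cells_real ?big_seq1// => y; rewrite inE => /eqP ->.
by rewrite empty_cells_nonreal// cnt_law.
Qed.

Lemma measurable_empty_cells z :
  measurable (empty_cells (blockx z.1) (blocky z.2) [:: z]).
Proof.
have [] // := @empty_cells_event (blockx z.1) (blocky z.2) [:: z].
  by move=> y; rewrite inE => /eqP ->.
by move=> + _; apply: dynkin_measurable; exact: blk_measurable.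
Qed.

Lemma cell_weight_event z c :
  <<d cell_events z >> [set w | cell_weight z w = c] /\
  P [set w | cell_weight z w = c] = (weight_law z c)%:E.
Proof.
rewrite /weight_law /cell_weight; have [zw|zw] := boolP (both_weak z).
  rewrite -(cnt_law S); split => //; apply: sub_gen_smallest.
  by rewrite /cell_events zw; exists c.
pose V := empty_cells (blockx z.1) (blocky z.2) [:: z].
have dV : <<d cell_events z >> V.
  by apply: sub_gen_smallest; rewrite /cell_events (negbTE zw).
have dd : dynkin <<d cell_events z >> by exact: g_dynkin_dynkin.
have hasV w : has (fun k => pt_cell (blockx z.1) (blocky z.2) k w == z)
    (iota 0 (cnt S (blockx z.1) (blocky z.2) w)) = (w \notin V).
  apply/hasP/idP => [[k + /eqP kz]|].
    rewrite mem_iota add0n => /= kn; rewrite notin_setE => /(_ k kn).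
    by rewrite inE kz eqxx.
  move=> /negP wV; apply: contrapT => h; apply: wV; rewrite inE => k kn.
  rewrite inE; apply/negP => kz; apply: h; exists k => //.
  by rewrite mem_iota add0n.
case: c => [|[|c]] /=.
- have -> : [set w | (has (fun k => pt_cell (blockx z.1) (blocky z.2) k w == z)
      (iota 0 (cnt S (blockx z.1) (blocky z.2) w)) : nat) = 0%N] = V.
    apply/seteqP; split => w /=; rewrite hasV.
      by case: (boolP (w \in V)) => //; rewrite inE.
    by move=> Vw; rewrite mem_set.
  by rewrite cell_voidE opprB addrC subrK.
- have -> : [set w | (has (fun k => pt_cell (blockx z.1) (blocky z.2) k w == z)
      (iota 0 (cnt S (blockx z.1) (blocky z.2) w)) : nat) = 1%N] = ~` V.
    apply/seteqP; split => w /=; rewrite hasV.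
      by case: (boolP (w \in V)) => //; rewrite notin_setE.
    by move=> Vw; rewrite (_ : w \notin V = true)//; apply/negP; rewrite inE.
  split; first by case: dd => _ + _; apply.
  by rewrite probability_setC ?cell_voidE -?EFinB//; exact: measurable_empty_cells.
- have -> : [set w | (has (fun k => pt_cell (blockx z.1) (blocky z.2) k w == z)
      (iota 0 (cnt S (blockx z.1) (blocky z.2) w)) : nat) = c.+2] = set0.
    by apply/seteqP; split => // w /=; case: has.
  rewrite measure0; split=> //; rewrite -setCT.
  by case: dd => dT dC _; exact: dC.
Qed.

Lemma measurable_cell_weight z c : measurable [set w | cell_weight z w = c].
Proof.
have [+ _] := cell_weight_event z c; apply: dynkin_measurable => A.
rewrite /cell_events; case: ifP => _ /=; last first.
  by move=> ->; exact: measurable_empty_cells.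
by move=> [k ->]; exact: blk_measurable (blk_count_event _ _ _).
Qed.

Lemma cell_weights_law (J : seq (nat * nat)) (c : nat * nat -> nat) : uniq J ->
  P (\bigcap_(z in [set` J]) [set w | cell_weight z w = c z]) =
  (\prod_(z <- J) weight_law z (c z))%:E.
Proof.
move=> uJ; rewrite (indep_dynkin _ cell_events_indep)//.
- by rewrite -prodEFin; apply: eq_bigr => z _; case: (cell_weight_event z (c z)).
- move=> z A; rewrite /cell_events; case: ifP => _ /=; last first.
    by move=> ->; exact: measurable_empty_cells.
  by move=> [k ->]; exact: blk_measurable (blk_count_event _ _ _).
- by move=> z _; case: (cell_weight_event z (c z)).
Qed.

End cell_weights.

(** * Expectations of finitely many weights as iterated sums *)

Section expectation_of_weights.
Context (R : realType) (d : measure_display) (T : measurableType d)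
  (P : probability T R).
Local Open Scope ereal_scope.
Variables (I : eqType) (X : I -> T -> nat) (mu : I -> nat -> R).
Hypothesis mX : forall i c, measurable [set w | X i w = c].

Lemma measurable_map_weights (J : seq I) (s : seq nat) :
  measurable [set w | [seq X i w | i <- J] = s].
Proof.
elim: J s => [|i J IH] s.
  have [->|s0] := eqVneq s [::].
    by rewrite (_ : mkset _ = setT)//; apply/seteqP; split.
  rewrite (_ : mkset _ = set0)//; apply/seteqP; split => // w /= h.
  by rewrite -h in s0.
case: s => [|c s]; first by rewrite (_ : mkset _ = set0)//; apply/seteqP; split.
rewrite (_ : mkset _ = [set w | X i w = c] `&` [set w | [seq X i w | i <- J] = s]).
  exact: measurableI.
by apply/seteqP; split => w /= [<- <-].
Qed.

Lemma measurable_fun_weights (J : seq I) (f : seq nat -> \bar R) (A : set T) :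
  measurable A -> measurable_fun A (fun w => f [seq X i w | i <- J]).
Proof.
move=> mA; apply: (@measurable_funS _ _ _ _ setT) => // _ Y mY; rewrite setTI.
have -> : (fun w => f [seq X i w | i <- J]) @^-1` Y =
    \bigcup_s ([set w | [seq X i w | i <- J] = s] `&` [set w | Y (f s)]).
  apply/seteqP; split=> w /=; first by move=> Yf; exists [seq X i w | i <- J].
  by move=> [s _ [/= -> ]].
apply: countable_bigcupT_measurable => // s; apply: measurableI.
  exact: measurable_map_weights.
have [Ys|Ys] := pselect (Y (f s)).
  by rewrite (_ : mkset _ = setT)//; apply/seteqP; split.
by rewrite (_ : mkset _ = set0)//; apply/seteqP; split.
Qed.

Hypothesis mu_mass : forall i, is_mass (mu i).

(** In the induction [A], of probability [p], is the event that the weights already treated have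
    prescribed values; it is split by the value of the next weight. *)
Lemma integral_weights_on (J : seq I) (A : set T) (p : R) (f : seq nat -> \bar R) :
  measurable A -> (0 <= p)%R -> uniq J ->
  (forall c : I -> nat, P (A `&` \bigcap_(i in [set` J]) [set w | X i w = c i]) =
     (p * \prod_(i <- J) mu i (c i))%:E) ->
  (forall s, 0 <= f s) ->
  \int[P]_(w in A) f [seq X i w | i <- J] = p%:E * EX [seq mu i | i <- J] f.
Proof.
elim: J A p f => [|i J IH] A p f mA p0 uJ hA f0.
  rewrite /= (integral_cst P mA (f [::])) muleC; congr (_ * _).
  by have := hA (fun=> 0%N); rewrite bigcap_set_nil setIT big_nil mulr1.
have /andP[iJ uJ'] := uJ.
pose F k := A `&` [set w | X i w = k].
have AF : A = \bigcup_k F k.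
  apply/seteqP; split=> w; first by move=> Aw; exists (X i w).
  by move=> [k _ []].
have mF k : measurable (F k) by exact: measurableI.
rewrite {1}AF ge0_integral_bigcup//; last 2 first.
- by rewrite -AF; exact: (measurable_fun_weights (i :: J)).
- by move=> k l _ _ [w [[_ /= <-] [_ /= <-]]].
have emu : is_masses [seq mu i | i <- J].
  by move=> nu /List.in_map_iff[j [<- _]].
rewrite /= /Ex -nneseriesZl; last first.
  by move=> k _; rewrite mule_ge0 ?lee_fin ?(mu_mass i).1// EX_ge0.
apply: eq_eseriesr => k _.
rewrite muleA -EFinM -(IH (F k) _ (fun s => f (k :: s)))//.
- by apply: eq_integral => w; rewrite inE => -[_ /= ->].
- by rewrite mulr_ge0// (mu_mass i).1.
move=> c; have := hA (fun j => if j == i then k else c j).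
have neq j : j \in J -> (j == i) = false.
  by move=> jJ; apply/eqP => ji; rewrite -ji jJ in iJ.
rewrite bigcap_set_cons eqxx big_cons eqxx setIA mulrA.
rewrite [X in (_ * X)%:E](eq_big_seq (fun j => mu j (c j))) => [<-|j /neq ->//].
by congr (P (_ `&` _)); apply: eq_bigcapr => j /= /neq ->.
Qed.

Lemma integral_weights (J : seq I) (f : seq nat -> \bar R) : uniq J ->
  (forall c : I -> nat, P (\bigcap_(i in [set` J]) [set w | X i w = c i]) =
     (\prod_(i <- J) mu i (c i))%:E) ->
  (forall s, 0 <= f s) ->
  \int[P]_w f [seq X i w | i <- J] = EX [seq mu i | i <- J] f.
Proof.
move=> uJ hJ f0; rewrite (@integral_weights_on J setT 1)// ?mul1e//.
by move=> c; rewrite setTI mul1r.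
Qed.

End expectation_of_weights.

Lemma integral_grid (R : realType) (d : measure_display) (T : measurableType d)
    (P : probability T R) (X : nat * nat -> T -> nat) (mu : nat * nat -> nat -> R)
    (n m : nat) (f : seq (seq nat) -> \bar R) :
  (forall z c, measurable [set w | X z w = c]) -> (forall z, is_mass (mu z)) ->
  (forall (J : seq (nat * nat)) (c : nat * nat -> nat), uniq J ->
    P (\bigcap_(z in [set` J]) [set w | X z w = c z]) =
     (\prod_(z <- J) mu z (c z))%:E) ->
  (forall s, 0 <= f s)%E ->
  (\int[P]_w f [seq [seq X (i, j) w | i <- iota 0 n] | j <- iota 0 m] =
   ER (grid_laws (fun i j => mu (i, j)) n m) f)%E.
Proof.
move=> mX hmu hP f0; rewrite ER_flatten.
pose J := flatten [seq [seq (i, j) | i <- iota 0 n] | j <- iota 0 m].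
have shE V (g : nat * nat -> V) : shape [seq [seq g (i, j) | i <- iota 0 n] | j <- iota 0 m]
    = shape (grid_laws (fun i j => mu (i, j)) n m).
  by rewrite /shape /grid_laws -!map_comp; apply: eq_map => j /=; rewrite !size_map.
have flE V (g : nat * nat -> V) :
    flatten [seq [seq g (i, j) | i <- iota 0 n] | j <- iota 0 m] = [seq g z | z <- J].
  by rewrite /J map_flatten -map_comp; congr flatten; apply: eq_map => j /=; rewrite -map_comp.
have uJ : uniq J.
  have -> : J = [seq (p.2, p.1) | p <- [seq (j, i) | j <- iota 0 m, i <- iota 0 n]].
    by rewrite map_allpairs.
  rewrite map_inj_uniq; last by move=> [a b] [c e] [-> ->].
  by apply: allpairs_uniq; rewrite ?iota_uniq// => -[a b] [c e] _ _ [-> ->].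
pose sh := shape (grid_laws (fun i j => mu (i, j)) n m).
have IW := @integral_weights _ _ _ P _ X mu mX hmu J (fun s => f (reshape sh s))
  uJ (fun c => hP J c uJ) (fun s => f0 _).
rewrite -/sh /grid_laws (flE _ mu) -IW.
apply: eq_integral => w _; rewrite -(flE _ (X ^~ w)); congr f.
by rewrite /sh -(shE _ (X ^~ w)) flattenK.
Qed.

(** * Increasing subsequences and last passage times *)

Section slot_steps.
Variables (R : realType) (le : rel (Omega R)).
Hypothesis leP : alphabet_order le.

Lemma extend_le_refl x : extend_le le x x.
Proof. by case: x => //= x; case: leP. Qed.

(** Two elements of the same weak slot are the same letter, in (Z^+)' or Sigma, where repetition is
    allowed. *)
Lemma incr_step_slot m x y :
  slot_step (slot_weak le m) (slot le m x) (slot le m y) -> incr_step le x y.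
Proof.
move=> /andP[]; rewrite leq_eqVlt => /orP[/eqP xy|xy _]; last first.
  rewrite /incr_step (slot_gt leP xy) /=.
  by apply/implyP => /eqP e; rewrite e ltnn in xy.
rewrite xy eqxx /= => yw.
have [-> yZ] : x = y /\ ~~ in_Zplus y.
  move: yw; rewrite /slot_weak; case E : (slot_block le m (slot le m y)) => [[|i|i]|] // _.
    have Ex : slot_block le m (slot le m x) = Some (Bint' i) by rewrite xy.
    have nb : Bint' i != Breal by apply/eqP.
    by rewrite (slot_letter leP Ex nb) (slot_letter leP E nb).
  have Ex : slot_block le m (slot le m x) = None by rewrite xy.
  by rewrite (slot_none Ex) (slot_none E).
by rewrite /incr_step extend_le_refl yZ implybT.
Qed.

Lemma eventually_all (I : eqType) (Q : nat -> I -> Prop) (l : seq I) :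
  (forall x, x \in l -> exists m0, forall m, (m0 <= m)%N -> Q m x) ->
  exists m0, forall m, (m0 <= m)%N -> forall x, x \in l -> Q m x.
Proof.
elim: l => [|x l IH] h; first by exists 0%N.
have [m1 h1] := h x (mem_head _ _).
have [|m2 h2] := IH; first by move=> y yl; apply: h; rewrite inE yl orbT.
exists (maxn m1 m2) => m; rewrite geq_max => /andP[l1 l2] y.
by rewrite inE => /predU1P[->|]; [exact: h1|exact: h2].
Qed.

Lemma slot_block_eventually (x : OmegaS R) :
  exists m0, forall m, (m0 <= m)%N -> slot_block le m (slot le m x) = block_of x.
Proof.
case: x => [[u|i|i]|].
- by exists 0%N => m _; rewrite slot_block_real.
- exists i.+1 => m im; apply: (slot_block_of leP (b := Bint i)).
  by rewrite mem_cat map_f// mem_iota.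
- exists i.+1 => m im; apply: (slot_block_of leP (b := Bint' i)).
  by rewrite mem_cat map_f ?orbT// mem_iota.
- by exists 0%N.
Qed.

Lemma slot_inj_eventually (x y : OmegaS R) :
  exists m0, forall m, (m0 <= m)%N -> slot le m x = slot le m y -> x = y.
Proof.
have [m1 h1] := slot_block_eventually x.
have [nx|] := pselect (block_of x <> Some Breal).
  exists m1 => m /h1 e1 e; case E : (block_of x) nx => [b|] nx.
    have nb : b != Breal by apply/eqP => bE; apply: nx; rewrite bE.
    have Ex : slot_block le m (slot le m x) = Some b by rewrite e1.
    rewrite (slot_letter leP Ex nb); rewrite e in Ex.
    by rewrite (slot_letter leP Ex nb).
  have Ex : slot_block le m (slot le m x) = None by rewrite e1.
  by rewrite (slot_none Ex); rewrite e in Ex; rewrite (slot_none Ex).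
move=> /contrapT xr; have [m2 h2] := slot_block_eventually y.
have [u xu] : exists u, x = Some (Oreal u) by case: x xr {h1} => [[u| |]|]//; exists u.
have [ny|] := pselect (block_of y <> Some Breal).
  exists (maxn m1 m2) => m; rewrite geq_max => /andP[/h1 e1 /h2 e2] e.
  by case: ny; rewrite -e2 -e e1.
move=> /contrapT yr.
have [v yv] : exists v, y = Some (Oreal v) by case: y yr {h2} => [[v| |]|]//; exists v.
have [uv|uv] := eqVneq (val u) (val v); first by exists 0%N => m _ _; rewrite xu yv (val_inj uv).
have duv : 0 < `|val u - val v| by rewrite normr_gt0 subr_eq0.
exists (Num.truncn (`|val u - val v|^-1)).+1 => m lm; rewrite xu yv => -[e].
have m0 : (0 < m)%N by exact: leq_ltn_trans lm.
have h : `|val u - val v| <= m%:R^-1.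
  have := rank_real_close leP m0 e; have := rank_real_close leP m0 (esym e).
  by rewrite ler_norml; lra.
have : `|val u - val v|^-1 < m%:R.
  by apply: lt_le_trans (Num.Theory.truncnS_gt _) _; rewrite ler_nat.
rewrite invf_plt ?posrE ?ltr0n// => h'.
by have := lt_le_trans h' h; rewrite ltxx.
Qed.

Lemma slots_eventually (l : seq (OmegaS R)) :
  exists m0, forall m, (m0 <= m)%N ->
    (forall x, x \in l -> slot_block le m (slot le m x) = block_of x) /\
    {in l &, injective (slot le m)}.
Proof.
have [m1 h1] := eventually_all (l := l) (fun x _ => slot_block_eventually x).
have [m2 h2] := eventually_all (l := [seq (x, y) | x <- l, y <- l])
  (Q := fun m p => slot le m p.1 = slot le m p.2 -> p.1 = p.2)
  (fun p _ => slot_inj_eventually p.1 p.2).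
exists (maxn m1 m2) => m; rewrite geq_max => /andP[/h1 e1 /h2 e2]; split => // x y xl yl.
by apply: (e2 (x, y)); exact: allpairs_f.
Qed.

End slot_steps.

Section lambda1_lpp.
Context (R : realType) (d : measure_display) (T : measurableType d)
  (P : probability T R) (pp pm : param R) (ap am : R)
  (S : sampling P pp pm ap am) (lep lem : rel (Omega R)).
Hypotheses (lepP : alphabet_order lep) (lemP : alphabet_order lem).

Definition grid_lambda (m : nat) (w : T) : nat :=
  lpp (slot_weak lep m) (slot_weak lem m)
    (fun i j => cell_weight S lep lem m (i, j) w)
    (slot_count R m) (slot_count R m).

Lemma block_of_elt a (u : unit01 R) : block_of (block_elt a u) = a.
Proof. by case: a => [[]|]. Qed.

Lemma block_elt_nonreal a (u v : unit01 R) : a != Some Breal ->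
  block_elt a u = block_elt a v.
Proof. by case: a => [[|i|i]|]// /eqP. Qed.

Lemma cell_weight_le1 m z w : ~~ both_weak lep lem m z ->
  (cell_weight S lep lem m z w <= 1)%N.
Proof. by rewrite /cell_weight => /negbTE ->; exact: leq_b1. Qed.

Lemma cell_weight_pt m z w : (0 < cell_weight S lep lem m z w)%N ->
  exists k, (k < cnt S (slot_block lep m z.1) (slot_block lem m z.2) w)%N /\
    pt_cell S lep lem m (slot_block lep m z.1) (slot_block lem m z.2) k w = z.
Proof.
rewrite /cell_weight; case: ifP => zw.
  move=> c0; exists 0%N; split => //.
  by apply: nonreal_cell => //; exact: both_weak_nonreal zw.
case: hasP => // -[k]; rewrite mem_iota add0n => /= kn /eqP kz _.
by exists k.
Qed.

(** An optimal chain of cells lifts to points by choosing one in every occupied cell. A cell visited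
    several times is doubly weak, and all its points are copies of the same pair of letters. *)
Lemma grid_lambda_le m w : ((grid_lambda m w)%:R%:E <= lambda1 lep lem S w)%E.
Proof.
pose W i j := cell_weight S lep lem m (i, j) w.
have [|t [st bt ct zt]] := @lpp_attained (slot_weak lep m) (slot_weak lem m) W
  (slot_count R m) (slot_count R m).
  by move=> i j ij; exact: cell_weight_le1.
have /choice[k hk] : forall z, exists k, (0 < cell_weight S lep lem m z w)%N ->
  (k < cnt S (slot_block lep m z.1) (slot_block lem m z.2) w)%N /\
    pt_cell S lep lem m (slot_block lep m z.1) (slot_block lem m z.2) k w = z.
  move=> z; have [/cell_weight_pt[k h]|h] := boolP (0 < cell_weight S lep lem m z w)%N.
    by exists k.
  by exists 0%N.
pose pick z := sample_pt S (slot_block lep m z.1) (slot_block lem m z.2) (k z) w.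
have tW z : z \in t -> (0 < cell_weight S lep lem m z w)%N.
  move=> zt'; have : (0 < W z.1 z.2)%N.
    by apply: leq_trans (ct z); rewrite -has_count has_pred1.
  by rewrite /W -surjective_pairing.
have pickK z : z \in t -> (slot lep m (pick z).1, slot lem m (pick z).2) = z.
  by move=> /tW /hk[_ e]; exact: e.
apply: ereal_sup_ubound; exists [seq pick z | z <- t]; last by rewrite size_map zt.
split; last first.
  rewrite /is_increasing sorted_map.
  have tt : all (mem t) t by apply/allP.
  apply: (sub_in_sorted _ tt st) => z z' /pickK zK /pickK zK' /andP[s1 s2]; apply/andP; split.
    by apply: (incr_step_slot lepP (m := m)); move: s1; rewrite -{1}zK -{1}zK'.
  by apply: (incr_step_slot lemP (m := m)); move: s2; rewrite -{1}zK -{1}zK'.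
move=> x; rewrite count_map.
have [xt|xt] := boolP (has (fun z => pick z == x) t); last first.
  have -> : count (preim pick (pred1 x)) t = 0%N by apply/eqP; rewrite -leqn0 leqNgt -has_count.
  by [].
have [z0 z0t /eqP z0x] := hasP xt.
have -> : count (preim pick (pred1 x)) t = count_mem z0 t.
  apply: eq_in_count => z zt' /=; apply/eqP/eqP => [zx|->//].
  by rewrite -(pickK z zt') zx -z0x pickK.
apply: leq_trans (ct z0) _; rewrite /W -surjective_pairing.
rewrite /multiplicity -z0x /pick /sample_pt /= !block_of_elt.
set a := slot_block lep m z0.1; set b := slot_block lem m z0.2.
have [zw|zw] := boolP (both_weak lep lem m z0).
  have /norP[na nb] := both_weak_nonreal zw.
  rewrite /cell_weight zw -[leqLHS](size_iota 0) -count_predT.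
  apply: eq_leq; apply: eq_count => j /=; apply/esym/eqP; congr pair; exact: block_elt_nonreal.
apply: leq_trans (cell_weight_le1 _ zw) _; rewrite -has_count; apply/hasP.
exists (k z0); last by rewrite eqxx.
by rewrite mem_iota add0n; have [] := hk z0 (tW z0 z0t).
Qed.

(** This concerns all coordinates of the sampling, including those numbered beyond the counts. *)
Definition distinct_points (w : T) : Prop :=
  (forall i j : option block * nat, i <> j -> fstu S i.1 i.2 w <> fstu S j.1 j.2 w) /\
  (forall i j : option block * nat, i <> j -> sndu S i.1 i.2 w <> sndu S j.1 j.2 w).

Lemma count_gt1 (s : seq nat) (p : pred nat) : uniq s -> (1 < count p s)%N ->
  exists i j, [/\ i \in s, j \in s, i <> j, p i & p j].
Proof.
move=> us; rewrite -size_filter => h.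
have uf := filter_uniq p us.
case E : (seq.filter p s) h uf => [|i [|j l]] //= _.
rewrite inE negb_or -andbA => /and3P[/eqP ij _ _].
have : i \in seq.filter p s by rewrite E mem_head.
have : j \in seq.filter p s by rewrite E !inE eqxx orbT.
by rewrite !mem_filter => /andP[pj js] /andP[pi is_]; exists i, j.
Qed.

(** Equal neighbors show multiplicity at least 2, which is what excludes the repetition of a point
    with a real coordinate. *)
Lemma sorted_count (U : eqType) (r : rel U) (s : seq U) : sorted r s ->
  sorted (fun x y => r x y && ((x == y) ==> (1 < count_mem x s)%N)) s.
Proof.
case: s => // x0 s'; set s := x0 :: s'.
move=> /(sortedP x0) h; apply/(sortedP x0) => i si; rewrite h//=.
apply/implyP => /eqP e.
suff : (1 < count_mem (nth x0 s i) s)%N by [].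
have -> : count_mem (nth x0 s i) s =
    count_mem (nth x0 s i) (take i s ++ drop i s) by rewrite cat_take_drop.
rewrite count_cat (drop_nth x0 (ltnW si)) (drop_nth x0 si).
set c := nth x0 s i in e *; rewrite /= -e eqxx.
by apply: leq_trans (leq_addl _ _).
Qed.

Lemma multiplicity_pt w z : (0 < multiplicity S w z)%N ->
  exists k, (k < cnt S (block_of z.1) (block_of z.2) w)%N /\
    sample_pt S (block_of z.1) (block_of z.2) k w = z.
Proof.
rewrite -has_count => /hasP[k]; rewrite mem_iota add0n => /= kn /eqP kz.
by exists k.
Qed.

Lemma distinct_real_fst w z z' : distinct_points w ->
  (0 < multiplicity S w z)%N -> (0 < multiplicity S w z')%N ->
  (z = z' -> (1 < multiplicity S w z)%N) ->
  z.1 = z'.1 -> block_of z.1 <> Some Breal.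
Proof.
move=> [dw _] mz mz' mzz e zr.
have [k [kn kz]] := multiplicity_pt mz.
have [k' [kn' kz']] := multiplicity_pt mz'.
have zr' : block_of z'.1 = Some Breal by rewrite -e.
have fst_eq : fstu S (block_of z.2) k w = fstu S (block_of z'.2) k' w.
  move: (congr1 fst kz) (congr1 fst kz'); rewrite /sample_pt /= zr zr' -e /=.
  by move=> <- [].
have [kk|nkk] := pselect ((block_of z.2, k) = (block_of z'.2, k')); last first.
  exact: (dw (block_of z.2, k) (block_of z'.2, k')).
case: kk => bb kk; have zz : z = z' by rewrite -kz -kz' zr zr' bb kk.
have /count_gt1[|i [j [_ _ ij /eqP iz /eqP jz]]] := mzz zz; first exact: iota_uniq.
have nij : (block_of z.2, i) <> (block_of z.2, j) by move=> [].
apply: (dw _ _ nij) => /=.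
move: (congr1 fst iz) (congr1 fst jz); rewrite /sample_pt /= zr /=.
by move=> <- [].
Qed.

Lemma distinct_real_snd w z z' : distinct_points w ->
  (0 < multiplicity S w z)%N -> (0 < multiplicity S w z')%N ->
  (z = z' -> (1 < multiplicity S w z)%N) ->
  z.2 = z'.2 -> block_of z.2 <> Some Breal.
Proof.
move=> [_ dw] mz mz' mzz e zr.
have [k [kn kz]] := multiplicity_pt mz.
have [k' [kn' kz']] := multiplicity_pt mz'.
have zr' : block_of z'.2 = Some Breal by rewrite -e.
have snd_eq : sndu S (block_of z.1) k w = sndu S (block_of z'.1) k' w.
  move: (congr1 snd kz) (congr1 snd kz'); rewrite /sample_pt /= zr zr' -e /=.
  by move=> <- [].
have [kk|nkk] := pselect ((block_of z.1, k) = (block_of z'.1, k')); last first.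
  exact: (dw (block_of z.1, k) (block_of z'.1, k')).
case: kk => bb kk; have zz : z = z' by rewrite -kz -kz' zr zr' bb kk.
have /count_gt1[|i [j [_ _ ij /eqP iz /eqP jz]]] := mzz zz; first exact: iota_uniq.
have nij : (block_of z.1, i) <> (block_of z.1, j) by move=> [].
apply: (dw _ _ nij) => /=.
move: (congr1 snd iz) (congr1 snd jz); rewrite /sample_pt /= zr /=.
by move=> <- [].
Qed.

Lemma incr_slot_step (le : rel (Omega R)) m (leP : alphabet_order le) x y :
  incr_step le x y -> (slot le m x = slot le m y -> x = y) ->
  slot_block le m (slot le m y) = block_of y ->
  (x = y -> block_of y <> Some Breal) ->
  slot_step (slot_weak le m) (slot le m x) (slot le m y).
Proof.
move=> /andP[xy /implyP xZ] inj by_ nr; rewrite /slot_step (slot_le leP m xy) /=.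
apply/implyP => /eqP /inj exy; rewrite /slot_weak by_.
move: (nr exy) (xZ (introT eqP exy)); rewrite exy.
by case: (y) => [[u|i|i]|].
Qed.

(** For large [m] the finitely many letters of [s] lie in separate slots carrying their own blocks.
    Consecutive terms never share a real coordinate, so the strictness of real slots is harmless. *)
Lemma grid_lambda_ge w s : distinct_points w ->
  mset_subsequence (multiplicity S w) s -> is_increasing lep lem s ->
  exists m0, forall m, (m0 <= m)%N -> (size s <= grid_lambda m w)%N.
Proof.
move=> dw ms inc.
have [m1 h1] := slots_eventually lepP [seq z.1 | z <- s].
have [m2 h2] := slots_eventually lemP [seq z.2 | z <- s].
exists (maxn m1 m2) => m; rewrite geq_max => /andP[/h1[b1 i1] /h2[b2 i2]].
pose phi z := (slot lep m z.1, slot lem m z.2).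
have phi_inj : {in s &, injective phi}.
  move=> z z' zs zs' [e1 e2]; rewrite (surjective_pairing z) (surjective_pairing z').
  by congr pair; [apply: i1|apply: i2] => //; exact: map_f.
have mpos z : z \in s -> (0 < multiplicity S w z)%N.
  by rewrite -has_pred1 has_count => h; exact: leq_trans h (ms z).
rewrite -(size_map phi); apply: lpp_bound.
- have ss : all (mem s) s by apply/allP.
  rewrite sorted_map; apply: (sub_in_sorted _ ss (sorted_count inc)) =>
    z z' zs zs' /andP[/andP[s1 s2] /implyP zz].
  have mzz : z = z' -> (1 < multiplicity S w z)%N.
    by move=> /eqP/zz h; exact: leq_trans h (ms z).
  apply/andP; split; apply: incr_slot_step => //.
  + by move=> e; apply: i1 => //; exact: map_f.
  + by apply: b1; exact: map_f.
  + by move=> e; rewrite -e; apply: (distinct_real_fst dw (mpos _ zs) (mpos _ zs') mzz).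
  + by move=> e; apply: i2 => //; exact: map_f.
  + by apply: b2; exact: map_f.
  + by move=> e; rewrite -e; apply: (distinct_real_snd dw (mpos _ zs) (mpos _ zs') mzz).
- by apply/allP => _ /mapP[z _ ->]; rewrite /in_box /= !slot_lt.
- apply/allP => _ /mapP[z zs ->]; rewrite /= -/(phi z).
  have e1 : slot_block lep m (slot lep m z.1) = block_of z.1 by apply: b1; exact: map_f.
  have e2 : slot_block lem m (slot lem m z.2) = block_of z.2 by apply: b2; exact: map_f.
  rewrite /cell_weight /both_weak /= e1 e2.
  have [zw|zw] := boolP (slot_weak lep m (slot lep m z.1) && slot_weak lem m (slot lem m z.2)).
    rewrite count_map (eq_in_count (a2 := pred1 z)); last first.
      by move=> y ys /=; apply/eqP/eqP => [/phi_inj ->//|->].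
    apply: leq_trans (ms z) _; rewrite /multiplicity /=.
    by apply: leq_trans (count_size _ _) _; rewrite size_iota.
  rewrite lt0b; have [k [kn kz]] := multiplicity_pt (mpos z zs).
  apply/hasP; exists k; first by rewrite mem_iota add0n.
  by rewrite /pt_cell kz.
Qed.

End lambda1_lpp.

(** * Logarithmic derivatives of the generating functions *)

Section log_derivative.
Variable R : realType.

Lemma expR_le_inv (x : R) : x < 1 -> expR x <= (1 - x)^-1.
Proof.
move=> x1; rewrite -[leLHS]invrK -expRN lef_pV2 ?posrE ?expR_gt0 ?subr_gt0//.
exact: expR_ge1Dx.
Qed.

Lemma expR_le_quad (y : R) : y <= 2^-1 -> expR y <= 1 + y + 2 * y ^+ 2.
Proof.
move=> y1; have y10 : 0 < 1 - y by lra.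
apply: (le_trans (expR_le_inv _)); first by lra.
rewrite -[leLHS]mul1r ler_pdivrMr//.
have : 0 <= y ^+ 2 * (1 - 2 * y) by rewrite mulr_ge0 ?sqr_ge0//; lra.
by rewrite !expr2; nra.
Qed.

Lemma expR_lower (x : R) : `|x| <= 2^-1 -> expR (x - 2 * x ^+ 2) <= 1 + x.
Proof.
rewrite ler_norml => /andP[x1 x2]; have x0 : 0 < 1 + x by lra.
have h : expR (x / (1 + x)) <= 1 + x.
  apply: (le_trans (expR_le_inv _)).
    by rewrite ltr_pdivrMr//; lra.
  have -> : 1 - x / (1 + x) = (1 + x)^-1 by field; rewrite gt_eqF.
  by rewrite invrK.
apply: le_trans h; rewrite ler_expR ler_pdivlMr//.
have : 0 <= x ^+ 2 * (1 + 2 * x) by rewrite mulr_ge0 ?sqr_ge0//; lra.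
by rewrite !expr2; nra.
Qed.

(** Exponential bounds of this shape multiply over factors and pass to limits, so no differentiation
    under the limit is required. *)
Lemma derive1_expR_bounds (f : R -> R) (z D K e : R) : 0 <= f z -> 0 < e -> 0 <= K ->
  (forall h, `|h| <= e -> f z * expR (h * D - K * h ^+ 2) <= f (h + z) /\
                f (h + z) <= f z * expR (h * D + K * h ^+ 2)) ->
  derive1 f z = f z * D.
Proof.
move=> fz0 e0 K0 hf; rewrite /derive1.
pose C := f z * (K + 2 * (`|D| + K) ^+ 2).
have C0 : 0 <= C by rewrite mulr_ge0// addr_ge0// mulr_ge0// sqr_ge0.
have DK0 : 0 <= `|D| + K by rewrite addr_ge0.
(* Chosen so that [h ^+ 2] is at most [|h|] and the exponent is at most 1/2, the range of
   [expR_le_quad]. *)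
pose e' := Num.min e (Num.min 1 (2 * (`|D| + K) + 2)^-1).
have q0 : 0 < 2 * (`|D| + K) + 2 by lra.
have e'0 : 0 < e' by rewrite !lt_min e0 ltr01 invr_gt0.
have bound h : `|h| <= e' -> `|f (h + z) - f z - h * (f z * D)| <= C * `|h| ^+ 2.
  rewrite !le_min => /and3P[he h1 h2].
  have [l u] := hf h he.
  have Dh : `|h * D| <= `|D| * `|h| by rewrite normrM mulrC.
  have hh : `|h| ^+ 2 <= `|h| by rewrite expr2 ler_piMr.
  have hsq : h ^+ 2 = `|h| ^+ 2 by rewrite real_normK// num_real.
  have y2 : `|h * D + K * h ^+ 2| <= (`|D| + K) * `|h|.
    rewrite (le_trans (ler_normD _ _))// mulrDl lerD//.
    by rewrite normrM (ger0_norm K0) hsq normrX normr_id ler_wpM2l.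
  have y3 : (`|D| + K) * `|h| <= 2^-1.
    have : (2 * (`|D| + K) + 2) * `|h| <= 1 by rewrite mulrC -ler_pdivlMr// mul1r.
    by have := normr_ge0 h; nra.
  have y4 : h * D + K * h ^+ 2 <= 2^-1.
    by apply: le_trans (ler_norm _) _; exact: le_trans y2 y3.
  have y5 : (h * D + K * h ^+ 2) ^+ 2 <= (`|D| + K) ^+ 2 * `|h| ^+ 2.
    by rewrite -exprMn -(real_normK (num_real (h * D + _))) ler_sqr ?nnegrE// mulr_ge0.
  have eu := expR_le_quad y4.
  have el := expR_ge1Dx (h * D - K * h ^+ 2).
  have U : f (h + z) <= f z * (1 + (h * D + K * h ^+ 2) + 2 * ((`|D| + K) ^+ 2 * `|h| ^+ 2)).
    apply: le_trans u _; rewrite ler_wpM2l//; apply: le_trans eu _.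
    by rewrite lerD2l ler_wpM2l.
  have L : f z * (1 + (h * D - K * h ^+ 2)) <= f (h + z).
    by apply: le_trans l; rewrite ler_wpM2l.
  rewrite ler_norml /C; apply/andP; split; rewrite -hsq in U *.
    apply: (@le_trans _ _ (f z * (1 + (h * D - K * h ^+ 2)) - f z - h * (f z * D))); last first.
      by rewrite !lerD2r.
    have -> : f z * (1 + (h * D - K * h ^+ 2)) - f z - h * (f z * D) = - (f z * K * h ^+ 2) by ring.
    rewrite lerN2 ler_wpM2r ?sqr_ge0// ler_wpM2l// lerDl.
    by rewrite mulr_ge0// sqr_ge0.
  apply: (@le_trans _ _ (f z * (1 + (h * D + K * h ^+ 2) +
    2 * ((`|D| + K) ^+ 2 * h ^+ 2)) - f z - h * (f z * D))).
    by rewrite !lerD2r.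
  by rewrite le_eqVlt; apply/orP; left; apply/eqP; ring.
apply/cvg_lim => //; apply/cvgrPdist_le => eps eps0.
have d0 : 0 < Num.min e' (eps / (C + 1)) by rewrite lt_min e'0 divr_gt0//; lra.
near=> h.
have hne : h != 0 by near: h; exact: nbhs_dnbhs_neq.
have hd : `|h| <= Num.min e' (eps / (C + 1)).
  near: h; apply: dnbhs0_le => //.
move: hd; rewrite le_min => /andP[he hC].
have := bound h he.
have -> : f (h + z) - f z - h * (f z * D) = h * (h^-1 *: (f (h + z) - f z) - f z * D).
  by rewrite /GRing.scale /=; field.
rewrite normrM expr2 mulrCA => hb.
rewrite distrC.
have h0 : 0 < `|h| by rewrite normr_gt0.
have : `|h^-1 *: (f (h + z) - f z) - f z * D| <= C * `|h|.
  by rewrite -(ler_pM2l h0).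
move=> hb'; apply: le_trans hb' _.
have : (C + 1) * `|h| <= eps by rewrite mulrC -ler_pdivlMr//; lra.
by have := normr_ge0 h; lra.
Unshelve. all: by end_near.
Qed.

(** * Convergence and logarithmic derivative of the infinite product *)

Section Egen_derivative.
Variables (p : param R) (z : R).
Hypotheses (z0 : 0 < z) (zR : z * supR p < 1).

Let q_fin : (\sum_(0 <= i <oo) (pq p i)%:E < +oo)%E.
Proof.
apply: le_lt_trans (p_summable p); apply: leeDl; apply: nneseries_ge0 => i _ _.
by rewrite lee_fin pr_ge0.
Qed.

Let r_fin : (\sum_(0 <= i <oo) (pr p i)%:E < +oo)%E.
Proof.
apply: le_lt_trans (p_summable p); apply: leeDr; apply: nneseries_ge0 => i _ _.
by rewrite lee_fin pq_ge0.
Qed.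

Lemma term_le_series (u : nat -> R) : (forall i, 0 <= u i) ->
  (\sum_(0 <= i <oo) (u i)%:E < +oo)%E ->
  forall i, u i <= fine (\sum_(0 <= i <oo) (u i)%:E)%E.
Proof.
move=> u0 uf i; rewrite -lee_fin fineK; last first.
  by rewrite ge0_fin_numE//; apply: nneseries_ge0 => j _ _; rewrite lee_fin.
rewrite (nneseriesD1 (n := i))//; last by move=> j _; rewrite lee_fin.
by apply: leeDl; apply: nneseries_ge0 => j _ _; rewrite lee_fin.
Qed.

Lemma pr_le_supR i : pr p i <= supR p.
Proof.
apply: sup_upper_bound; last by exists i.
split; first by exists (pr p 0), 0%N.
exists (fine (\sum_(0 <= i <oo) (pr p i)%:E)%E) => _ [j _ <-].
by apply: term_le_series => //; exact: pr_ge0.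
Qed.

Lemma pq_le_supQ i : pq p i <= supQ p.
Proof.
apply: sup_upper_bound; last by exists i.
split; first by exists (pq p 0), 0%N.
exists (fine (\sum_(0 <= i <oo) (pq p i)%:E)%E) => _ [j _ <-].
by apply: term_le_series => //; exact: pq_ge0.
Qed.

(** The logarithmic derivative of the factor of index [i]. *)
Definition log_term (x : R) (i : nat) : R :=
  pq p i / (1 + x * pq p i) + pr p i / (1 - x * pr p i).

Definition log_series (x : R) : R := limn (series (log_term x)).

Definition Efactor (x : R) (i : nat) : R :=
  (1 + x * pq p i) * (1 - x * pr p i)^-1.

Let good (x : R) := 0 < x /\ x * supR p < 1.

Let supR_ge0 : 0 <= supR p.
Proof. by apply: le_trans (pr_le_supR 0); exact: pr_ge0. Qed.

Let den1 x i : good x -> 1 <= 1 + x * pq p i.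
Proof. by move=> [x0 _]; rewrite lerDl mulr_ge0 ?pq_ge0// ltW. Qed.

Let den2 x i : good x -> 1 - x * supR p <= 1 - x * pr p i.
Proof. by move=> [x0 _]; rewrite lerD2l lerN2 ler_wpM2l ?pr_le_supR// ltW. Qed.

Let den2_gt0 x i : good x -> 0 < 1 - x * pr p i.
Proof. by move=> gx; apply: lt_le_trans (den2 i gx); rewrite subr_gt0; case: gx. Qed.

Let den1_gt0 x i : good x -> 0 < 1 + x * pq p i.
Proof. by move=> gx; apply: lt_le_trans (den1 i gx). Qed.

Lemma log_term_ge0 x i : good x -> 0 <= log_term x i.
Proof.
move=> gx; apply: addr_ge0; rewrite divr_ge0 ?pq_ge0 ?pr_ge0//.
  by rewrite ltW// den1_gt0.
by rewrite ltW// den2_gt0.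
Qed.

Lemma log_series_cvg x : good x -> cvgn (series (log_term x)).
Proof.
move=> gx; apply: nnseries_is_cvg => [i|]; first exact: log_term_ge0.
have c0 : 0 < 1 - x * supR p by rewrite subr_gt0; case: gx.
have le1 i : log_term x i <= pq p i + (1 - x * supR p)^-1 * pr p i.
  apply: lerD; first by rewrite ler_pdivrMr ?den1_gt0// ler_peMr ?pq_ge0// den1.
  rewrite mulrC ler_wpM2r ?pr_ge0// lef_pV2 ?posrE ?den2_gt0//.
  exact: den2.
apply: (@le_lt_trans _ _ (\sum_(0 <= i <oo) ((pq p i)%:E +
    ((1 - x * supR p)^-1)%:E * (pr p i)%:E))%E).
  apply: lee_nneseries => [i _ _|i _]; first by rewrite lee_fin log_term_ge0.
  by rewrite -EFinM -EFinD lee_fin.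
rewrite nneseriesD => [|i _ _|i _ _]; last 2 first.
- by rewrite lee_fin pq_ge0.
- by rewrite -EFinM lee_fin mulr_ge0 ?pr_ge0// invr_ge0 ltW.
rewrite nneseriesZl => [|i _]; last by rewrite lee_fin pr_ge0.
apply: lte_add_pinfty => //; apply: lte_mul_pinfty => //.
by rewrite lee_fin invr_ge0 ltW.
Qed.

Lemma log_partial_le x n : good x -> series (log_term x) n <= log_series x.
Proof.
move=> gx; apply: nondecreasing_cvgn_le; last exact: log_series_cvg.
by apply: nondecreasing_series => i _ _; exact: log_term_ge0.
Qed.

Lemma log_series_ge0 x : good x -> 0 <= log_series x.
Proof. by move=> gx; apply: le_trans (log_partial_le 0 gx); rewrite seriesEnat /= big_geq. Qed.

Lemma Efactor_ge1 x i : good x -> 1 <= Efactor x i.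
Proof.
move=> gx; rewrite /Efactor ler_pdivlMr ?den2_gt0// mul1r.
have [x0 _] := gx; have := den1 i gx.
have : 0 <= x * pr p i by rewrite mulr_ge0 ?pr_ge0// ltW.
lra.
Qed.

Lemma Efactor_le x i : good x ->
  Efactor x i <= expR (x * pq p i + x * (pr p i / (1 - x * pr p i))).
Proof.
move=> gx; rewrite expRD; have d2 := den2_gt0 i gx; apply: ler_pM => //.
- by rewrite ltW// den1_gt0.
- by rewrite invr_ge0 ltW.
- exact: expR_ge1Dx.
- apply: le_trans (expR_ge1Dx _).
  by rewrite le_eqVlt; apply/orP; left; apply/eqP; field; rewrite gt_eqF.
Qed.

Definition Eprod (x : R) (n : nat) : R := \prod_(i < n) Efactor x i.

Lemma Eprod_gt0 x n : good x -> 0 < Eprod x n.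
Proof.
by move=> gx; apply: prodr_gt0 => i _; apply: lt_le_trans (Efactor_ge1 i gx).
Qed.

Lemma Eprod_ge1 x n : good x -> 1 <= Eprod x n.
Proof.
move=> gx; elim: n => [|n IH]; first by rewrite /Eprod big_ord0.
rewrite /Eprod big_ord_recr /=; apply: le_trans IH _.
by rewrite ler_peMr ?Efactor_ge1// ltW// Eprod_gt0.
Qed.

Lemma Eprod_cvg x : good x -> cvgn (Eprod x).
Proof.
move=> gx; apply: nondecreasing_is_cvgn.
  apply/nondecreasing_seqP => n; rewrite /Eprod big_ord_recr /=.
  by rewrite ler_peMr ?Efactor_ge1// ltW// Eprod_gt0.
have [x0 xR] := gx.
exists (expR (x * (fine (\sum_(0 <= i <oo) (pq p i)%:E)%E + log_series x))).
move=> _ [n _ <-].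
apply: (@le_trans _ _ (expR (\sum_(i < n) (x * pq p i + x * (pr p i / (1 - x * pr p i)))))).
  rewrite expR_sum; apply: ler_prod => i _; rewrite Efactor_le// andbT.
  by apply: le_trans (Efactor_ge1 i gx).
rewrite ler_expR big_split /= -!mulr_sumr -mulrDr ler_wpM2l//; first exact: ltW.
apply: lerD.
  rewrite -lee_fin fineK; last first.
    by rewrite ge0_fin_numE//; apply: nneseries_ge0 => j _ _; rewrite lee_fin pq_ge0.
  rewrite -sumEFin -(big_mkord xpredT (fun i => (pq p i)%:E)).
  by apply: nneseries_lim_ge => i _; rewrite lee_fin pq_ge0.
apply: le_trans (log_partial_le n gx); rewrite seriesEord /=.
apply: ler_sum => i _; rewrite lerDr divr_ge0 ?pq_ge0// ltW// den1_gt0//.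
Qed.

(** With [c = 1 - z * supR p], both [q / (1 + z q)] and [r / (1 - z r)] are at most [1 / (z c)]; for
    [|h|] within the radius every factor changes by a relative amount of at most 1/2. *)
Definition E_radius : R := z * (1 - z * supR p) / 2.

Let c := 1 - z * supR p.
Let c0 : 0 < c. Proof. by rewrite subr_gt0. Qed.
Let c1 : c <= 1. Proof. by rewrite gerBl mulr_ge0// ltW. Qed.
Let gz : good z. Proof. by []. Qed.
Let e0 : 0 < E_radius. Proof. by rewrite divr_gt0// mulr_gt0. Qed.

Lemma near_good h : `|h| <= E_radius -> good (h + z).
Proof.
rewrite ler_norml /E_radius -/c => /andP[h1 h2].
have zc : 0 < z * c by rewrite mulr_gt0.
have zc1 : z * c <= z by rewrite ler_piMr// ltW.
split; first by lra.
have : (h + z) * supR p <= (z * c / 2 + z) * supR p by rewrite ler_wpM2r// lerD2r.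
have -> : (z * c / 2 + z) * supR p = (c / 2 + 1) * (z * supR p) by ring.
have -> : z * supR p = 1 - c by rewrite /c; ring.
by move: c0 c1; nra.
Qed.

(** The ratio is [(1 + h s) / (1 - h u)] with [s + u = log_term z i]. The quadratic errors in [h s]
    and [h u] are bounded by [h^2 / (z c)] times [s] and [u], hence are summable over [i]. *)
Lemma Efactor_ratio h i : `|h| <= E_radius ->
  Efactor z i * expR (h * log_term z i - 2 * (h ^+ 2 / (z * c) * log_term z i))
    <= Efactor (h + z) i /\
  Efactor (h + z) i <=
  Efactor z i * expR (h * log_term z i + 2 * (h ^+ 2 / (z * c) * log_term z i)).
Proof.
move=> he; have gh := near_good he.
have d1 := den1_gt0 i gz; have d2 := den2_gt0 i gz.
have d1' := den1_gt0 i gh; have d2' := den2_gt0 i gh.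
have zc : 0 < z * c by rewrite mulr_gt0.
pose s := pq p i / (1 + z * pq p i); pose u := pr p i / (1 - z * pr p i).
have s0 : 0 <= s by rewrite divr_ge0 ?pq_ge0// ltW.
have u0 : 0 <= u by rewrite divr_ge0 ?pr_ge0// ltW.
have s1 : s <= (z * c)^-1.
  rewrite /s ler_pdivrMr// mulrC ler_pdivlMr//.
  have := pq_ge0 p i; move: z0 c0 c1; set q := pq p i => ? ? ? ?.
  have : q * z * c <= q * z by rewrite ler_piMr// mulr_ge0// ltW.
  by lra.
have u1 : u <= (z * c)^-1.
  rewrite /u ler_pdivrMr// mulrC ler_pdivlMr//.
  have h1 : z * pr p i <= 1 - c.
    by rewrite /c opprB addrC subrK ler_wpM2l ?pr_le_supR// ltW.
  have h2 : 0 <= z * pr p i by rewrite mulr_ge0 ?pr_ge0// ltW.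
  have -> : pr p i * (z * c) = z * pr p i * c by ring.
  apply: (@le_trans _ _ c); last by lra.
  by rewrite ler_piMl// ?ltW//; lra.
have hs : `|h * s| <= 2^-1.
  rewrite normrM (ger0_norm s0).
  apply: (@le_trans _ _ (E_radius * (z * c)^-1)); first by rewrite ler_pM.
  by rewrite /E_radius -/c mulrAC divff ?mul1r// gt_eqF.
have hu : `|- (h * u)| <= 2^-1.
  rewrite normrN normrM (ger0_norm u0).
  apply: (@le_trans _ _ (E_radius * (z * c)^-1)); first by rewrite ler_pM.
  by rewrite /E_radius -/c mulrAC divff ?mul1r// gt_eqF.
have E1 : 1 + (h + z) * pq p i = (1 + z * pq p i) * (1 + h * s).
  by rewrite /s; field; rewrite gt_eqF.
have E2 : 1 - (h + z) * pr p i = (1 - z * pr p i) * (1 - h * u).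
  by rewrite /u; field; rewrite gt_eqF.
have hs2 : (h * s) ^+ 2 <= h ^+ 2 / (z * c) * s.
  by rewrite exprMn -mulrA ler_wpM2l ?sqr_ge0// expr2 ler_wpM2r.
have hu2 : (h * u) ^+ 2 <= h ^+ 2 / (z * c) * u.
  by rewrite exprMn -mulrA ler_wpM2l ?sqr_ge0// expr2 ler_wpM2r.
have lt_s : log_term z i = s + u by [].
have hb : 0 < 1 - h * u.
  by move: hu; rewrite ler_norml => /andP[]; lra.
have ratio : Efactor (h + z) i = Efactor z i * ((1 + h * s) * (1 - h * u)^-1).
  rewrite /Efactor E1 E2; field; by rewrite !gt_eqF.
have A1 := expR_lower hs; have A2 := expR_ge1Dx (h * s).
have A3 := expR_lower hu; have A4 := expR_ge1Dx (- (h * u)).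
have EF0 : 0 <= Efactor z i by apply: le_trans (Efactor_ge1 i gz).
have I1 : expR (h * u) <= (1 - h * u)^-1.
  by rewrite -[leLHS]invrK -expRN lef_pV2 ?posrE ?expR_gt0.
have I2 : (1 - h * u)^-1 <= expR (h * u + 2 * (h * u) ^+ 2).
  rewrite -[leRHS]invrK -expRN lef_pV2 ?posrE ?expR_gt0//.
  by apply: le_trans A3; rewrite ler_expR sqrrN; lra.
have B0 : 0 <= 1 + h * s.
  by move: hs; rewrite ler_norml => /andP[]; lra.
rewrite ratio lt_s; split; rewrite ler_wpM2l//.
  apply: (@le_trans _ _ (expR (h * s - 2 * (h * s) ^+ 2) * expR (h * u))).
    rewrite -expRD ler_expR; have : 0 <= h ^+ 2 / (z * c) * u.
      by rewrite mulr_ge0// divr_ge0 ?sqr_ge0// ltW.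
    move: hs2; move: (h ^+ 2 / (z * c)) ((h * s) ^+ 2) => X Y.
    by rewrite !mulrDr; lra.
  by apply: ler_pM => //; exact: expR_ge0.
apply: (@le_trans _ _ (expR (h * s) * expR (h * u + 2 * (h * u) ^+ 2))).
  by apply: ler_pM => //; rewrite invr_ge0 ltW.
rewrite -expRD ler_expR; have : 0 <= h ^+ 2 / (z * c) * s.
  by rewrite mulr_ge0// divr_ge0 ?sqr_ge0// ltW.
move: hu2; move: (h ^+ 2 / (z * c)) ((h * u) ^+ 2) => X Y.
by rewrite !mulrDr; lra.
Qed.

Let K := 2 * log_series z / (z * c).

(** [K] does not depend on [n], so the bounds survive the limit in [Egen_ratio]. *)
Lemma Eprod_ratio h n : `|h| <= E_radius ->
  Eprod z n * expR (h * series (log_term z) n - K * h ^+ 2) <= Eprod (h + z) n /\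
  Eprod (h + z) n <= Eprod z n * expR (h * series (log_term z) n + K * h ^+ 2).
Proof.
move=> he; have zc : 0 < z * c by rewrite mulr_gt0.
have EF0 i : 0 <= Efactor z i by apply: le_trans (Efactor_ge1 i gz).
have EF0' i : 0 <= Efactor (h + z) i by apply: le_trans (Efactor_ge1 i (near_good he)).
have SK : 2 * (h ^+ 2 / (z * c) * series (log_term z) n) <= K * h ^+ 2.
  have -> : K * h ^+ 2 = 2 * (h ^+ 2 / (z * c) * log_series z) by rewrite /K; ring.
  by rewrite ler_wpM2l// ler_wpM2l ?log_partial_le// divr_ge0 ?sqr_ge0// ltW.
have Es : \sum_(i < n) log_term z i = series (log_term z) n by rewrite seriesEord.
split.
  apply: (@le_trans _ _ (\prod_(i < n) (Efactor z i *
     expR (h * log_term z i - 2 * (h ^+ 2 / (z * c) * log_term z i))))).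
    rewrite big_split /= -expR_sum sumrB -!mulr_sumr Es.
    by rewrite ler_wpM2l ?ler_expR; [|exact: prodr_ge0|]; lra.
  apply: ler_prod => i _; rewrite mulr_ge0 ?expR_ge0//=.
  by have [] := Efactor_ratio i he.
apply: (@le_trans _ _ (\prod_(i < n) (Efactor z i *
     expR (h * log_term z i + 2 * (h ^+ 2 / (z * c) * log_term z i))))).
  apply: ler_prod => i _; rewrite EF0' /=.
  by have [] := Efactor_ratio i he.
have S2 : \sum_(i < n) (h * log_term z i + 2 * (h ^+ 2 / (z * c) * log_term z i)) =
    h * series (log_term z) n + 2 * (h ^+ 2 / (z * c) * series (log_term z) n).
  by rewrite big_split /= -!mulr_sumr Es.
rewrite big_split /= -expR_sum S2.
by rewrite ler_wpM2l ?ler_expR; [|exact: prodr_ge0|]; lra.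
Qed.

Lemma Egen_ratio h : `|h| <= E_radius ->
  Egen p z * expR (h * (pt p + log_series z) - K * h ^+ 2) <= Egen p (h + z) /\
  Egen p (h + z) <= Egen p z * expR (h * (pt p + log_series z) + K * h ^+ 2).
Proof.
move=> he; have cz := Eprod_cvg gz; have ch := Eprod_cvg (near_good he).
have EE x : Egen p x = expR (pt p * x) * limn (Eprod x) by [].
have cs : series (log_term z) @ \oo --> log_series z by exact: log_series_cvg.
have cexp (s : R) : (fun n => expR (h * series (log_term z) n + s)) @ \oo -->
    expR (h * log_series z + s).
  apply: (@continuous_cvg _ _ _ _ _ (fun n => h * series (log_term z) n + s) expR).
    exact: continuous_expR.
  by apply: cvgD; [apply: cvgM => //|]; exact: cvg_cst.
have L : limn (Eprod z) * expR (h * log_series z - K * h ^+ 2) <= limn (Eprod (h + z)).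
  apply: (ler_cvg_to (a := \oo) (f := fun n => Eprod z n * expR (h * series (log_term z) n - K * h ^+ 2))
    (g := Eprod (h + z))) => //.
    by apply: cvgM => //; exact: (cexp (- (K * h ^+ 2))).
  by apply: nearW => n; have [] := Eprod_ratio n he.
have U : limn (Eprod (h + z)) <= limn (Eprod z) * expR (h * log_series z + K * h ^+ 2).
  apply: (ler_cvg_to (a := \oo) (f := Eprod (h + z))
    (g := fun n => Eprod z n * expR (h * series (log_term z) n + K * h ^+ 2))) => //.
    by apply: cvgM => //; exact: cexp.
  by apply: nearW => n; have [] := Eprod_ratio n he.
have ex (s : R) : expR (pt p * z) * limn (Eprod z) * expR (h * (pt p + log_series z) + s)
    = expR (pt p * (h + z)) * (limn (Eprod z) * expR (h * log_series z + s)).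
  rewrite -!mulrA [RHS]mulrCA [in LHS]mulrCA; congr (_ * _).
  by rewrite -!expRD; congr expR; ring.
rewrite !EE; split; first by rewrite (ex (- _)) ler_wpM2l ?expR_ge0.
by rewrite ex ler_wpM2l ?expR_ge0.
Qed.

Lemma Egen_gt0 : 0 < Egen p z.
Proof.
rewrite /Egen mulr_gt0 ?expR_gt0//; apply: (lt_le_trans ltr01).
apply: limr_ge; first exact: Eprod_cvg.
by apply: nearW => n; exact: Eprod_ge1.
Qed.

Lemma log_derivative_Egen :
  derive1 (Egen p) z / Egen p z = pt p + log_series z.
Proof.
have K0 : 0 <= K.
  by rewrite divr_ge0 ?mulr_ge0 ?log_series_ge0// ltW// c0.
rewrite (derive1_expR_bounds (ltW Egen_gt0) e0 K0 Egen_ratio).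
by rewrite mulrAC divff ?mul1r// gt_eqF// Egen_gt0.
Qed.

End Egen_derivative.
End log_derivative.

(** * Almost sure distinctness of the coordinates *)

Section measure_facts.
Context (R : realType) (d : measure_display) (T : measurableType d)
  (P : probability T R).
Local Open Scope ereal_scope.

(* The integral of a nonnegative function, measurable or not, is the supremum  *)
(* over the simple functions below it.                                         *)
Lemma ge0_le_integral_lower (f g : T -> \bar R) :
  (forall w, 0 <= f w) -> (forall w, f w <= g w) ->
  \int[P]_w f w <= \int[P]_w g w.
Proof.
move=> f0 fg; have g0 w : 0 <= g w by exact: le_trans (fg w).
rewrite !ge0_integralTE//; apply: le_ereal_sup => _ [h /= hf <-].
by exists h => // w; exact: le_trans (fg w).
Qed.

(** Meant for [f = lambda1]: a simple function below [f] is below [g] off a null set, which suffices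
    to compare its integral. *)
Lemma ae_ge0_le_integral_upper (f g : T -> \bar R) (N : set T) :
  (forall w, 0 <= f w) -> (forall w, 0 <= g w) -> measurable_fun setT g ->
  P.-negligible N -> (forall w, ~ N w -> f w <= g w) ->
  \int[P]_w f w <= \int[P]_w g w.
Proof.
move=> f0 g0 mg [N' [mN' N'0 NN']] fg.
rewrite [leLHS]ge0_integralTE//; apply: ge_ereal_sup => _ [h /= hf <-].
have hE : sintegral P h = \int[P]_w (h w)%:E by rewrite integralT_nnsfun.
have mh : measurable_fun setT (fun w => (h w)%:E).
  by apply/measurable_EFinP; exact: measurable_funP.
rewrite hE (@ge0_negligible_integral _ _ _ P setT N')//; last first.
  by move=> w _; rewrite lee_fin.
rewrite [leRHS](@ge0_negligible_integral _ _ _ P setT N')//.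
apply: ge0_le_integral => //.
- exact: measurableD.
- by move=> w _; rewrite lee_fin.
- exact: measurable_funS mh.
- exact: measurable_funS mg.
- move=> w [_ wN]; apply: le_trans (hf w) _; apply: fg => /NN'; exact: wN.
Qed.

End measure_facts.

Section distinct_points_ae.
Context (R : realType) (d : measure_display) (T : measurableType d)
  (P : probability T R) (pp pm : param R) (ap am : R)
  (S : sampling P pp pm ap am) (lep lem : rel (Omega R)).
Hypotheses (lepP : alphabet_order lep) (lemP : alphabet_order lem).
Local Open Scope ereal_scope.

(** With Sigma as the other letter, a point cannot miss all the real slots, so the probability in
    [miss_event] is 0. *)
Lemma slot_len_sum (m : nat) :
  (\sum_(s <- iota 0 (slot_count R m) | slot_block lep m s == Some Breal)
     slot_len m lep s = 1)%R /\
  (\sum_(s <- iota 0 (slot_count R m) | slot_block lem m s == Some Breal)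
     slot_len m lem s = 1)%R.
Proof.
split.
  pose A := [seq (s, 0%N) | s <- iota 0 (slot_count R m) & slot_block lep m s == Some Breal].
  have uA : uniq A by rewrite map_inj_uniq ?filter_uniq ?iota_uniq// => i j [].
  have hA z : z \in A -> cell_blocks lep lem m z = (Some Breal, None).
    by move=> /mapP[s + ->]; rewrite mem_filter => /andP[/eqP e _]; rewrite /cell_blocks /= e.
  have [_] := miss_event S lepP lemP 0%N uA hA.
  rewrite (_ : mkset _ = set0).
    rewrite measure0 => -[/esym/eqP]; rewrite subr_eq0 => /eqP ->.
    rewrite /A big_map big_filter; apply: eq_bigr => s _.
    by rewrite /cell_len /slot_len /= mulr1.
  apply/seteqP; split => // w /= /negP[]; apply/mapP.
  exists (slot lep m (Some (Oreal (fstu S None 0%N w)))); last by [].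
  by rewrite mem_filter mem_iota slot_block_real// eqxx add0n; exact: (slot_lt lep).
pose A := [seq (0%N, s) | s <- iota 0 (slot_count R m) & slot_block lem m s == Some Breal].
have uA : uniq A by rewrite map_inj_uniq ?filter_uniq ?iota_uniq// => i j [].
have hA z : z \in A -> cell_blocks lep lem m z = (None, Some Breal).
  by move=> /mapP[s + ->]; rewrite mem_filter => /andP[/eqP e _]; rewrite /cell_blocks /= e.
have [_] := miss_event S lepP lemP 0%N uA hA.
rewrite (_ : mkset _ = set0).
  rewrite measure0 => -[/esym/eqP]; rewrite subr_eq0 => /eqP ->.
  rewrite /A big_map big_filter; apply: eq_bigr => s _.
  by rewrite /cell_len /slot_len /= mul1r.
apply/seteqP; split => // w /= /negP[]; apply/mapP.
exists (slot lem m (Some (Oreal (sndu S None 0%N w)))); last by [].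
by rewrite mem_filter mem_iota slot_block_real// eqxx add0n; exact: (slot_lt lem).
Qed.

Lemma slot_len_le (le : rel (Omega R)) (leP : alphabet_order le) (m s : nat) :
  (0 < m)%N -> slot_block le m s == Some Breal -> (slot_len m le s <= 2 / m%:R)%R.
Proof.
move=> m0 sr; rewrite /slot_len sr -lee_fin -uniform_fine; last exact: measurable_real_slot.
exact: uniform_real_slot_le.
Qed.

Lemma negligible_inv_bound (N : nat -> set T) (A : set T) :
  (forall m, (0 < m)%N -> [/\ measurable (N m), A `<=` N m & P (N m) <= (2 / m%:R)%:E]) ->
  P.-negligible A.
Proof.
move=> h; exists (\bigcap_(m in [set m | (0 < m)%N]) N m); split.
- by apply: bigcap_measurable => [|m /h[]]; [exists 1%N|].
- apply/eqP; rewrite eq_le measure_ge0 andbT; apply/lee_addgt0Pr => e e0; rewrite add0e.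
  pose m := (Num.truncn (2 / e)).+1.
  have m0 : (0 < m)%N by [].
  have [mN _ PN] := h m m0.
  apply: (@le_trans _ _ (P (N m))).
    apply: le_measure; rewrite ?inE//.
      by apply: bigcap_measurable => [|k /h[]]; [exists 1%N|].
    by move=> w; apply.
  apply: le_trans PN _; rewrite lee_fin ler_pdivrMr ?ltr0n// mulrC -ler_pdivrMr//.
  by apply: ltW; exact: Num.Theory.truncnS_gt.
- by move=> w Aw m /h[_ + _]; apply.
Qed.

(** If [U = V] both lie in the same real slot; by independence this has probability at most the sum
    of the squared lengths, which is at most 2/m. *)
Lemma uniform_distinct (le : rel (Omega R)) (leP : alphabet_order le) (U V : T -> unit01 R) :
  uniform01 P U -> uniform01 P V ->
  (forall m, \sum_(s <- iota 0 (slot_count R m) | slot_block le m s == Some Breal)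
     slot_len m le s = 1)%R ->
  (forall A B : set R, measurable A -> measurable B ->
     P ([set w | A (val (U w))] `&` [set w | B (val (V w))]) =
     P [set w | A (val (U w))] * P [set w | B (val (V w))]) ->
  P.-negligible [set w | U w = V w].
Proof.
move=> uU uV len1 ind.
pose E m s := [set w | real_slot le m s (val (U w))] `&` [set w | real_slot le m s (val (V w))].
pose rs m := [seq s <- iota 0 (slot_count R m) | slot_block le m s == Some Breal].
have mE m s : measurable (E m s).
  apply: measurableI; rewrite -[X in measurable X]setTI.
    by apply: uU.1 => //; exact: measurable_real_slot.
  by apply: uV.1 => //; exact: measurable_real_slot.
have En m s : slot_block le m s != Some Breal -> E m s = set0.
  move=> nr; apply/seteqP; split=> // w [[u [_ us]] _].
  by rewrite -us slot_block_real// eqxx in nr.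
apply: (negligible_inv_bound
  (N := fun m => \big[setU/set0]_(s < slot_count R m) E m s)) => m m0.
split.
- by apply: bigsetU_measurable => s _; exact: mE.
- move=> w UV; rewrite -bigcup_mkord; exists (slot le m (Some (Oreal (U w)))).
    exact: slot_lt.
  by split; exists (U w); rewrite //= UV.
- apply: le_trans (Boole_inequality _ _) _ => //.
  rewrite -(big_mkord xpredT (fun s => P (E m s)))
    (bigID (fun s => slot_block le m s == Some Breal)) /=.
  rewrite [X in _ + X]big1 ?adde0; last by move=> s /En ->; rewrite measure0.
  have -> : (2 / m%:R)%:E = (\sum_(s <- iota 0 (slot_count R m) | slot_block le m s == Some Breal)
     slot_len m le s * (2 / m%:R))%:E by rewrite -mulr_suml len1 mul1r.
  rewrite -sumEFin /index_iota subn0; apply: lee_sum => s sr.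
  rewrite /E ind; [|exact: measurable_real_slot..].
  have lenE : uniform_prob (@ltr01 R) (real_slot le m s) = (slot_len m le s)%:E.
    by rewrite /slot_len sr -uniform_fine//; exact: measurable_real_slot.
  rewrite uU.2 ?uV.2 ?lenE; [|exact: measurable_real_slot..].
  rewrite -EFinM lee_fin ler_wpM2l ?slot_len_ge0//.
  exact: slot_len_le.
Qed.

Lemma block_countable : exists code : (option block * nat) * (option block * nat) -> nat,
  injective code.
Proof.
pose enc (b : block) : option (nat + nat) :=
  match b with Breal => None | Bint i => Some (inl i) | Bint' i => Some (inr i) end.
have enc_inj : injective enc by move=> [|i|i] [|j|j] //= [->].
exists (fun x => pickle ((omap enc x.1.1, x.1.2), (omap enc x.2.1, x.2.2))).
move=> [[a i] [b j]] [[a' i'] [b' j']] /(pcan_inj pickleK)[] /= ea -> eb ->.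
by congr ((_, _), (_, _)); [move: ea|move: eb]; exact: (inj_omap enc_inj).
Qed.

Lemma negligible_pairs (X : option block * nat -> T -> unit01 R) :
  (forall i j, i <> j -> P.-negligible [set w | X i w = X j w]) ->
  P.-negligible [set w | ~ forall i j, i <> j -> X i w <> X j w].
Proof.
move=> h; have [code codeI] := block_countable.
apply: (negligibleS (A := \bigcup_n [set w | exists i j,
    [/\ code (i, j) = n, i <> j & X i w = X j w]])).
  move=> w /existsNP[i /existsNP[j /not_implyP[ij /contrapT e]]].
  by exists (code (i, j)) => //; exists i, j.
apply: negligible_bigcup => n.
have [[i [j [cn ij]]]|ne] := pselect (exists i j, code (i, j) = n /\ i <> j).
  apply: negligibleS (h i j ij) => w [i' [j' [cn' _ e]]].
  by have [<- <-] : (i', j') = (i, j) by apply: codeI; rewrite cn.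
apply: negligibleS (negligible_set0 _) => w [i [j [cn ij _]]].
by apply: ne; exists i, j.
Qed.

Lemma distinct_points_ae : P.-negligible [set w | ~ distinct_points S w].
Proof.
have ind2 : mutually_independent P (source_events (fun a b => cnt S a b) (fstu S) (sndu S)).
  exact: (@sampling_indep _ _ _ _ _ _ _ _ S).
have two (I : eqType) (i j : I) (B : I -> set T) :
    \bigcap_(k in [set` [:: i; j]]) B k = B i `&` B j.
  by rewrite !bigcap_set_cons bigcap_set_nil setIT.
apply: (negligibleS (A :=
  [set w | ~ forall i j : option block * nat, i <> j -> fstu S i.1 i.2 w <> fstu S j.1 j.2 w] `|`
  [set w | ~ forall i j : option block * nat, i <> j -> sndu S i.1 i.2 w <> sndu S j.1 j.2 w])).
  by move=> w /= nd; apply: contrapT => /not_orP[/contrapT h1 /contrapT h2]; apply: nd.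
apply: negligibleU; apply: negligible_pairs => -[b k] [b' k'] bk /=.
  apply: (uniform_distinct lepP (fstu_law S b k) (fstu_law S b' k')).
    by move=> m; have [] := slot_len_sum m.
  move=> A B mA mB.
  have := ind2 [:: Fst b k; Fst b' k'] (fun s => if s is Fst c l then
    if (c, l) == (b, k) then [set w | A (val (fstu S b k w))]
    else [set w | B (val (fstu S b' k' w))]
    else setT).
  rewrite two !big_cons big_nil mule1 eqxx ifN; last by apply/eqP => e; apply: bk.
  apply.
    by rewrite /= andbT inE; apply/eqP => -[e1 e2]; apply: bk; rewrite e1 e2.
  move=> s; rewrite !inE => /orP[] /eqP -> /=.
    by rewrite eqxx; exists A; rewrite ?setTI.
  rewrite ifN; last by apply/eqP => e; apply: bk.
  by exists B; rewrite ?setTI.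
apply: (uniform_distinct lemP (sndu_law S b k) (sndu_law S b' k')).
  by move=> m; have [] := slot_len_sum m.
move=> A B mA mB.
have := ind2 [:: Snd b k; Snd b' k'] (fun s => if s is Snd c l then
  if (c, l) == (b, k) then [set w | A (val (sndu S b k w))] else [set w | B (val (sndu S b' k' w))]
  else setT).
rewrite two !big_cons big_nil mule1 eqxx ifN; last by apply/eqP => e; apply: bk.
apply.
  by rewrite /= andbT inE; apply/eqP => -[e1 e2]; apply: bk; rewrite e1 e2.
move=> s; rewrite !inE => /orP[] /eqP -> /=.
  by rewrite eqxx; exists A; rewrite ?setTI.
rewrite ifN; last by apply/eqP => e; apply: bk.
by exists B; rewrite ?setTI.
Qed.

End distinct_points_ae.

(** * Comparison with the solvable model *)

Section law_comparison.
Variable R : realType.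
Implicit Types (x p delta : R).

Lemma st_le_refl (mu : nat -> R) : st_le mu mu.
Proof. by move=> f _ _. Qed.

Lemma one_sub_expR_le x : 1 - expR (- x) <= x.
Proof. by have := expR_ge1Dx (- x); lra. Qed.

Lemma one_sub_expR_ge x : 0 <= x -> x / (1 + x) <= 1 - expR (- x).
Proof.
move=> x0; have x1 : 0 < 1 + x by lra.
have h : expR (- x) <= (1 + x)^-1.
  by rewrite expRN lef_pV2 ?posrE ?expR_gt0//; exact: expR_ge1Dx.
have -> : x / (1 + x) = 1 - (1 + x)^-1 by field; rewrite gt_eqF.
by lra.
Qed.

Lemma frac_le p q : 0 <= p -> p <= q -> p / (1 + p) <= q / (1 + q).
Proof.
move=> p0 pq; rewrite ler_pdivrMr; last by lra.
by rewrite mulrAC ler_pdivlMr; [nra|lra].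
Qed.

Lemma frac_le_self p : 0 <= p -> p / (1 + p) <= p.
Proof. by move=> p0; rewrite ler_pdivrMr; [nra|lra]. Qed.

(** [p / (1 + p) <= p <= x / (1 + delta) <= x / (1 + x) <= 1 - exp(-x)]. *)
Lemma void_law_lower (wx wy : bool) x p delta : ~~ (wx && wy) -> 0 <= p ->
  0 <= x <= delta -> p <= x / (1 + delta) ->
  st_le (cell_law wx wy p) (bern01 (1 - expR (- x))).
Proof.
move=> ww p0 /andP[x0 xd] px.
have e1 : 1 - expR (- x) <= 1 by rewrite gerBl expR_ge0.
have px' : p <= 1 - expR (- x).
  apply: le_trans px _; apply: le_trans (one_sub_expR_ge x0).
  by rewrite ler_wpM2l// lef_pV2 ?posrE; lra.
rewrite /cell_law (negbTE ww); case: ifP => _; apply: bern01_st_le => //.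
  by rewrite divr_ge0//; lra.
by apply: le_trans px'; exact: frac_le_self.
Qed.

(** From [p >= x / (1 - x)] follows [p / (1 + p) >= x >= 1 - exp(-x)], which covers both Bernoulli
    laws. *)
Lemma void_law_upper (wx wy : bool) x p delta : ~~ (wx && wy) ->
  0 <= x <= delta -> delta < 1 -> x / (1 - delta) <= p -> (~~ (wx || wy) -> p <= 1) ->
  st_le (bern01 (1 - expR (- x))) (cell_law wx wy p).
Proof.
move=> ww /andP[x0 xd] d1 px p1.
have e0 : 0 <= 1 - expR (- x).
  by rewrite subr_ge0 -[leRHS]expR0 ler_expR; lra.
have xp : x / (1 - x) <= p.
  by apply: le_trans px; rewrite ler_wpM2l// lef_pV2 ?posrE; lra.
have xx : x <= x / (1 - x) by rewrite ler_pdivlMr; [nra|lra].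
have p0 : 0 <= p by lra.
rewrite /cell_law (negbTE ww); case: ifPn => wxy; apply: bern01_st_le => //.
- apply: le_trans (one_sub_expR_le x) _.
  have -> : x = (x / (1 - x)) / (1 + x / (1 - x)).
    by field; rewrite addrNK oner_neq0 andbT gt_eqF//; lra.
  by apply: frac_le => //; lra.
- by rewrite ler_pdivrMr; lra.
- by apply: le_trans (one_sub_expR_le x) _; lra.
- exact: p1.
Qed.

End law_comparison.

(** * Slots as letters, and their boundary means *)

Section slot_parameters.
Variable R : realType.

(* A real slot of length [l] plays the part of a letter of Z^+ of parameter    *)
(* [t l rho]; [rho] is close to 1.                                             *)
Definition slot_par (le : rel (Omega R)) (m : nat) (p : param R) (z rho : R) (s : nat) : R :=
  if slot_block le m s == Some Breal then pt p * slot_len m le s * rho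
  else block_param p z (slot_block le m s).

Lemma slot_weakE (le : rel (Omega R)) m s : slot_weak le m s = block_weak (slot_block le m s).
Proof. by []. Qed.

Lemma letter_blocks_nonreal m b : b \in letter_blocks m -> b != Breal.
Proof. by rewrite mem_cat => /orP[] /mapP[i _ ->]; apply/eqP. Qed.

Lemma letter_blocks_uniq m : uniq (letter_blocks m).
Proof.
rewrite cat_uniq !map_inj_uniq ?iota_uniq//=; last 2 first.
- by move=> i j [].
- by move=> i j [].
by rewrite andbT; apply/hasPn => _ /mapP[i _ ->]; apply/negP => /mapP[].
Qed.

(** The shift of the index skips Sigma. The slots carrying a letter correspond bijectively to
    [letter_blocks m], and [Bint i] together with [Bint' i] contributes [z * log_term p z i]. *)
Lemma slot_mean_sum (le : rel (Omega R)) (leP : alphabet_order le) (m : nat) (p : param R)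
    (z0 z rho : R) :
  \sum_(i <- iota 0 (slot_count R m).-1)
    cell_mean (slot_weak le m i.+1) (slot_par le m p z0 rho i.+1 * z) =
  z * series (log_term p z) m +
  \sum_(s <- iota 0 (slot_count R m) | slot_block le m s == Some Breal)
    cell_mean false (pt p * slot_len m le s * rho * z).
Proof.
pose F s := cell_mean (slot_weak le m s) (slot_par le m p z0 rho s * z).
have [K NK] : exists K, slot_count R m = K.+1 by exists (slot_count R m).-1.
rewrite NK -[K.+1.-1]/K -[iota 0 K.+1]/(0%N :: iota 1 K) big_cons.
have -> : (slot_block le m 0 == Some Breal) = false by apply/eqP.
transitivity (\sum_(s <- iota 1 K) F s).
  by rewrite (iotaDl 1 0 K) big_map.
rewrite (bigID (fun s => slot_block le m s == Some Breal)) /= addrC; congr (_ + _); last first.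
  by apply: eq_bigr => s sr; rewrite /F /slot_par slot_weakE sr (eqP sr).
rewrite -big_filter.
have pm : perm_eq [seq s <- iota 1 K | slot_block le m s != Some Breal]
    [seq slot le m (Some (letter R b)) | b <- letter_blocks m].
  apply: uniq_perm; first by rewrite filter_uniq ?iota_uniq.
    rewrite map_inj_in_uniq ?letter_blocks_uniq// => b b' bl bl' e.
    have := slot_block_of leP bl; rewrite e (slot_block_of leP bl').
    by move=> [].
  move=> s; rewrite mem_filter mem_iota; apply/idP/mapP.
    move=> /andP[sr /andP[s0 _]]; case E : (slot_block le m s) sr => [b|] sr; last first.
      by case: s s0 E.
    have nb : b != Breal by apply: contraNneq sr => ->.
    by have [bl ->] := slot_block_letter E nb; exists b.
  move=> [b bl ->]; rewrite slot_block_of//.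
  have nb := letter_blocks_nonreal bl.
  apply/andP; split; first by apply: contra nb => /eqP[->].
  by rewrite add1n -NK; exact: slot_lt.
rewrite (perm_big _ pm) /= big_map big_seq.
transitivity (\sum_(b <- letter_blocks m)
    cell_mean (block_weak (Some b)) (block_param p z0 (Some b) * z)).
  rewrite [RHS]big_seq; apply: eq_bigr => b bl.
  rewrite /F /slot_par slot_weakE slot_block_of// ifN//.
  by apply: contra (letter_blocks_nonreal bl) => /eqP[->].
rewrite /letter_blocks big_cat /= !big_map -big_split seriesEnat /= /index_iota subn0 mulr_sumr.
apply: eq_bigr => i _; rewrite /cell_mean /log_term mulrDr.
by rewrite ![_ * z]mulrC !mulrA.
Qed.

Lemma real_mean_le (le : rel (Omega R)) (m : nat) (p : param R) (z rho : R) :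
  0 <= z -> 0 <= rho ->
  \sum_(s <- iota 0 (slot_count R m) | slot_block le m s == Some Breal) slot_len m le s = 1 ->
  \sum_(s <- iota 0 (slot_count R m) | slot_block le m s == Some Breal)
    cell_mean false (pt p * slot_len m le s * rho * z) <= z * pt p * rho.
Proof.
move=> z0 r0 len1.
have -> : z * pt p * rho = \sum_(s <- iota 0 (slot_count R m) | slot_block le m s == Some Breal)
    pt p * slot_len m le s * rho * z.
  by rewrite -!mulr_suml -mulr_sumr len1 mulr1; ring.
apply: ler_sum => s _; apply: frac_le_self.
by rewrite !mulr_ge0 ?pt_ge0 ?slot_len_ge0.
Qed.

Lemma real_mean_ge (le : rel (Omega R)) (m : nat) (p : param R) (z rho delta : R) :
  0 <= z -> 0 <= rho <= 1 -> 0 <= delta ->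
  (forall s, slot_block le m s == Some Breal -> pt p * slot_len m le s * z <= delta) ->
  \sum_(s <- iota 0 (slot_count R m) | slot_block le m s == Some Breal) slot_len m le s = 1 ->
  z * pt p * rho / (1 + delta) <=
  \sum_(s <- iota 0 (slot_count R m) | slot_block le m s == Some Breal)
    cell_mean false (pt p * slot_len m le s * rho * z).
Proof.
move=> z0 /andP[r0 r1] d0 hd len1.
have -> : z * pt p * rho / (1 + delta) =
    \sum_(s <- iota 0 (slot_count R m) | slot_block le m s == Some Breal)
    pt p * slot_len m le s * rho * z / (1 + delta).
  by rewrite -!mulr_suml -mulr_sumr len1 mulr1; ring.
apply: ler_sum => s sr; rewrite /cell_mean.
have y0 : 0 <= pt p * slot_len m le s * rho * z by rewrite !mulr_ge0 ?pt_ge0 ?slot_len_ge0.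
have yd : pt p * slot_len m le s * rho * z <= delta.
  apply: le_trans (hd s sr); rewrite mulrAC ler_piMr//.
  by rewrite !mulr_ge0 ?pt_ge0 ?slot_len_ge0.
by rewrite ler_wpM2l// lef_pV2 ?posrE; lra.
Qed.

End slot_parameters.

(** * The discretized model between two solvable ones *)

Section sandwich.
Context (R : realType) (d : measure_display) (T : measurableType d)
  (P : probability T R) (pp pm : param R) (alpha : R)
  (S : sampling P pp pm alpha alpha^-1) (lep lem : rel (Omega R)).
Hypotheses (lepP : alphabet_order lep) (lemP : alphabet_order lem).
Hypotheses (a0 : 0 < alpha) (QQ : supQ pp * supQ pm < 1)
  (Ra : supR pp < alpha) (aR : alpha * supR pm < 1).

Local Notation am := (alpha^-1).
Let am0 : 0 < am. Proof. by rewrite invr_gt0. Qed.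

Variable m : nat.
Local Notation N := (slot_count R m).
Local Notation wx := (slot_weak lep m).
Local Notation wy := (slot_weak lem m).
Local Notation law := (weight_law pp pm alpha am lep lem m).
Local Notation px := (slot_par lep m pp alpha).
Local Notation py := (slot_par lem m pm am).
Local Notation bx := (slot_block lep m).
Local Notation by_ := (slot_block lem m).

Lemma slot_par_ge0 (le : rel (Omega R)) (p : param R) (z rho : R) s : 0 <= z -> 0 <= rho ->
  0 <= slot_par le m p z rho s.
Proof.
move=> z0 r0; rewrite /slot_par; case: ifP => _.
  by rewrite !mulr_ge0 ?pt_ge0 ?slot_len_ge0.
exact: block_param_ge0.
Qed.

Lemma weight_law_is_mass z : is_mass (law z).
Proof.
have PE c := (cell_weight_event S lepP lemP m (ltW a0) (ltW am0) z c).2.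
have mE c := measurable_cell_weight S lepP lemP m (ltW a0) (ltW am0) z c.
split=> [k|]; first by rewrite -lee_fin -PE; exact: measure_ge0.
have U : \bigcup_c [set w | cell_weight S lep lem m z w = c] = setT.
  by apply/seteqP; split => // w _; exists (cell_weight S lep lem m z w).
under eq_eseriesr do rewrite -PE.
rewrite -measure_semi_bigcup//.
- by rewrite U; exact: probability_setT.
- by move=> i j _ _ [w [/= <- <-]].
- exact: bigcup_measurable.
Qed.

Lemma integral_grid_lambda :
  (\int[P]_w (grid_lambda S lep lem m w)%:R%:E =
   ER (grid_laws (fun i j => law (i, j)) N N)
     (fun ss => (lpp wx wy (weight_of ss) N N)%:R%:E))%E.
Proof.
rewrite -(integral_grid (P := P) (X := cell_weight S lep lem m))//.
- apply: eq_integral => w _; congr (_%:R%:E); apply: lpp_ext => i j iN jN.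
  rewrite /weight_of (nth_map 0%N) ?size_iota// (nth_map 0%N) ?size_iota//.
  by rewrite !nth_iota.
- by move=> z c; apply: measurable_cell_weight => //; exact: ltW.
- exact: weight_law_is_mass.
- by move=> J c uJ; apply: cell_weights_law => //; exact: ltW.
Qed.

Definition model_law (rho : R) (i j : nat) : nat -> R :=
  if (i == 0%N) && (j == 0%N) then @zero_mass R
  else cell_law (wx i) (wy j) (px rho i * py rho j).

Let real_cell (z : nat * nat) := (bx z.1 == Some Breal) || (by_ z.2 == Some Breal).

(** Cells of letters already follow the solvable model. For two letters of Z^+ the geometric count
    of parameter [s] is positive with probability [s], the parameter of the strict Bernoulli
    cell. *)
Lemma nonreal_law a b : a != Some Breal -> b != Some Breal -> a != None \/ b != None ->
  (if block_weak a && block_weak b then count_mass pp pm alpha am a b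
   else bern01 (1 - count_mass pp pm alpha am a b 0)) =
  cell_law (block_weak a) (block_weak b) (block_param pp alpha a * block_param pm am b).
Proof.
have q0 (p : param R) (z : R) k : 0 < z -> 0 <= z * pq p k.
  by move=> z0; rewrite mulr_ge0 ?pq_ge0// ltW.
have qr0 (p p' : param R) k l : 0 <= pq p k * pr p' l by rewrite mulr_ge0 ?pq_ge0 ?pr_ge0.
have F (x y : R) : 0 <= x -> x = y -> 1 - 1 / (1 + x) = y / (1 + y).
  by move=> x0 <-; field; rewrite gt_eqF//; lra.
move=> na nb ab; rewrite /cell_law.
case: a na ab => [[|i|i]|] na ab; case: b nb ab => [[|j|j]|] nb ab /=;
  try (by case/eqP: na); try (by case/eqP: nb).
- by congr bern01; rewrite /geom_mass expr0; ring.
- by congr bern01; apply: F.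
- by congr bern01; apply: F; [exact: q0|rewrite mulrC].
- by congr bern01; apply: F; rewrite // mulrC.
- by [].
- by rewrite mulrC.
- by congr bern01; apply: F; [exact: q0|].
- by [].
- by case: ab => /eqP.
Qed.

Lemma weight_law_nonreal rho i j : ~~ real_cell (i, j) ->
  law (i, j) = model_law rho i j.
Proof.
rewrite /real_cell /= => nr; have := nr; rewrite negb_or => /andP[nx ny].
rewrite /model_law /slot_par (negbTE nx) (negbTE ny).
have [/andP[/eqP-> /eqP->]//|ij] := boolP ((i == 0%N) && (j == 0%N)).
rewrite /weight_law /both_weak /cell_void [(i, j).1]/= [(i, j).2]/= (negbTE nr) !slot_weakE.
apply: nonreal_law => //; move: ij; rewrite negb_and => /orP[|] h; [left|right].
- by apply: contra h => /eqP; case: (i).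
- by apply: contra h => /eqP; case: (j).
Qed.

Lemma real_cell_neq0 i j : real_cell (i, j) -> ~~ ((i == 0%N) && (j == 0%N)).
Proof.
apply: contraTN => /andP[/eqP -> /eqP ->]; rewrite /real_cell negb_or.
by apply/andP; split; apply/eqP.
Qed.

Let real_void i j := real_cell (i, j) ->
  law (i, j) = bern01 (1 - expR (- (block_param pp alpha (bx i) * block_param pm am (by_ j)
     * (slot_len m lep i * slot_len m lem j)))).

Lemma weight_law_real i j : real_void i j.
Proof.
move=> rc; rewrite /weight_law /cell_void.
rewrite ifN; last by apply/negP => /both_weak_nonreal/negP.
by rewrite ifT.
Qed.

Variable delta : R.
Hypotheses (d0 : 0 <= delta) (d2 : delta <= 2^-1).
Hypothesis real_small_x : forall s, bx s == Some Breal -> pt pp * slot_len m lep s <= delta.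
Hypothesis real_small_y : forall s, by_ s == Some Breal -> pt pm * slot_len m lem s <= delta.
Hypothesis real_small_xb : forall s b, bx s == Some Breal -> b != Some Breal ->
  pt pp * slot_len m lep s * block_param pm am b <= delta.
Hypothesis real_small_yb : forall s a, by_ s == Some Breal -> a != Some Breal ->
  pt pm * slot_len m lem s * block_param pp alpha a <= delta.

Let d1 : delta <= 1. Proof. by apply: le_trans d2 _; rewrite invf_le1 ?ler1n. Qed.

Let void_rate i j := block_param pp alpha (bx i) * block_param pm am (by_ j)
     * (slot_len m lep i * slot_len m lem j).

Lemma void_rate_bounds i j : real_cell (i, j) -> 0 <= void_rate i j <= delta.
Proof.
move=> rc; apply/andP; split.
  by rewrite !mulr_ge0 ?slot_len_ge0//; apply: block_param_ge0; exact: ltW.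
have tx0 : 0 <= pt pp * slot_len m lep i by rewrite mulr_ge0 ?pt_ge0 ?slot_len_ge0.
have ty0 : 0 <= pt pm * slot_len m lem j by rewrite mulr_ge0 ?pt_ge0 ?slot_len_ge0.
rewrite /void_rate mulrACA; have [xr|xr] := boolP (bx i == Some Breal).
  have := real_small_x xr; rewrite (eqP xr) /= => hx.
  have [yr|yr] := boolP (by_ j == Some Breal).
    have := real_small_y yr; rewrite (eqP yr) /= => hy.
    by apply: le_trans hx; rewrite ler_piMr//; exact: le_trans hy d1.
  by rewrite [slot_len m lem j]/slot_len (negbTE yr) mulr1; exact: real_small_xb.
have yr : by_ j == Some Breal by move: rc; rewrite /real_cell /= (negbTE xr).
rewrite [slot_len m lep i]/slot_len (negbTE xr) mulr1 mulrC (eqP yr) /=.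
exact: real_small_yb.
Qed.

(** One factor [rho] for each real coordinate; in either case the parameter lies on the side of the
    rate that [rho] dictates. *)
Lemma real_par rho i j : real_cell (i, j) -> 0 <= rho ->
  px rho i * py rho j = void_rate i j * rho \/
  px rho i * py rho j = void_rate i j * rho * rho.
Proof.
rewrite /real_cell /= /void_rate /slot_par => rc r0.
case: ifPn rc => xr; case: ifPn => yr //= _.
- by right; rewrite (eqP xr) (eqP yr) /=; ring.
- by left; rewrite (eqP xr) [slot_len m lem j]/slot_len (negbTE yr) /=; ring.
- by left; rewrite (eqP yr) [slot_len m lep i]/slot_len (negbTE xr) /=; ring.
Qed.

Lemma real_not_weak i j : real_cell (i, j) -> ~~ (wx i && wy j).
Proof.
by move=> rc; apply/negP => h; have /negP[] := @both_weak_nonreal R lep lem m (i, j) h.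
Qed.

Let rho_lo := (1 + delta)^-1.
Let rho_hi := (1 - delta)^-1.

Let rho_lo01 : 0 <= rho_lo <= 1.
Proof.
have d0' := d0; apply/andP; split; first by rewrite invr_ge0; lra.
by rewrite invf_le1; lra.
Qed.

Let rho_hi1 : 1 <= rho_hi.
Proof. by have d0' := d0; have d2' := d2; rewrite invf_ge1; lra. Qed.

Let rho_hi2 : delta * rho_hi <= 1.
Proof. by have d0' := d0; have d2' := d2; rewrite ler_pdivrMr; lra. Qed.

(** Checks the hypotheses of [lpp_mean]: the bounds on alpha serve the weak letters, [QQ] the pairs
    of letters of Z^+, and the smallness of real slots the remaining strict pairs. *)
Lemma model_law_mean rho : 0 <= rho -> delta * rho <= 1 ->
  (ER (grid_laws (model_law rho) N N)
     (fun ss => (lpp wx wy (weight_of ss) N N)%:R%:E) =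
  (\sum_(i <- iota 0 N.-1) cell_mean (wx i.+1) (px rho i.+1 * am) +
   \sum_(j <- iota 0 N.-1) cell_mean (wy j.+1) (alpha * py rho j.+1))%:E)%E /\
  (forall i j, is_mass (model_law rho i j)).
Proof.
move=> r0 rd.
have par0 i : 0 <= px rho i by apply: slot_par_ge0 => //; exact: ltW.
have par0' i : 0 <= py rho i by apply: slot_par_ge0 => //; exact: ltW.
have pxd i : bx i == Some Breal -> px rho i <= 1.
  move=> xr; rewrite /slot_par xr; apply: le_trans rd.
  by rewrite ler_wpM2r// real_small_x.
have pyd i : by_ i == Some Breal -> py rho i <= 1.
  move=> yr; rewrite /slot_par yr; apply: le_trans rd.
  by rewrite ler_wpM2r// real_small_y.
have hx i : (0 < i)%N -> wx i -> px rho i * am < 1.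
  rewrite slot_weakE /slot_par; case E : (bx i) => [[|k|k]|] //= i0 _; last by case: (i) i0 E.
  rewrite ifN; last by apply/eqP.
  by rewrite ltr_pdivrMr// mul1r; exact: le_lt_trans (pr_le_supR pp k) Ra.
have hy j : (0 < j)%N -> wy j -> alpha * py rho j < 1.
  rewrite slot_weakE /slot_par; case E : (by_ j) => [[|k|k]|] //= j0 _; last by case: (j) j0 E.
  rewrite ifN; last by apply/eqP.
  by apply: le_lt_trans aR; rewrite ler_wpM2l ?pr_le_supR// ltW.
have hxy i j : ~~ (wx i || wy j) -> px rho i * py rho j <= 1.
  rewrite negb_or !slot_weakE => /andP[wi wj].
  have [xr|xr] := boolP (bx i == Some Breal).
    have [yr|yr] := boolP (by_ j == Some Breal).
      by rewrite mulr_ile1// ?pxd ?pyd.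
    have -> : px rho i * py rho j = pt pp * slot_len m lep i * block_param pm am (by_ j) * rho.
      by rewrite /slot_par xr (negbTE yr); ring.
    by apply: le_trans rd; rewrite ler_wpM2r// real_small_xb.
  have [yr|yr] := boolP (by_ j == Some Breal).
    have -> : px rho i * py rho j = pt pm * slot_len m lem j * block_param pp alpha (bx i) * rho.
      by rewrite /slot_par yr (negbTE xr); ring.
    by apply: le_trans rd; rewrite ler_wpM2r// real_small_yb.
  rewrite /slot_par (negbTE xr) (negbTE yr).
  case: (bx i) wi xr => [[|k|k]|] //= _ xr; first by case/eqP: xr.
  case: (by_ j) wj yr => [[|l|l]|] //= _ yr; first by case/eqP: yr.
  apply: ltW; apply: le_lt_trans QQ.
  by rewrite ler_pM ?pq_ge0 ?pq_le_supQ.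
have px0 : px rho 0 = alpha.
  by rewrite /slot_par; have -> : (bx 0 == Some Breal) = false by apply/eqP.
have py0 : py rho 0 = am.
  by rewrite /slot_par; have -> : (by_ 0 == Some Breal) = false by apply/eqP.
split.
  have h0 : 0 < px rho 0 by rewrite px0.
  have h1 : px rho 0 * py rho 0 = 1 by rewrite px0 py0 divff// gt_eqF.
  have h2 i : (0 < i <= N.-1)%N -> 0 <= px rho i /\ (wx i -> px rho i * py rho 0 < 1).
    by move=> /andP[i0 _]; split => //; rewrite py0; exact: hx.
  have h3 j : (0 < j <= N.-1)%N -> 0 <= py rho j /\ (wy j -> px rho 0 * py rho j < 1).
    by move=> /andP[i0 _]; split => //; rewrite px0; exact: hy.
  have := @lpp_mean R wx wy (px rho) (py rho) N.-1 N.-1 erefl erefl h0 h1 h2 h3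
    (fun i j _ _ => @hxy i j).
  by rewrite px0 py0; exact.
move=> i j; rewrite /model_law; case: ifPn => ij; first exact: zero_mass_is_mass.
apply: cell_law_is_mass; first by rewrite mulr_ge0.
  move=> /andP[wi wj].
  case: i ij wi => [|i] ij wi; first by case: j ij wj => // j _ wj; rewrite px0; exact: hy.
  case: j ij wj => [|j] ij wj; first by rewrite py0; exact: hx.
  have -> : px rho i.+1 * py rho j.+1 = (px rho i.+1 * am) * (alpha * py rho j.+1).
    by field; rewrite gt_eqF.
  by rewrite mulr_ilt1 ?hx ?hy// mulr_ge0// ltW.
exact: hxy.
Qed.

Lemma grid_lambda_upper :
  (\int[P]_w (grid_lambda S lep lem m w)%:R%:E <=
   (\sum_(i <- iota 0 N.-1) cell_mean (wx i.+1) (px rho_hi i.+1 * am) +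
    \sum_(j <- iota 0 N.-1) cell_mean (wy j.+1) (alpha * py rho_hi j.+1))%:E)%E.
Proof.
have r0 : 0 <= rho_hi by apply: le_trans rho_hi1.
have [<- mm] := model_law_mean r0 rho_hi2.
rewrite integral_grid_lambda; apply: grid_st_le => i j iN jN; split => //.
  exact: weight_law_is_mass.
have [rc|rc] := boolP (real_cell (i, j)); last first.
  by rewrite (weight_law_nonreal rho_hi rc); exact: st_le_refl.
have /andP[v0 vd] := void_rate_bounds rc.
rewrite (weight_law_real rc) /model_law ifN; last first.
  exact: real_cell_neq0.
have m1 := mm i j.
apply: (void_law_upper (delta := delta)) => //.
- exact: real_not_weak.
- by rewrite v0.
- by have d2' := d2; lra.
- have := real_par rc r0; rewrite -/(void_rate i j) => -[->//|->].
  by rewrite ler_peMr// mulr_ge0.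
- move=> nw.
  have [_ mj] := model_law_mean r0 rho_hi2.
  have := (mj i j).1 1%N; have := (mj i j).1 0%N.
  rewrite /model_law ifN; last first.
    exact: real_cell_neq0.
  move: nw; rewrite /cell_law negb_or => /andP[/negbTE -> /negbTE ->] /=.
  by rewrite subr_ge0.
Qed.

Lemma grid_lambda_lower :
  ((\sum_(i <- iota 0 N.-1) cell_mean (wx i.+1) (px rho_lo i.+1 * am) +
    \sum_(j <- iota 0 N.-1) cell_mean (wy j.+1) (alpha * py rho_lo j.+1))%:E <=
  \int[P]_w (grid_lambda S lep lem m w)%:R%:E)%E.
Proof.
have [r0 r1] := andP rho_lo01.
have rd : delta * rho_lo <= 1 by have d0' := d0; rewrite ler_pdivrMr; lra.
have [<- mm] := model_law_mean r0 rd.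
rewrite integral_grid_lambda; apply: grid_st_le => i j iN jN; split => //.
  exact: weight_law_is_mass.
have [rc|rc] := boolP (real_cell (i, j)); last first.
  by rewrite (weight_law_nonreal rho_lo rc); exact: st_le_refl.
have /andP[v0 vd] := void_rate_bounds rc.
rewrite (weight_law_real rc) /model_law ifN; last first.
  exact: real_cell_neq0.
apply: (void_law_lower (delta := delta)) => //.
- exact: real_not_weak.
- by rewrite mulr_ge0// slot_par_ge0// ltW.
- by rewrite v0.
- have := real_par rc r0; rewrite -/(void_rate i j) => -[->//|->].
  by rewrite ler_piMr// mulr_ge0.
Qed.

End sandwich.

(** * The limit *)

Lemma measurable_grid_lambda (R : realType) (d : measure_display)
    (T : measurableType d) (P : probability T R) (pp pm : param R) (ap am : R)
    (S : sampling P pp pm ap am) (lep lem : rel (Omega R))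
    (lepP : alphabet_order lep) (lemP : alphabet_order lem)
    (ap0 : 0 <= ap) (am0 : 0 <= am) (m : nat) :
  measurable_fun setT (fun w => (grid_lambda S lep lem m w)%:R%:E : \bar R).
Proof.
pose n := slot_count R m.
pose J := [seq (i, j) | i <- iota 0 n, j <- iota 0 n].
pose f (s : seq nat) : \bar R := (lpp (slot_weak lep m) (slot_weak lem m)
  (fun i j => nth 0%N s (index (i, j) J)) n n)%:R%:E.
have -> : (fun w => (grid_lambda S lep lem m w)%:R%:E : \bar R) =
    (fun w => f [seq cell_weight S lep lem m z w | z <- J]).
  apply/funext => w; congr (_%:R%:E); apply: lpp_ext => i j iN jN.
  have ij : (i, j) \in J by apply: allpairs_f; rewrite mem_iota.
  by rewrite (nth_map (0%N, 0%N)) ?index_mem// nth_index.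
apply: measurable_fun_weights => // z c.
exact: measurable_cell_weight.
Qed.

Lemma limn_einf_le (R : realType) (u v : (\bar R)^nat) (l : \bar R) :
  (\forall n \near \oo, u n <= v n)%E -> v @ \oo --> l -> (limn_einf u <= l)%E.
Proof.
move=> uv vl; rewrite limn_einf_lim -(cvg_lim _ vl)//; apply: lee_lim.
- exact: is_cvg_einfs.
- by apply/cvg_ex; exists l.
- near=> n; apply: (@le_trans _ _ (u n)); last by near: n.
  by apply: ereal_inf_lbound; exists n => /=.
Unshelve. all: by end_near.
Qed.

Lemma limn_einf_ge (R : realType) (u : (\bar R)^nat) (x : \bar R) (n0 : nat) :
  (forall n, (n0 <= n)%N -> x <= u n)%E -> (x <= limn_einf u)%E.
Proof.
move=> xu; rewrite limn_einf_lim; apply: lime_ge; first exact: is_cvg_einfs.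
near=> n; apply: le_ereal_inf_tmp => _ [k /= nk <-]; apply: xu.
by apply: leq_trans nk; near: n; exact: nbhs_infty_ge.
Unshelve. all: by end_near.
Qed.

Section limit.
Context (R : realType) (d : measure_display) (T : measurableType d)
  (P : probability T R) (pp pm : param R) (alpha : R)
  (S : sampling P pp pm alpha alpha^-1) (lep lem : rel (Omega R)).
Hypotheses (lepP : alphabet_order lep) (lemP : alphabet_order lem).
Hypotheses (a0 : 0 < alpha) (QQ : supQ pp * supQ pm < 1)
  (Ra : supR pp < alpha) (aR : alpha * supR pm < 1).

Local Notation am := (alpha^-1).
Let am0 : 0 < am. Proof. by rewrite invr_gt0. Qed.

Lemma supQ_ge0 (p : param R) : 0 <= supQ p.
Proof. by apply: le_trans (pq_le_supQ p 0); exact: pq_ge0. Qed.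

Lemma supR_ge0 (p : param R) : 0 <= supR p.
Proof. by apply: le_trans (pr_le_supR p 0); exact: pr_ge0. Qed.

Let B := 1 + pt pp + pt pm + supQ pp + supQ pm + supR pp + supR pm + alpha + am.

Let B_bounds : [/\ 1 <= B, pt pp <= B, pt pm <= B,
  forall b, b != Some Breal -> block_param pm am b <= B &
  forall a, a != Some Breal -> block_param pp alpha a <= B].
Proof.
have := pt_ge0 pp; have := pt_ge0 pm; have := supQ_ge0 pp; have := supQ_ge0 pm.
have := supR_ge0 pp; have := supR_ge0 pm; have := a0; have := am0.
rewrite /B => ? ? ? ? ? ? ? ?; split; [lra|lra|lra| |].
  case=> [[|k|k]|] /= h; first by case/eqP: h.
  - by have := pq_le_supQ pm k; lra.
  - by have := pr_le_supR pm k; lra.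
  - by lra.
case=> [[|k|k]|] /= h; first by case/eqP: h.
- by have := pq_le_supQ pp k; lra.
- by have := pr_le_supR pp k; lra.
- by lra.
Qed.

(** A real slot has length at most 2/m and [B] dominates the other parameters, so [B * (2 / m) * B]
    bounds the products in question. *)
Let delta (m : nat) : R := 2 * B ^+ 2 / m%:R.

Let delta_cvg : delta m @[m --> \oo] --> 0.
Proof.
rewrite -(mulr0 (2 * B ^+ 2)); apply: cvgM; first exact: cvg_cst.
have h := @cvg_harmonic R.
by rewrite -cvg_shiftS; exact: h.
Qed.

Let S1 := log_series pp am.
Let S2 := log_series pm alpha.
Let V := am * (pt pp + S1) + alpha * (pt pm + S2).

Let bound (rho : nat -> R) (m : nat) : R :=
  (am * series (log_term pp am) m + am * pt pp * rho m) +
  (alpha * series (log_term pm alpha) m + alpha * pt pm * rho m).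

Let gap : am * supR pp < 1.
Proof. by rewrite mulrC ltr_pdivrMr// mul1r. Qed.

Let bound_cvg (rho : nat -> R) : rho m @[m --> \oo] --> (1 : R) ->
  bound rho m @[m --> \oo] --> V.
Proof.
move=> rho1.
have -> : V = (am * S1 + am * pt pp * 1) + (alpha * S2 + alpha * pt pm * 1).
  by rewrite /V; ring.
have c1 : series (log_term pp am) @ \oo --> S1 by apply: log_series_cvg.
have c2 : series (log_term pm alpha) @ \oo --> S2 by apply: log_series_cvg.
by apply: cvgD; apply: cvgD; apply: cvgM => //; exact: cvg_cst.
Qed.

(** The lower bound loses [1 + delta] twice: once in the parameter of a real slot, once because its
    mean is [p / (1 + p)] instead of [p] ([real_mean_ge]). *)
Lemma sandwich_bounds m : (0 < m)%N -> delta m <= 2^-1 ->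
  ((bound (fun m => (1 + delta m)^-1 / (1 + delta m)) m)%:E <=
    \int[P]_w (grid_lambda S lep lem m w)%:R%:E)%E /\
  (\int[P]_w (grid_lambda S lep lem m w)%:R%:E <=
    (bound (fun m => (1 - delta m)^-1) m)%:E)%E.
Proof.
move=> m0 dm; have [B1 Bp Bm Bb Ba] := B_bounds.
have mR : 0 < m%:R :> R by rewrite ltr0n.
have B0 : 0 <= B by apply: le_trans B1.
have d0 : 0 <= delta m by rewrite divr_ge0// mulr_ge0// sqr_ge0.
have small (le : rel (Omega R)) (leP : alphabet_order le) (t b : R) s :
      0 <= t -> t <= B -> 0 <= b -> b <= B ->
    slot_block le m s == Some Breal -> t * slot_len m le s * b <= delta m.
  move=> t0 tB b0 bB sr.
  have l0 := slot_len_ge0 m le s; have l2 := slot_len_le leP m0 sr.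
  have -> : delta m = B * (2 / m%:R) * B by rewrite /delta; ring.
  by apply: ler_pM => //; [exact: mulr_ge0|exact: ler_pM].
have xb s b : slot_block lep m s == Some Breal -> b != Some Breal ->
    pt pp * slot_len m lep s * block_param pm am b <= delta m.
  by move=> sr nb; apply: small => //; [exact: pt_ge0|apply: block_param_ge0; exact: ltW|exact: Bb].
have yb s a : slot_block lem m s == Some Breal -> a != Some Breal ->
    pt pm * slot_len m lem s * block_param pp alpha a <= delta m.
  by move=> sr na; apply: small => //; [exact: pt_ge0|apply: block_param_ge0; exact: ltW|exact: Ba].
have xs s : slot_block lep m s == Some Breal -> pt pp * slot_len m lep s <= delta m.
  by move=> sr; rewrite -[leLHS]mulr1; apply: small => //; exact: pt_ge0.
have ys s : slot_block lem m s == Some Breal -> pt pm * slot_len m lem s <= delta m.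
  by move=> sr; rewrite -[leLHS]mulr1; apply: small => //; exact: pt_ge0.
have [l1 l2] := slot_len_sum S lepP lemP m.
have swap rho : \sum_(j <- iota 0 (slot_count R m).-1)
      cell_mean (slot_weak lem m j.+1) (alpha * slot_par lem m pm am rho j.+1) =
    \sum_(j <- iota 0 (slot_count R m).-1)
      cell_mean (slot_weak lem m j.+1) (slot_par lem m pm am rho j.+1 * alpha).
  by apply: eq_bigr => j _; rewrite mulrC.
have a1 := ltW a0; have am1 := ltW am0.
split.
  apply: le_trans (grid_lambda_lower S lepP lemP a0 QQ Ra aR d0 dm xs ys xb yb).
  rewrite swap !slot_mean_sum// lee_fin /bound.
  have r01 : 0 <= (1 + delta m)^-1 <= 1.
    by apply/andP; split; [rewrite invr_ge0; lra|rewrite invf_le1; lra].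
  apply: lerD; rewrite lerD2l mulrA.
    by apply: real_mean_ge => // s sr; apply: (xb s None) => //; apply/eqP.
  by apply: real_mean_ge => // s sr; apply: (yb s None) => //; apply/eqP.
apply: le_trans (grid_lambda_upper S lepP lemP a0 QQ Ra aR d0 dm xs ys xb yb) _.
rewrite swap !slot_mean_sum// lee_fin /bound.
have r0 : 0 <= (1 - delta m)^-1 by rewrite invr_ge0; lra.
by apply: lerD; rewrite lerD2l; apply: real_mean_le.
Qed.

Let near_small : \forall m \near \oo, (0 < m)%N /\ delta m <= 2^-1.
Proof.
near=> m; split; first by near: m; exact: nbhs_infty_gt.
near: m; move/cvgrPdist_le : delta_cvg => /(_ 2^-1).
rewrite invr_gt0 ltr0n => /(_ isT); apply: filterS => m.
by rewrite sub0r normrN => /ler_normlW.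
Unshelve. all: by end_near.
Qed.

Let rho_cvg (s : R) : (1 + s * delta m)^-1 @[m --> \oo] --> (1 : R).
Proof.
have h : 1 + s * delta m @[m --> \oo] --> 1 + s * 0.
  by apply: cvgD; [exact: cvg_cst|apply: cvgM => //; exact: cvg_cst].
rewrite mulr0 addr0 in h.
by rewrite -[X in _ --> X]invr1; apply: cvgV h; exact: oner_neq0.
Qed.

Lemma lambda1_ge0 w : (0 <= lambda1 lep lem S w)%E.
Proof.
by apply: le_trans (grid_lambda_le S lepP lemP 0 w); rewrite lee_fin ler0n.
Qed.

(** Off a null set [lambda1] is at most the lower limit of the passage times, which is measurable,
    so Fatou's lemma bounds the integral above; each passage time is at most [lambda1], which bounds
    it below. *)
Lemma mean_lambda1 : (\int[P]_w lambda1 lep lem S w = V%:E)%E.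
Proof.
pose G m w : \bar R := (grid_lambda S lep lem m w)%:R%:E.
have G0 m w : (0 <= G m w)%E by rewrite lee_fin ler0n.
have lo_cvg : bound (fun m => (1 + delta m)^-1 / (1 + delta m)) m @[m --> \oo] --> V.
  apply: bound_cvg; rewrite -[X in _ --> X]mulr1.
  have h : (1 + delta m)^-1 @[m --> \oo] --> (1 : R).
    by have := rho_cvg 1; under eq_fun do rewrite mul1r.
  by apply: cvgM.
have hi_cvg : bound (fun m => (1 - delta m)^-1) m @[m --> \oo] --> V.
  by apply: bound_cvg; have := rho_cvg (-1); under eq_fun do rewrite mulN1r.
have mG m : measurable_fun setT (G m).
  by apply: measurable_grid_lambda => //; exact: ltW.
have measurable_liminf : measurable_fun setT (fun w => limn_einf (G ^~ w)).
  have -> : (fun w => limn_einf (G ^~ w)) =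
      (fun w => - limn_esup (fun m => - G m w))%E.
    by apply/funext => w; rewrite -[RHS]/(- limn_esup (-%E \o G ^~ w))%E limn_esupN oppeK.
  apply: measurableT_comp => //; apply: measurable_fun_limn_esup => m.
  exact: measurableT_comp.
apply/eqP; rewrite eq_le; apply/andP; split.
  apply: (@le_trans _ _ (\int[P]_w limn_einf (G ^~ w))%E).
    apply: (ae_ge0_le_integral_upper (N := [set w | ~ distinct_points S w])).
    - exact: lambda1_ge0.
    - by move=> w; apply: (limn_einf_ge (n0 := 0)) => n _; exact: G0.
    - exact: measurable_liminf.
    - exact: (distinct_points_ae S lepP lemP).
    - move=> w /contrapT dw; apply: ge_ereal_sup => _ [s [ms inc] <-].
      have [m0 hm] := grid_lambda_ge lepP lemP dw ms inc.
      by apply: (limn_einf_ge (n0 := m0)) => m /hm; rewrite lee_fin ler_nat.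
  apply: le_trans (fatou P measurableT _ _) _ => //.
  apply: (limn_einf_le (v := fun m => (bound (fun m => (1 - delta m)^-1) m)%:E)).
    by apply: filterS near_small => m [m0 dm]; have [] := sandwich_bounds m0 dm.
  exact: (cvg_comp _ _ hi_cvg).
have lo' : (bound (fun m => (1 + delta m)^-1 / (1 + delta m)) m)%:E @[m --> \oo] --> V%:E.
  exact: (cvg_comp _ _ lo_cvg).
rewrite -(cvg_lim _ lo')//; apply: lime_le; first by apply/cvg_ex; exists V%:E.
apply: filterS near_small => m [m0 dm].
have [lo _] := sandwich_bounds m0 dm; apply: le_trans lo _.
apply: ge0_le_integral_lower => w; first exact: G0.
exact: grid_lambda_le.
Qed.

End limit.

Theorem corollary3p3 (R : realType) (pp pm : param R) (alpha : R)
    (compat : compatible pp pm)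
    (alpha_gt : supR pp < alpha)
    (alpha_lt : (alpha%:E < ((supR pm)%:E)^-1)%E)
    (lep lem : rel (Omega R))
    (lepP : alphabet_order lep) (lemP : alphabet_order lem)
    (d : measure_display) (T : measurableType d) (P : probability T R)
    (S : sampling P pp pm alpha alpha^-1) :
  (\int[P]_w lambda1 lep lem S w)%E =
  (alpha * derive1 (Egen pm) alpha / Egen pm alpha +
   alpha^-1 * derive1 (Egen pp) alpha^-1 / Egen pp alpha^-1)%:E.
Proof.
have a0 : 0 < alpha by apply: le_lt_trans alpha_gt; exact: supR_ge0.
(* If [supR pm] is 0, its inverse is [+oo] and the product is 0. *)
have aR : alpha * supR pm < 1.
  have := supR_ge0 pm; rewrite le_eqVlt => /predU1P[<-|R0]; first by rewrite mulr0.
  move: alpha_lt; rewrite /inve gt_eqF// lte_fin => h.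
  by rewrite -ltr_pdivlMr// div1r.
have Ra : alpha^-1 * supR pp < 1 by rewrite mulrC ltr_pdivrMr// mul1r.
have am0 : 0 < alpha^-1 by rewrite invr_gt0.
rewrite (mean_lambda1 S lepP lemP a0 compat.1 alpha_gt aR).
rewrite -!mulrA (log_derivative_Egen a0 aR) (log_derivative_Egen am0 Ra).
by rewrite addrC.
Qed.
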